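(* Let $\mathbb{F}$ be a field with characteristic $2$ such that $|\mathbb{F}|>2$. Let $\mathcal{S}$ be an optimal $2$-spec linear subspace of $\operatorname{M}_4(\mathbb{F})$. Then $\mathcal{S}$ is similar to $\mathfrak{sl}_2(\mathbb{F}) \vee \mathfrak{sl}_2(\mathbb{F})$ or to $\mathcal{B}_4(\mathbb{F})$.
   Context: A linear subspace $\mathcal{S}$ of $\operatorname{M}_n(\mathbb{F})$ is called $2$-spec if every matrix in $\mathcal{S}$ has at most two distinct eigenvalues in $\mathbb{F}$. A $2$-spec linear subspace is optimal if it has the greatest possible dimension among the $2$-spec linear subspaces of $\operatorname{M}_n(\mathbb{F})$ (here $n=4$). Two subsets $\mathcal{V},\mathcal{W}$ of $\operatorname{M}_n(\mathbb{F})$ are similar if $\mathcal{W}=P\mathcal{V}P^{-1}$ for some $P\in \operatorname{GL}_n(\mathbb{F})$. $\mathfrak{sl}_2(\mathbb{F})$ is the space of trace-zero matrices of $\operatorname{M}_2(\mathbb{F})$. For subsets $\mathcal{A}\subseteq\operatorname{M}_n(\mathbb{F})$ and $\mathcal{C}\subseteq \operatorname{M}_p(\mathbb{F})$, the joint $\mathcal{A}\vee\mathcal{C}$ is the set of all matrices $\begin{bmatrix} A & B\\ 0 & C\end{bmatrix}$ with $A\in\mathcal{A}$, $C\in\mathcal{C}$ and $B\in\operatorname{M}_{n,p}(\mathbb{F})$. $\mathcal{B}_4(\mathbb{F})$ is the space of all matrices $\begin{bmatrix} A & S_2\\ S_1 & -A^T\end{bmatrix}$ with $A\in \operatorname{M}_2(\mathbb{F})$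 and $S_1,S_2$ symmetric matrices in $\operatorname{M}_2(\mathbb{F})$. *)

(* Defs.v *)
From mathcomp Require Import all_boot all_order all_algebra.

Set Implicit Arguments.
Unset Strict Implicit.
Unset Printing Implicit Defensive.

Import GRing.Theory.
Local Open Scope ring_scope.

(* [T] may be infinite, so [#|T|] is not available. *)
Definition card_gt (T : eqType) (k : nat) : Prop :=
  exists2 s : seq T, uniq s & (k < size s)%N.

(* [eigenvalue] tests for row eigenvectors, which yields the same eigenvalues
   in [F] as column eigenvectors (both are the roots of [char_poly A]). *)
Definition at_most_eigenvalues (F : fieldType) (n k : nat) (A : 'M[F]_n) : Prop :=
  forall s : seq F, uniq s -> all (eigenvalue A) s -> (size s <= k)%N.

Definition two_spec (F : fieldType) (n : nat) (S : {vspace 'M[F]_n}) : Prop :=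
  forall A : 'M[F]_n, A \in S -> at_most_eigenvalues 2 A.

Definition optimal_two_spec (F : fieldType) (n : nat) (S : {vspace 'M[F]_n}) : Prop :=
  two_spec S /\
  forall T : {vspace 'M[F]_n}, two_spec T -> (\dim T <= \dim S)%N.

Definition similar_sets (F : fieldType) (n : nat) (V W : {pred 'M[F]_n}) : Prop :=
  exists2 P : 'M[F]_n, P \in unitmx &
    forall M : 'M[F]_n,
      M \in W <-> (exists2 A : 'M[F]_n, A \in V & M = P *m A *m invmx P).

Definition sl (F : fieldType) (n : nat) : {pred 'M[F]_n} :=
  [pred A : 'M[F]_n | \tr A == 0].

Definition joint (F : fieldType) (n p : nat) (A : {pred 'M[F]_n})
    (C : {pred 'M[F]_p}) : {pred 'M[F]_(n + p)} :=
  [pred M : 'M[F]_(n + p) |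
    [&& ulsubmx M \in A, drsubmx M \in C & dlsubmx M == 0]].

Definition B4 (F : fieldType) : {pred 'M[F]_(2 + 2)} :=
  [pred M : 'M[F]_(2 + 2) |
    [&& drsubmx M == - (ulsubmx M)^T,
        (dlsubmx M)^T == dlsubmx M & (ursubmx M)^T == ursubmx M]].

Arguments sl F n : clear implicits.
Arguments B4 F : clear implicits.

Lemma jointP (F : fieldType) (n p : nat) (A : {pred 'M[F]_n})
    (C : {pred 'M[F]_p}) (M : 'M[F]_(n + p)) :
  reflect (exists X B Y, [/\ X \in A, Y \in C & M = block_mx X B 0 Y])
          (M \in joint A C).
Proof.
apply: (iffP and3P) => [[AX CY /eqP M0]|[X [B [Y [AX CY ->]]]]].
  exists (ulsubmx M), (ursubmx M), (drsubmx M); split=> //.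
  by rewrite -M0 submxK.
by rewrite block_mxKul block_mxKdr block_mxKdl.
Qed.

Lemma B4P (F : fieldType) (M : 'M[F]_(2 + 2)) :
  reflect (exists A S1 S2 : 'M[F]_2,
             [/\ S1^T = S1, S2^T = S2 & M = block_mx A S2 S1 (- A^T)])
          (M \in B4 F).
Proof.
apply: (iffP and3P) => [[/eqP dr /eqP dl /eqP ur]|[A [S1 [S2 [s1 s2 ->]]]]].
  exists (ulsubmx M), (dlsubmx M), (ursubmx M); split=> //.
  by rewrite -dr submxK.
by rewrite block_mxKul block_mxKur block_mxKdl block_mxKdr s1 s2.
Qed.

(* Main.v *)
(* Let [S] be a 2-spec space of dimension 10 and let [T], of dimension 6, be its
   orthogonal for the form [tr (B M)].  For every basis, the triangular matrices
   of [S] have at most two distinct diagonal coordinate forms, because [F] has at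
   least four elements; dually, the index set splits into two classes such that
   [T] contains, for any two distinct indices [i], [j] in the same class, a
   triangular matrix with diagonal [e_i + e_j].  This is the only information on
   [T] used afterwards; it bounds from below the dimension of what [T] induces
   along a flag.
   Matrices act on row vectors.  It follows that [x T] is never the whole space,
   that [dim (x T) = 3] for some [x], and that then [x] belongs to [x T].  As the
   rank is maximal at [x], a matrix of [T] that kills [x] maps every vector into
   the hyperplane [x T], and a second-order condition yields a bilinear form on
   this hyperplane that is alternating on a plane, hence [0] or nondegenerate
   there.  If it is nondegenerate, then [T] is the space of matrices that are
   alternating for a symplectic form, whence [B_4].  If it vanishes at every such
   [x], then [T] leaves several hyperplanes invariant, which yields an invariant
   plane on which, as on the quotient, [T] acts by scalars; whence the joint. *)
From HB Require Import structures.
From Stdlib Require Import Classical_Prop.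
Require Import Defs.
From mathcomp Require Import all_boot all_order all_algebra ring.

Set Implicit Arguments.
Unset Strict Implicit.
Unset Printing Implicit Defensive.

Import GRing.Theory.
Local Open Scope ring_scope.

(** * Fields of characteristic 2 with at least four elements *)

(** The field may have exactly four elements, so no point can be taken generic. Every
    general-position argument is therefore reduced to one nonzero polynomial of degree at most 3 in
    one parameter. This is why the bound 3 on the rank of [x T] is established before any limit is
    taken, and why the limits use all points other than [x] of a projective line through [x],
    including the one at infinity. Characteristic 2 enters the duality: [e_i + e_j] pairs with [M]
    to [M i i + M j j], which vanishes exactly when the two diagonal entries agree. Equality of
    diagonal forms on the triangular part of [S] thus becomes existence of matrices in [T], and
    existence is what the dimension counts need. The count rests on 6 = 16 - 10: a vector with [x T]
    of dimension 3 is killed by a space of dimension 3, and two independent triangular matrices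
    already fill a space of dimension 2. *)

Notation i0 := (@Ordinal 4 0 isT).
Notation i1 := (@Ordinal 4 1 isT).
Notation i2 := (@Ordinal 4 2 isT).
Notation i3 := (@Ordinal 4 3 isT).

Lemma sum4 (V : nmodType) (f : 'I_4 -> V) :
  \sum_i f i = f i0 + f i1 + f i2 + f i3.
Proof.
rewrite !big_ord_recr big_ord0 /= add0r.
by congr (f _ + f _ + f _ + f _); apply: val_inj.
Qed.

Lemma ord4P (P : 'I_4 -> Prop) : P i0 -> P i1 -> P i2 -> P i3 -> forall i, P i.
Proof.
by move=> P0 P1 P2 P3 [[|[|[|[|i]]]] Hi] //;
   [move: P0|move: P1|move: P2|move: P3]; congr P; apply: val_inj.
Qed.

Section Field.
Variable F : fieldType.
Hypothesis char2 : 2%N \in [pchar F].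
Hypothesis cardF : card_gt F 2.

Lemma addr_eq0_2 (a b : F) : (a + b == 0) = (a == b).
Proof. by rewrite addr_eq0 (oppr_pchar2 char2). Qed.

Lemma four_elements : exists2 s : seq F, uniq s & size s = 4.
Proof.
case: cardF => [[|a [|b [|c s]]]] // /and4P[Ha Hb Hc _] _.
have [ab ac] : a != b /\ a != c by move: Ha; rewrite !inE !negb_or => /and3P[].
have bc : b != c by move: Hb; rewrite !inE negb_or => /andP[].
(* In characteristic 2 the sum of three distinct elements differs from each of them. *)
exists [:: a; b; c; a + b + c] => //=.
rewrite !inE !negb_or ab ac bc /= !andbT.
have h (x y z : F) : (x == x + (y + z)) = (y == z).
  by rewrite eq_sym -subr_eq0 addrAC subrr add0r addr_eq0_2.
have -> : a + b + c = b + (a + c) by rewrite addrCA addrA.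
by rewrite h ac addrCA h bc addrA addrC h ab.
Qed.

Lemma nonroot (p : {poly F}) : p != 0 -> (size p <= 4)%N -> exists t, ~~ root p t.
Proof.
move=> p0 sp; have [s us ss] := four_elements.
have [/allP rs|/allPn[t _ Ht]] := boolP (all (root p) s); last by exists t.
have := max_poly_roots p0 (introT allP rs) us.
by rewrite ss ltnNge sp.
Qed.

Lemma nonroot0 (p : {poly F}) :
  p != 0 -> (size p <= 3)%N -> exists2 t, t != 0 & p.[t] != 0.
Proof.
move=> p0 sp; have Xp0 : p * 'X != 0 by rewrite mulf_neq0 ?polyX_eq0.
have [|t] := nonroot Xp0; first by rewrite size_mulX.
by rewrite rootM rootX negb_or => /andP[Ht t0]; exists t.
Qed.

Lemma quadratic_nonroot (c0 c1 c2 : F) : [|| c0 != 0, c1 != 0 | c2 != 0] ->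
  exists2 t, t != 0 & c0 + t * (c1 + t * c2) != 0.
Proof.
move=> H; have [||t t0 Ht] := @nonroot0 (Poly [:: c0; c1; c2]).
- apply: contraL H => /eqP/polyP H.
  have E i : [:: c0; c1; c2]`_i = 0 by rewrite -coef_Poly H coef0.
  by rewrite (E 0 : c0 = 0) (E 1 : c1 = 0) (E 2 : c2 = 0) eqxx.
- exact: size_Poly.
exists t => //; move: Ht; rewrite horner_Poly /= mul0r add0r.
by rewrite -(mulrC t) addrC (addrC _ c1) -(mulrC t).
Qed.

(* The determinant of [X + t Y] completed by [w] is, up to normalisation, the
   reversed characteristic polynomial of a singular matrix of size [k]. *)
Lemma pencil k (X Y : 'M[F]_(k, 4)) (w : 'rV_4) :
  (k <= 3)%N ->
  (forall t, t != 0 -> ~~ row_free (col_mx (X + t *: Y) w)) ->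
  ~~ row_free (col_mx Y w) -> ~~ row_free (col_mx X w).
Proof.
move=> k3 Ht HY; apply/negP => /row_freeP[R].
rewrite mul_col_mx -[R]hsubmxK !mul_mx_row (scalar_mx_block _ _ 1) => /eq_block_mx.
set Rl := lsubmx R; set Rr := rsubmx R => -[XR XR0 wR0 wR].
have det0 Z : ~~ row_free (col_mx Z w) -> \det (Z *m Rl) = 0.
  move=> HZ; apply/eqP; apply: contraR HZ; rewrite -unitfE -unitmxE => HZ.
  have U : (col_mx Z w *m R) \in unitmx.
    rewrite unitmxE mul_col_mx -[R]hsubmxK !mul_mx_row -/Rl -/Rr wR0 wR.
    by rewrite det_ublock det1 mulr1 -unitmxE.
  by apply/row_freeP; exists (R *m invmx (col_mx Z w *m R)); rewrite mulmxA mulmxV.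
set N := Y *m Rl.
have [|u /negP[]] := nonroot (monic_neq0 (char_poly_monic N)).
  by rewrite size_char_poly.
rewrite rootE /char_poly -horner_evalE -det_map_mx /=.
have -> : map_mx (horner_eval u) (char_poly_mx N) = u%:M - N.
  apply/matrixP => i j; rewrite !mxE /horner_eval /= hornerD hornerN hornerC.
  by case: eqP; rewrite ?mulr1n ?mulr0n ?hornerX ?hornerC.
(* The root [u = 0] stands for the parameter at infinity and comes from [Y]; a root [u != 0] comes
   from [t = - u^-1]. *)
have [->|u0] := eqVneq u 0.
  by rewrite raddf0 sub0r -scaleN1r detZ det0 ?mulr0.
have -> : u%:M - N = u *: ((X - u^-1 *: Y) *m Rl).
  by rewrite mulmxBl XR scalerBr -scalemxAl scalerA divff // scale1r scalemx1.
by rewrite detZ -scaleNr det0 ?mulr0 // Ht // oppr_eq0 invr_eq0.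
Qed.
End Field.

(** * Row images of a space of matrices *)

Section Images.
Variable F : fieldType.
Implicit Types (T : {vspace 'M[F]_4}) (x v w : 'rV[F]_4).

Definition img T x : {vspace 'rV[F]_4} := (linfun (mulmx x) @: T)%VS.

Definition ann T x : {vspace 'M[F]_4} := (T :&: lker (linfun (mulmx x)))%VS.

Lemma imgP T x w : reflect (exists2 B, B \in T & w = x *m B) (w \in img T x).
Proof. by apply: (iffP memv_imgP) => -[B BT ->]; exists B => //; rewrite lfunE. Qed.

Lemma mem_img T x B : B \in T -> x *m B \in img T x.
Proof. by move=> BT; apply/imgP; exists B. Qed.

Lemma annP T x B : reflect (B \in T /\ x *m B = 0) (B \in ann T x).
Proof.
rewrite memv_cap memv_ker lfunE /=.
by apply: (iffP andP) => -[? /eqP].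
Qed.

Lemma dim_ann T x : (\dim (ann T x) + \dim (img T x) = \dim T)%N.
Proof. exact: limg_ker_dim. Qed.

Lemma row_free_dim k n (M : 'M[F]_(k, n)) (U : {vspace 'rV[F]_n}) :
  row_free M -> (forall i, row i M \in U) -> (k <= \dim U)%N.
Proof.
move=> /row_freeP[R MR] MU.
pose X := [tuple row i M | i < k].
have XU : (<<X>> <= U)%VS by apply/span_subvP => _ /codomP[i ->].
apply: leq_trans (dimvS XU); rewrite (_ : \dim <<X>> = k) //.
suff /eqP-> : free X by rewrite size_tuple.
apply/freeP => c; rewrite (eq_bigr (fun i => c i *: row i M)) => [|i _]; last first.
  by rewrite -tnth_nth tnth_mktuple.
move=> Hc i; pose u := \row_j c j.
have uM : u *m M = 0.
  by rewrite mulmx_sum_row -[RHS]Hc; apply: eq_bigr => j _; rewrite mxE.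
have : u = 0 by rewrite -[u]mulmx1 -MR mulmxA uM mul0mx.
by move/matrixP/(_ ord0 i); rewrite !mxE.
Qed.

Hypothesis char2 : 2%N \in [pchar F].
Hypothesis cardF : card_gt F 2.

(** Besides [x], the projective line through [x] and [v] contains the points [x + t v] with
    [t != 0], and [v]: at least four points. If [w] were outside [x T], lifts of a basis of [x T],
    completed by [w], would be independent at [x] but dependent at all these points, which [pencil]
    excludes. *)
Lemma limit_img T x v w :
  (\dim (img T x) <= 3)%N ->
  (forall t, t != 0 -> (\dim (img T (x + t *: v)) <= \dim (img T x))%N) ->
  (\dim (img T v) <= \dim (img T x))%N ->
  (forall t, t != 0 -> w \in img T (x + t *: v)) -> w \in img T v ->
  w \in img T x.
Proof.
set m := \dim (img T x) => m3 Ht Hv wt wv.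
apply/negP => /negP wx.
pose b := vbasis (img T x).
have bT i : exists2 B, B \in T & tnth b i = x *m B.
  by apply/imgP; rewrite vbasis_mem ?mem_tnth.
have [C CT bC] := fin_all_exists2 bT.
pose X z := \matrix_i (z *m C i).
have notfree z : (\dim (img T z) <= m)%N -> w \in img T z ->
    ~~ row_free (col_mx (X z) w).
  move=> dz wz; apply/negP => free; have : (m + 1 <= \dim (img T z))%N.
    apply: row_free_dim free _ => i; rewrite -[i]splitK; case: (split i) => j /=.
      by rewrite rowKu rowK mem_img.
    by rewrite rowKd row_id.
  by rewrite addn1 ltnNge dz.
have Xt t : X x + t *: X v = X (x + t *: v).
  by apply/row_matrixP => i; rewrite linearD linearZ /= !rowK mulmxDl scalemxAl.
have notfreex : ~~ row_free (col_mx (X x) w).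
  apply: (pencil char2 cardF m3 _ (notfree _ Hv wv)) => t t0.
  by rewrite Xt; apply: notfree; [apply: Ht | apply: wt].
case/negP: notfreex; apply: inj_row_free => u; rewrite -[u]hsubmxK mul_row_col.
set ul := lsubmx u; set ur := rsubmx u.
have uX : ul *m X x = \sum_i ul 0 i *: b`_i.
  by rewrite mulmx_sum_row; apply: eq_bigr => i _; rewrite rowK -bC -tnth_nth.
have uXx : ul *m X x \in img T x.
  by rewrite uX rpred_sum // => i _; rewrite rpredZ // vbasis_mem ?mem_nth ?size_tuple.
rewrite [ur]mx11_scalar mul_scalar_mx; have [ur0|ur0] := eqVneq (ur 0 0) 0.
  rewrite ur0 scale0r addr0 uX => H.
  have /freeP/(_ _ H) ul0 := basis_free (vbasisP (img T x)).
  rewrite raddf0 [X in row_mx X _](_ : _ = 0) ?row_mx0 //.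
  by apply/rowP => i; rewrite ul0 mxE.
move/eqP; rewrite addrC addr_eq0 => /eqP H.
by case/negP: wx; rewrite -[w](scalerK ur0) H rpredZ // rpredN.
Qed.

(* A vector killed by [B] stays in the boundary of the maximal-rank locus:
   [(x + t v) B = t v B], so that [v B] is a limit of elements of [(x + t v) T]. *)
Lemma first_order T x v B :
  (\dim (img T x) <= 3)%N ->
  (forall y, (\dim (img T y) <= \dim (img T x))%N) ->
  B \in ann T x -> v *m B \in img T x.
Proof.
move=> d3 dx /annP[BT xB]; apply: limit_img (dx _) _ _ => // [t t0|]; last exact: mem_img.
have -> : v *m B = (x + t *: v) *m (t^-1 *: B).
  by rewrite mulmxDl -!scalemxAr -scalemxAl xB scaler0 add0r scalerA mulVf // scale1r.
by rewrite mem_img // rpredZ.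
Qed.

(** Expanding [(x + t v) (t^-1 C - t^-2 B)], the term [x B] vanishes and [x C] cancels [v B]. What
    remains is [v C], which thus lies in every [(x + t v) T] with [t != 0]. *)
Lemma second_order T x v B C :
  (\dim (img T x) <= 3)%N ->
  (forall y, (\dim (img T y) <= \dim (img T x))%N) ->
  B \in ann T x -> C \in T -> x *m C = v *m B -> v *m C \in img T x.
Proof.
move=> d3 dx /annP[BT xB] CT xC.
apply: limit_img (dx _) _ _ => // [t t0|]; last exact: mem_img.
have -> : v *m C = (x + t *: v) *m (t ^- 1 *: (C - t ^-1 *: B)).
  rewrite -scalemxAr mulmxBr !mulmxDl -!scalemxAr -!scalemxAl xB xC scaler0 add0r.
  by rewrite scalerA mulVf // scale1r addrAC subrr add0r scalerA mulVf // scale1r.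
by rewrite mem_img // rpredZ // rpredB // rpredZ.
Qed.

End Images.

(** * Triangular matrices along flags *)

Section Patterns.
Variable F : fieldType.
Implicit Types (T U : {vspace 'M[F]_4}) (x v w : 'rV[F]_4) (P B : 'M[F]_4).

(* The rows of [P] span a flag preserved by [B], whose eigenvalues along it are
   the [d k]. *)
Definition triang P B (d : 'I_4 -> F) : Prop :=
  exists L : 'M[F]_4, [/\ P *m B = L *m P,
    forall k l : 'I_4, (k < l)%N -> L k l = 0 & forall k, L k k = d k].

(** The two classes of indices are the fibres of [c]; they may depend on the flag. *)
Definition pattern T : Prop := forall P, P \in unitmx ->
  exists c : 'I_4 -> bool, forall i j, i != j -> c i = c j ->
    exists2 B, B \in T & triang P B (fun k => ((k == i) || (k == j))%:R).

Definition good T : Prop := \dim T = 6 /\ pattern T.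

Definition conj P T : {vspace 'M[F]_4} :=
  (linfun (mulmxr (invmx P) \o mulmx P) @: T)%VS.

Lemma conjP P T B : P \in unitmx ->
  reflect (exists2 C, C \in T & P *m C = B *m P) (B \in conj P T).
Proof.
move=> uP; apply: (iffP memv_imgP) => -[C CT eC]; exists C => //.
  by rewrite eC lfunE /= mulmxKV.
by rewrite lfunE /= eC mulmxK.
Qed.

Lemma mem_conj P T B : P \in unitmx -> (P *m B *m invmx P \in conj P T) = (B \in T).
Proof.
move=> uP; apply/conjP/idP => // [[C CT]|BT]; last by exists B; rewrite ?mulmxKV.
by rewrite mulmxKV // => /(can_inj (mulKmx uP)) <-.
Qed.

Lemma dim_conj P T : P \in unitmx -> \dim (conj P T) = \dim T.
Proof.
move=> uP; apply: limg_dim_eq; apply/eqP; rewrite -subv0; apply/subvP => B.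
rewrite memv_cap memv_ker lfunE /= => /andP[_ /eqP H].
by rewrite memv0 -[B](mulKmx uP) -[P *m B](mulmxKV uP) H mul0mx mulmx0.
Qed.

Lemma pattern_conj P T : P \in unitmx -> pattern T -> pattern (conj P T).
Proof.
move=> uP pT Q uQ; have [|c Hc] := pT (Q *m P); first by rewrite unitmx_mul uQ.
exists c => i j ij cij; have [C CT [L [QPC L0 Ld]]] := Hc i j ij cij.
exists (P *m C *m invmx P); first by rewrite mem_conj.
by exists L; split => //; rewrite !mulmxA QPC mulmxA mulmxK.
Qed.

Lemma good_conj P T : P \in unitmx -> good T -> good (conj P T).
Proof. by move=> uP [dT pT]; split; [rewrite dim_conj | apply: pattern_conj]. Qed.

Lemma img_conj P T x w : P \in unitmx ->
  (w \in img (conj P T) x) = (w *m P \in img T (x *m P)).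
Proof.
move=> uP; apply/imgP/imgP => -[B].
  by move=> /(conjP _ _ uP)[C CT PC ->]; exists C => //; rewrite -!mulmxA PC.
move=> BT wP; exists (P *m B *m invmx P); first by rewrite mem_conj.
by rewrite !mulmxA -wP mulmxK.
Qed.

Lemma dim_img_conj P T x : P \in unitmx ->
  \dim (img (conj P T) x) = \dim (img T (x *m P)).
Proof.
move=> uP.
have -> : img T (x *m P) = (linfun (mulmxr P) @: img (conj P T) x)%VS.
  apply/vspaceP => w; apply/idP/memv_imgP => [wT|[u uT ->]].
    by exists (w *m invmx P); rewrite ?lfunE /= ?img_conj ?mulmxKV.
  by rewrite lfunE /= -img_conj.
symmetry; apply: limg_dim_eq; apply/eqP; rewrite -subv0; apply/subvP => u.
rewrite memv_cap memv_ker lfunE /= => /andP[_ /eqP H].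
by rewrite memv0 -[u](mulmxK uP) (H : u *m P = 0) mul0mx.
Qed.

Lemma triangB P B C (a b : F) d d' : triang P B d -> triang P C d' ->
  triang P (a *: B + b *: C) (fun k => a * d k + b * d' k).
Proof.
move=> [L [PB L0 Ld]] [M [PC M0 Md]]; exists (a *: L + b *: M); split.
- by rewrite mulmxDr mulmxDl -!scalemxAr -!scalemxAl PB PC.
- by move=> k l kl; rewrite !mxE L0 // M0 // !mulr0 addr0.
- by move=> k; rewrite !mxE Ld Md.
Qed.

Lemma triang0 P d k : P \in unitmx -> triang P 0 d -> d k = 0.
Proof.
move=> uP [L [PB _ <-]]; have -> : L = 0 by rewrite -[L](mulmxK uP) -PB mulmx0 mul0mx.
by rewrite mxE.
Qed.

(** The indices [m] and [n] witness that [e_i + e_j] and [e_k + e_l] are independent: [m] lies in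
    the first pair only, and [n] in the second. *)
Lemma bool_pairs (c : 'I_4 -> bool) : exists i j k l m n,
  [/\ (i != j) && (k != l), c i = c j, c k = c l,
      [&& (m == i) || (m == j), m != k & m != l] & (n == k) || (n == l)].
Proof.
case e0: (c i0); case e1: (c i1); case e2: (c i2); case e3: (c i3);
first [ by exists i0, i1, i1, i2, i0, i2; rewrite ?e0 ?e1 ?e2 ?e3
      | by exists i0, i1, i1, i3, i0, i3; rewrite ?e0 ?e1 ?e2 ?e3
      | by exists i0, i2, i2, i3, i0, i3; rewrite ?e0 ?e1 ?e2 ?e3
      | by exists i1, i2, i2, i3, i1, i3; rewrite ?e0 ?e1 ?e2 ?e3
      | by exists i0, i1, i2, i3, i0, i3; rewrite ?e0 ?e1 ?e2 ?e3
      | by exists i0, i2, i1, i3, i0, i3; rewrite ?e0 ?e1 ?e2 ?e3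
      | by exists i0, i3, i1, i2, i0, i2; rewrite ?e0 ?e1 ?e2 ?e3 ].
Qed.

(** [pattern] yields two triangular matrices with independent diagonals for the flag [P], and these
    already span [U]. *)
Lemma dim2_triang T U P : P \in unitmx -> pattern T ->
  (forall B d, B \in T -> triang P B d -> B \in U) -> (\dim U <= 2)%N ->
  forall B, B \in U -> exists d, triang P B d.
Proof.
move=> uP pT TU dU; have [c Hc] := pT P uP.
have [i [j [k [l [m [n [/andP[ij kl] cij ckl /and3P[mij mk ml] nkl]]]]]]] := bool_pairs c.
have [B1 B1T t1] := Hc i j ij cij; have [B2 B2T t2] := Hc k l kl ckl.
have fr : free [:: B1; B2].
  apply/(@freeP _ _ 2 [tuple B1; B2]) => a; rewrite !big_ord_recl big_ord0 /= addr0 => H.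
  have := triangB (a ord0) (a (lift ord0 ord0)) t1 t2; rewrite H => t0.
  have := triang0 m uP t0; rewrite mij (negbTE mk) (negbTE ml) /= mulr1 mulr0 addr0 => a0.
  have := triang0 n uP t0; rewrite nkl a0 mul0r add0r mulr1 => a1.
  by case=> -[|[|q]] Hq //; [rewrite -[RHS]a0 | rewrite -[RHS]a1]; congr (a _); apply: val_inj.
have /eqP UE : (<<[:: B1; B2]>> == U)%VS.
  rewrite eqEdim; apply/andP; split; last by rewrite (eqP fr).
  by apply/span_subvP => B; rewrite !inE => /orP[] /eqP->; apply: TU; eassumption.
move=> B; rewrite -UE span_cons span_seq1 => /memv_addP[_ /vlineP[a ->] [_ /vlineP[b ->] ->]].
by eexists; apply: triangB; eassumption.
Qed.

Lemma complete (X : seq 'rV[F]_4) : free X ->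
  exists2 P, P \in unitmx & forall i : 'I_4, (i < size X)%N -> row i P = X`_i.
Proof.
move=> fX; pose Y := vbasis (<<X>>^C).
have fXY : free (X ++ Y).
  rewrite cat_free fX (basis_free (vbasisP _)) /= directv_addE /= !directv_trivial /=.
  by rewrite (span_basis (vbasisP _)) capv_compl.
have sXY : size (X ++ Y) == 4.
  have := eqP fXY; rewrite span_cat (span_basis (vbasisP _)) addv_complf dimvf => <-.
  by rewrite dim_matrix.
pose Z := Tuple sXY.
exists (\matrix_i Z`_i) => [|i iX]; last by rewrite rowK /= nth_cat iX.
rewrite -row_free_unit; apply: inj_row_free => u.
rewrite mulmx_sum_row => H; apply/rowP => i; rewrite mxE.
have /freeP := fXY : free Z.
by apply; rewrite -[RHS]H; apply: eq_bigr => j _; rewrite rowK.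
Qed.

Lemma complete_span (X : seq 'rV[F]_4) P u :
  (forall i : 'I_4, (i < size X)%N -> row i P = X`_i) -> (size X <= 4)%N ->
  u \in <<X>>%VS ->
  exists2 c : 'rV[F]_4, u = c *m P & forall j : 'I_4, (size X <= j)%N -> c 0 j = 0.
Proof.
move=> PX sX uX; pose a i := coord (in_tuple X) i u.
have iE (i : 'I_(size X)) : (inord i : 'I_4) = i :> nat.
  by rewrite inordK // (leq_trans (ltn_ord i)).
exists (\sum_i a i *: delta_mx 0 (inord i : 'I_4)) => [|j Xj].
  rewrite {1}(coord_span (X := in_tuple X) uX) mulmx_suml; apply: eq_bigr => i _.
  by rewrite -scalemxAl -rowE PX ?iE.
rewrite summxE big1 // => i _; rewrite !mxE (_ : j == _ = false) ?andbF ?mulr0 //.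
by apply/eqP => /(congr1 val) /= ji; move: Xj; rewrite ji iE leqNgt ltn_ord.
Qed.
End Patterns.

(** * Explicit matrices of size 4 and computation with their entries *)

Notation ev := (delta_mx (0 : 'I_1)).

Definition mx4 (F : fieldType) (s : seq (seq F)) : 'M[F]_4 :=
  \matrix_(i, j) nth 0 (nth [::] s i) j.

Definition rv4 (F : fieldType) (s : seq F) : 'rV[F]_4 := \row_j nth 0 s j.

Lemma mx4E (F : fieldType) (s : seq (seq F)) i j : mx4 s i j = nth 0 (nth [::] s i) j.
Proof. by rewrite mxE. Qed.

Lemma mulmx4E (F : fieldType) (A B : 'M[F]_4) i j : (A *m B) i j =
  A i i0 * B i0 j + A i i1 * B i1 j + A i i2 * B i2 j + A i i3 * B i3 j.
Proof. by rewrite mxE sum4. Qed.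

Ltac entries := rewrite ?mulmx4E ?mx4E /= ?(mxE, sum4) /= ?mulr0 ?mul0r ?mulr1 ?mul1r
  ?addr0 ?add0r ?subr0 ?(mulr0, mul0r, mulr1, mul1r, add0r, addr0, subr0).
Tactic Notation "entries" "in" hyp(H) :=
  rewrite ?mulmx4E ?mx4E /= ?(mxE, sum4) /= ?mulr0 ?mul0r ?mulr1 ?mul1r
  ?addr0 ?add0r ?subr0 ?(mulr0, mul0r, mulr1, mul1r, add0r, addr0, subr0) in H.
Tactic Notation "entry" constr(H) constr(i) constr(j) :=
  let X := fresh in have X := congr1 (fun M : 'M_4 => M i j) H; entries in X; move: X.
Ltac mx4_eq := apply/matrixP; apply: ord4P; apply: ord4P; entries; try by []; try ring.
Ltac mx4_unit s := apply: (proj1 (@mulmx1_unit _ _ _ (mx4 s) _)); mx4_eq.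

(** * Matrices preserving a line and a plane *)

Section Surjective.
Variable F : fieldType.
Implicit Types (T U : {vspace 'M[F]_4}) (x v w : 'rV[F]_4) (P B : 'M[F]_4).

Definition coefs (s : seq ('I_4 * 'I_4)) (B : 'M[F]_4) : 'rV[F]_(size s) :=
  \row_k B (nth (i0, i0) s k).1 (nth (i0, i0) s k).2.

Fact coefs_is_linear s : linear (coefs s).
Proof. by move=> a B C; apply/rowP => k; rewrite !mxE. Qed.

HB.instance Definition _ s :=
  GRing.isLinear.Build F 'M[F]_4 'rV[F]_(size s) *:%R (coefs s) (coefs_is_linear s).

Definition vzero s : {vspace 'M[F]_4} := lker (linfun (coefs s)).

Lemma mem_vzero s B : (B \in vzero s) = all (fun p => B p.1 p.2 == 0) s.
Proof.
rewrite memv_ker lfunE /=; apply/eqP/(all_nthP (i0, i0)) => [H k ks|H].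
  by move/rowP/(_ (Ordinal ks)): H; rewrite !mxE /= => ->.
by apply/rowP => k; rewrite !mxE (eqP (H _ (ltn_ord k))).
Qed.

Lemma dim_vzero s T :
  (\dim (T :&: vzero s) + \dim (linfun (coefs s) @: T) = \dim T)%N.
Proof. exact: limg_ker_dim. Qed.

Lemma dim_coefs s T : (\dim (linfun (coefs s) @: T) <= size s)%N.
Proof. by apply: leq_trans (dimvS (subvf _)) _; rewrite dimvf /dim /= mul1n. Qed.

Lemma triang4 P B d : triang P B d -> exists a b c f g h, forall j,
  [/\ (P *m B) i0 j = d i0 * P i0 j, (P *m B) i1 j = a * P i0 j + d i1 * P i1 j,
      (P *m B) i2 j = b * P i0 j + c * P i1 j + d i2 * P i2 j &
      (P *m B) i3 j = f * P i0 j + g * P i1 j + h * P i2 j + d i3 * P i3 j].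
Proof.
move=> [L [-> L0 Ld]]; exists (L i1 i0), (L i2 i0), (L i2 i1), (L i3 i0), (L i3 i1), (L i3 i2) => j.
rewrite -!Ld !mxE !sum4 (L0 i0 i1) // (L0 i0 i2) // (L0 i0 i3) // (L0 i1 i2) //.
by rewrite (L0 i1 i3) // (L0 i2 i3) // !mul0r !addr0.
Qed.

Lemma triang1 B d : triang 1%:M B d ->
  (forall i j : 'I_4, (i < j)%N -> B i j = 0) /\ (forall k, B k k = d k).
Proof. by move=> [L []]; rewrite mul1mx mulmx1 => ->. Qed.

Definition fixes1 B := B \in vzero [:: (i0, i1); (i0, i2); (i0, i3)].
(** Together with [fixes1], this says that [B] preserves the plane of the first two basis
    vectors. *)
Definition fixes2 B := B \in vzero [:: (i1, i2); (i1, i3)].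

Lemma fixes1P B : reflect [/\ B i0 i1 = 0, B i0 i2 = 0 & B i0 i3 = 0] (fixes1 B).
Proof.
rewrite /fixes1 mem_vzero /= andbT.
by apply: (iffP and3P) => -[H1 H2 H3]; split; apply/eqP.
Qed.

Lemma fixes2P B : reflect (B i1 i2 = 0 /\ B i1 i3 = 0) (fixes2 B).
Proof.
rewrite /fixes2 mem_vzero /= andbT.
by apply: (iffP andP) => -[H1 H2]; split; apply/eqP.
Qed.

(* As [dim U' <= 2], the triangular matrices given by [pattern] fill [U'] for every
   flag through the first two basis vectors. *)
Lemma plane_scalar T U' :
  pattern T -> (forall B, B \in T -> fixes1 B -> fixes2 B -> B \in U') -> (\dim U' <= 2)%N ->
  (forall B, B \in U' -> [/\ B i2 i3 = 0, B i3 i2 = 0 & B i2 i2 = B i3 i3]) /\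
  exists B1 B2, [/\ B1 \in T /\ B2 \in T, B1 \in U' /\ B2 \in U',
    triang 1%:M B1 (fun k => ((k == i0) || (k == i1))%:R) &
    triang 1%:M B2 (fun k => ((k == i2) || (k == i3))%:R)].
Proof.
move=> pT mU' dU'.
have tri P d B : (exists s, P = mx4 [:: [:: 1], [:: 0; 1] & s]) ->
    B \in T -> triang P B d -> B \in U'.
  move=> [s ->] BT /triang4[a [b [c [f [g [h H]]]]]]; apply: mU' => //.
    by apply/fixes1P; split; [case: (H i1)|case: (H i2)|case: (H i3)] => + _ _ _; entries.
  by apply/fixes2P; split; [case: (H i2)|case: (H i3)] => _ + _ _; entries.
have scal B : B \in U' -> [/\ B i2 i3 = 0, B i3 i2 = 0 & B i2 i2 = B i3 i3].
  move=> BU.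
  have key s s' : (mx4 [:: [:: 1], [:: 0; 1] & s] : 'M[F]_4) *m mx4 s' = 1%:M ->
    exists d, triang (mx4 [:: [:: 1], [:: 0; 1] & s]) B d.
    move=> /mulmx1_unit[uP _]; apply: (dim2_triang uP pT _ dU') => // C d.
    by apply: tri; exists s.
  (* Modulo [<e0, e1>], the three flags make [e2], [e3] and [e2 + e3] eigenvectors of [B], so that
     [B] is scalar on the quotient. *)
  have [|d1 /triang4[a1 [b1 [c1 [f1 [g1 [h1 H1]]]]]]] := key
    [:: [:: 0; 0; 1]; [:: 0; 0; 0; 1]]
    [:: [:: 1]; [:: 0; 1]; [:: 0; 0; 1]; [:: 0; 0; 0; 1]]; first by mx4_eq.
  have [|d2 /triang4[a2 [b2 [c2 [f2 [g2 [h2 H2]]]]]]] := key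
    [:: [:: 0; 0; 0; 1]; [:: 0; 0; 1]]
    [:: [:: 1]; [:: 0; 1]; [:: 0; 0; 0; 1]; [:: 0; 0; 1]]; first by mx4_eq.
  have [|d3 /triang4[a3 [b3 [c3 [f3 [g3 [h3 H3]]]]]]] := key
    [:: [:: 0; 0; 1; 1]; [:: 0; 0; 0; 1]]
    [:: [:: 1]; [:: 0; 1]; [:: 0; 0; 1; -1]; [:: 0; 0; 0; 1]]; first by mx4_eq.
  have B23 : B i2 i3 = 0 by case: (H1 i3) => _ _ + _; entries.
  have B32 : B i3 i2 = 0 by case: (H2 i2) => _ _ + _; entries.
  split=> //; case: (H3 i2) (H3 i3) => _ _ + _ [_ _ + _]; entries.
  by rewrite B23 B32 add0r addr0 => -> ->.
have [c Hc] := pT 1%:M (unitmx1 _ _).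
have Uc B d : B \in T -> triang 1%:M B d -> B \in U'.
  move=> BT t; apply: tri BT t; exists [:: [:: 0; 0; 1]; [:: 0; 0; 0; 1]]; mx4_eq.
(* By [scal], the diagonal [e_i + e_j] takes equal values at 2 and 3. A pair within a class
   therefore never joins 0 or 1 to 2 or 3, and the classes can only be [{0, 1}] and [{2, 3}]. *)
have c2 i j : i != j -> c i = c j ->
    ((i2 == i) || (i2 == j))%:R = ((i3 == i) || (i3 == j))%:R :> F.
  move=> ij cij; have [B BT t] := Hc i j ij cij.
  have [_ _] := scal B (Uc _ _ BT t).
  by have [_ Bd] := triang1 t; rewrite !Bd.
have nc i j : (i \in [:: i0; i1]) -> (j \in [:: i2; i3]) -> c i != c j.
  rewrite !inE => /orP[] /eqP-> /orP[] /eqP->; apply/eqP => /c2 /= /(_ isT) /eqP;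
  by rewrite ?oner_eq0 // eq_sym oner_eq0.
have cc (a b d : bool) : a != d -> b != d -> a = b by case: a; case: b; case: d.
have [B1 B1T t1] := Hc i0 i1 isT (cc _ _ (c i2) (nc i0 i2 isT isT) (nc i1 i2 isT isT)).
have nc' i j : (i \in [:: i0; i1]) -> (j \in [:: i2; i3]) -> c j != c i.
  by move=> *; rewrite eq_sym nc.
have [B2 B2T t2] := Hc i2 i3 isT (cc _ _ (c i0) (nc' i0 i2 isT isT) (nc' i0 i3 isT isT)).
by split=> //; exists B1, B2; split=> //; split; [exact: Uc t1 | exact: Uc t2].
Qed.

(** As [B3] moves the plane [<e0, e1>], the part of [U] that preserves it has dimension at most 2.
    [plane_scalar] then gives [B1] and [B2], and adding [B3] gives a basis of [U]. *)
Lemma stable_plane T U B3 :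
  pattern T -> (forall B, B \in T -> fixes1 B -> B \in U) ->
  (\dim U <= 3)%N -> B3 \in U -> ~~ fixes2 B3 ->
  exists B1 B2, [/\ B1 \in T /\ B2 \in T,
    [/\ fixes1 B1, fixes2 B1, B1 i0 i0 = 1 & B1 i1 i1 = 1],
    [/\ fixes1 B2, fixes2 B2, B2 i0 i0 = 0 & B2 i1 i1 = 0],
    [/\ B1 i2 i2 = 0, B1 i2 i3 = 0, B1 i3 i2 = 0 & B1 i3 i3 = 0] &
    forall B, B \in U -> exists b1 b2 b3, B = b1 *: B1 + b2 *: B2 + b3 *: B3].
Proof.
move=> pT TU dU B3U nf3.
pose U' := (U :&: vzero [:: (i1, i2); (i1, i3)])%VS.
have dU' : (\dim U' <= 2)%N.
  rewrite -ltnS; apply: leq_trans dU; rewrite ltn_neqAle dimvS ?capvSl // andbT.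
  apply: contra nf3 => /eqP H; have /eqP E : (U' == U)%VS by rewrite eqEdim capvSl H /=.
  by move: B3U; rewrite -E memv_cap => /andP[].
have mU' B : B \in T -> fixes1 B -> fixes2 B -> B \in U'.
  by move=> BT f1 f2; rewrite memv_cap TU.
have [scal [B1 [B2 [[B1T B2T] [B1U' B2U'] t1 t2]]]] := plane_scalar pT mU' dU'.
have [[L1 D1] [L2 D2]] := (triang1 t1, triang1 t2).
have [B1U B2U] : B1 \in U /\ B2 \in U.
  by move: B1U' B2U'; rewrite !memv_cap => /andP[-> _] /andP[-> _].
have [P1 P2 P3] := scal _ B1U'.
exists B1, B2; split=> //.
- by split; [apply/fixes1P | apply/fixes2P | rewrite D1 | rewrite D1]; rewrite ?L1.
- by split; [apply/fixes1P | apply/fixes2P | rewrite D2 | rewrite D2]; rewrite ?L2.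
have fr : free [:: B1; B2; B3].
  apply/(@freeP _ _ 3 [tuple B1; B2; B3]) => a.
  rewrite !big_ord_recl big_ord0 /= addr0.
  set a0 := a ord0; set a1 := a (lift _ _); set a2 := a (lift _ _) => H.
  have H2 : a2 = 0.
    apply/eqP; apply: contraR nf3 => a20; apply/fixes2P.
    by split; apply: (mulfI a20); [entry H i1 i2|entry H i1 i3];
       rewrite !(L1, L2) // !mulr0 !add0r.
  have H0 : a0 = 0 by entry H i0 i0; rewrite H2 D1 D2 /= mulr1 mulr0 mul0r !addr0.
  have H1 : a1 = 0.
    by entry H i2 i2; rewrite H2 H0 D2 /= mulr1 !mul0r addr0 add0r.
  by case=> -[|[|[|q]]] Hq //; [rewrite -[RHS]H0 | rewrite -[RHS]H1 | rewrite -[RHS]H2];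
     congr (a _); apply: val_inj.
have /eqP UE : (<<[:: B1; B2; B3]>> == U)%VS.
  rewrite eqEdim (eqP fr) dU andbT.
  by apply/span_subvP => B; rewrite !inE => /or3P[] /eqP->.
move=> B; rewrite -UE 2!span_cons span_seq1.
move=> /memv_addP[_ /vlineP[a ->] [_ /memv_addP[_ /vlineP[b ->] [_ /vlineP[d ->] ->]] ->]].
by exists a, b, d; rewrite addrA.
Qed.
End Surjective.

(** * Row images are proper *)

Section Nonsurjective.
Variable F : fieldType.
Implicit Types (T U : {vspace 'M[F]_4}) (x y v w : 'rV[F]_4) (P B : 'M[F]_4).

Lemma free2 x y : x != 0 -> (forall a, y <> a *: x) -> free [:: x; y].
Proof.
move=> x0 H; rewrite (perm_free (_ : perm_eq _ [:: y; x])); last by rewrite (perm_catC [:: x]).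
rewrite free_cons span_seq1 seq1_free x0 andbT.
by apply/negP => /vlineP[a] /H.
Qed.

Lemma free3 x y z : free [:: x; y] -> (forall a b, z <> a *: x + b *: y) ->
  free [:: x; y; z].
Proof.
move=> xy H; rewrite (perm_free (_ : perm_eq _ [:: z; x; y])); last first.
  by rewrite (perm_catC [:: x; y]).
rewrite free_cons xy andbT span_cons span_seq1.
by apply/negP => /memv_addP[_ /vlineP[a ->] [_ /vlineP[b ->] /H]].
Qed.

Lemma ev_neq0 i : ev i != 0 :> 'rV[F]_4.
Proof. by apply/eqP => /rowP/(_ i)/eqP; rewrite !mxE !eqxx oner_eq0. Qed.

(** With two distinct diagonal entries, the block of [B] on the indices other than 0 is not scalar:
    one of [e_i], [e_k], [e_i + e_k] is not an eigenvector modulo [e0]. *)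
Lemma nonscalar B i k : i != k -> i != i0 -> k != i0 -> B i i != B k k ->
  exists y, free [:: ev i0; y; y *m B].
Proof.
move=> ik ie ke Bik.
have key m : m != i0 -> (forall l, l != i0 -> l != m -> B m l = 0) \/
    exists y, free [:: ev i0; y; y *m B].
  move=> m0; have [|] := boolP [forall l, (l != i0) ==> (l != m) ==> (B m l == 0)].
    by move/forallP => H; left => l l0 lm; move: (H l); rewrite l0 lm => /eqP.
  rewrite negb_forall => /existsP[l]; rewrite !negb_imply => /and3P[l0 lm Bl].
  right; exists (ev m); apply: free3 => [|a b].
    apply: free2 (ev_neq0 _) _ => a /rowP/(_ m)/eqP.
    by rewrite !mxE !eqxx (negbTE m0) mulr0 oner_eq0.
  rewrite -rowE => /rowP/(_ l)/eqP.
  by rewrite !mxE !eqxx (negbTE l0) (negbTE lm) !mulr0 addr0 (negbTE Bl).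
case: (key i ie) => // Hi; case: (key k ke) => // Hk.
exists (ev i + ev k); apply: free3 => [|a b].
  apply: free2 (ev_neq0 _) _ => a /rowP/(_ i)/eqP.
  by rewrite !mxE !eqxx (negbTE ik) (negbTE ie) mulr0 addr0 oner_eq0.
rewrite mulmxDl -!rowE => /rowP H; move: (H i) (H k); rewrite !mxE !eqxx.
have ki : k != i by rewrite eq_sym.
rewrite ?(negbTE ik, negbTE ki, negbTE ie, negbTE ke) /=.
rewrite (Hi k) // (Hk i) // ?mulr0 ?addr0 ?add0r ?mulr1 => e1 e2.
by move: Bik; rewrite e1 e2 eqxx.
Qed.

Lemma bool_pair3 (c : 'I_4 -> bool) : exists i j k : 'I_4,
  [/\ i != j, c i = c j, i != i0, k != i0 & [&& j != i0, k != i & k != j]].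
Proof.
case e1: (c i1); case e2: (c i2); case e3: (c i3);
first [ by exists i1, i2, i3; rewrite ?e1 ?e2 ?e3
      | by exists i1, i3, i2; rewrite ?e1 ?e2 ?e3
      | by exists i2, i3, i1; rewrite ?e1 ?e2 ?e3 ].
Qed.

Lemma exists_noneigen T : pattern T -> exists P B,
  [/\ P \in unitmx, B \in T, fixes1 B, row i0 P = ev i0 & row i1 P *m B = row i2 P].
Proof.
move=> /(_ _ (unitmx1 _ _))[c Hc].
have [i [j [k [ij cij ie ke /and3P[_ ki kj]]]]] := bool_pair3 c.
have [B BT /triang1[L D]] := Hc i j ij cij.
have Bd : B i i != B k k by rewrite !D eqxx (negbTE ki) (negbTE kj) oner_eq0.
have [y /complete[P uP HP]] : exists y, free [:: ev i0; y; y *m B].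
  by apply: nonscalar Bd => //; rewrite eq_sym.
exists P, B; split=> //; first by apply/fixes1P; rewrite !L.
  by rewrite HP.
by rewrite !HP.
Qed.

Lemma row0_fixes1 B : fixes1 B -> ev i0 *m B = B i0 i0 *: ev i0.
Proof.
move=> /fixes1P[B1 B2 B3]; rewrite -rowE; apply/rowP; apply: ord4P;
by rewrite !mxE ?B1 ?B2 ?B3 ?mulr1 ?mulr0.
Qed.

(** The stabiliser of the line of [e0] has dimension at most 3 in both cases. In the first, the
    annihilator has dimension 6 - 4 and one more dimension accounts for the scalar action on [e0].
    In the second, the annihilator has dimension 6 - 3 and the scalar must be 0, since otherwise
    [e0] would be in [e0 T]. *)
Lemma stab_space T : \dim T = 6 ->
  \dim (img T (ev i0)) = 4 \/ \dim (img T (ev i0)) = 3 /\ ev i0 \notin img T (ev i0) ->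
  exists2 U : {vspace _}, forall B, B \in T -> fixes1 B -> B \in U & (\dim U <= 3)%N.
Proof.
move=> dT H; have := dim_ann T (ev i0); rewrite dT.
case: H => [d4|[d3 H]]; last first.
  rewrite d3 => /(@addIn 3 _ 3) dA; exists (ann T (ev i0)); rewrite ?dA //.
  move=> B BT /row0_fixes1 B0; apply/annP; split=> //; rewrite B0.
  have [->|b0] := eqVneq (B i0 i0) 0; first by rewrite scale0r.
  case/negP: H; rewrite -[X in X \in _](scalerK b0) -B0 rpredZ //; exact: mem_img.
rewrite d4 => /(@addIn 4 _ 2) dA.
have /imgP[B0 B0T e0] : ev i0 \in img T (ev i0).
  suff -> : img T (ev i0) = fullv by rewrite memvf.
  by apply/eqP; rewrite eqEdim subvf d4 dimvf /dim /=.
exists (ann T (ev i0) + <[B0]>)%VS.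
- move=> B BT /row0_fixes1 BE; rewrite -[B](subrK (B i0 i0 *: B0)).
  rewrite memv_add ?memvZ ?memv_line //; apply/annP.
  by rewrite rpredB ?rpredZ // mulmxBr BE -scalemxAr -e0 subrr.
- apply: leq_trans (dimv_add_leqif _ _) _; rewrite dA.
  by rewrite (leq_add2l 2 _ 1) dim_vline; case: (_ != _).
Qed.

Lemma normalize_noneigen T : good T -> exists P B,
  [/\ P \in unitmx, ev i0 *m P = ev i0, B \in conj P T, fixes1 B & row i1 B = ev i2].
Proof.
move=> [dT pT]; have [P [B [uP BT f1 P0 P1]]] := exists_noneigen pT.
exists P, (P *m B *m invmx P); rewrite -rowE P0 mem_conj //; split=> //.
  have e0 : ev i0 *m invmx P = ev i0 by rewrite -[in LHS]P0 rowE mulmxK.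
  have r0 : row i0 (P *m B *m invmx P) = B i0 i0 *: ev i0.
    rewrite !row_mul P0 -rowE -[in RHS]e0 scalemxAl; congr (_ *m _).
    move/fixes1P: f1 => [B1 B2 B3]; apply/rowP; apply: ord4P;
    by rewrite !mxE ?B1 ?B2 ?B3 ?mulr1 ?mulr0.
  move: (P *m B *m invmx P) r0 => C /rowP r0.
  by apply/fixes1P; split; [move: (r0 i1)|move: (r0 i2)|move: (r0 i3)]; rewrite !mxE mulr0.
by rewrite !row_mul P1 rowE mulmxK.
Qed.

Lemma not_fixes2 B : row i1 B = ev i2 -> ~~ fixes2 B.
Proof.
move=> /rowP/(_ i2); rewrite !mxE /= => B1; apply/fixes2P => -[/eqP].
by rewrite B1 oner_eq0.
Qed.

(** Otherwise [stab_space] makes [stable_plane] applicable, and its matrix [B1] maps [e0] to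
    itself. *)
Lemma mem_img_ev0 T : good T -> \dim (img T (ev i0)) = 3 -> ev i0 \in img T (ev i0).
Proof.
move=> gT d3; apply/negPn/negP => e0.
have [P [B3 [uP P0 B3T f3 B3r]]] := normalize_noneigen gT.
have [dT' pT'] := good_conj uP gT.
have [|U TU dU] := stab_space dT'.
  by right; rewrite dim_img_conj // img_conj // P0.
have [B1 [_ [[B1T _] [f1 _ B1d _] _ _ _]]] :=
  stable_plane pT' TU dU (TU _ B3T f3) (not_fixes2 B3r).
case/negP: e0; rewrite -P0 -img_conj //.
by apply/imgP; exists B1; rewrite ?row0_fixes1 ?B1d ?scale1r.
Qed.

Hypothesis char2 : 2%N \in [pchar F].
Hypothesis cardF : card_gt F 2.

(* If [e0 T] were everything, [stable_plane] would apply to the flags through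
   [e0, e1] and through [e0, e1 + t e3], and the two resulting matrices [B1] are
   incompatible. *)
Lemma img_ev0_proper T : good T -> \dim (img T (ev i0)) <> 4.
Proof.
move=> gT d4; have [P [B3 [uP P0 B3T f3 B3r]]] := normalize_noneigen gT.
have gT1 := good_conj uP gT; have [dT1 pT1] := gT1.
have d41 : \dim (img (conj P T) (ev i0)) = 4 by rewrite dim_img_conj // P0.
move: (conj P T) gT1 dT1 pT1 d41 B3T => {uP P0 gT d4 P}T gT dT pT d4 B3T.
have [|U TU dU] := stab_space dT; first by left.
have [B1 [B2 [[B1T B2T] [_ f21 B1d0 B1d1] [_ f22 B2d0 B2d1] _ span]]] :=
  stable_plane pT TU dU (TU _ B3T f3) (not_fixes2 B3r).
(* The coordinate of [(e1 + t e3) B3] along [e2] is [1 + t * B3 i3 i2]. It must be nonzero for [B3]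
   to move the plane [<e0, e1 + t e3>] too. *)
have [|t t0] := @quadratic_nonroot F char2 cardF 1 (B3 i3 i2) 0; first by rewrite oner_eq0.
rewrite mulr0 addr0 => t1.
pose Q : 'M[F]_4 := mx4 [:: [:: 1]; [:: 0; 1; 0; t]; [:: 0; 0; 1]; [:: 0; 0; 0; 1]].
have uQ : Q \in unitmx.
  mx4_unit [:: [:: 1]; [:: 0; 1; 0; -t]; [:: 0; 0; 1]; [:: 0; 0; 0; 1]].
have Q0 : ev i0 *m Q = ev i0.
  by rewrite -rowE; apply/rowP; apply: ord4P; entries.
have [D3 D3T QB3] : exists2 D3, D3 \in conj Q T & Q *m B3 = D3 *m Q.
  by exists (Q *m B3 *m invmx Q); rewrite ?mem_conj // mulmxKV.
have [/fixes1P[B01 B02 B03]] := f3.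
have B1r j : B3 i1 j = (j == i2)%:R by move/rowP/(_ j): B3r; rewrite !mxE eqxx.
have fD : fixes1 D3.
  entry QB3 i0 i1; entry QB3 i0 i2; entry QB3 i0 i3; rewrite B01 B02 B03 => /esym h3 /esym D2 /esym D1.
  by apply/fixes1P; split=> //; move: h3; rewrite D1 mul0r add0r.
have nD : ~~ fixes2 D3.
  apply/fixes2P => -[D12 _]; entry QB3 i1 i2; rewrite D12 B1r /= => /eqP.
  by rewrite (negbTE t1).
have [dT' pT'] := good_conj uQ gT.
have [|U' TU' dU'] := stab_space dT'.
  by left; rewrite dim_img_conj // Q0.
have [D1 [_ [[D1T _] [f1 /fixes2P[g12 g13] D00 D11] _ [D22 D23 D32 D33] _]]] :=
  stable_plane pT' TU' dU' (TU' _ D3T fD) nD.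
move/fixes1P: f1 => [D01 D02 D03].
have [C CT QC] := conjP _ _ uQ D1T.
have C00 : C i0 i0 = 1 by entry QC i0 i0; rewrite D00.
have C01 : C i0 i1 = 0 by entry QC i0 i1; rewrite D01.
have C02 : C i0 i2 = 0 by entry QC i0 i2; rewrite D02.
have C03 : C i0 i3 = 0 by entry QC i0 i3; rewrite D01 D03 mul0r addr0.
have C32 : C i3 i2 = 0 by entry QC i3 i2; rewrite D32.
have C12 : C i1 i2 = 0 by entry QC i1 i2; rewrite g12 C32 mulr0 addr0.
have C31 : C i3 i1 = D1 i3 i1 by entry QC i3 i1.
have C33 : C i3 i3 = t * C i3 i1 by entry QC i3 i3; rewrite D33 addr0 C31 mulrC.
have C11 : C i1 i1 = 1 - t * C i3 i1.
  by entry QC i1 i1; rewrite D11 => <-; rewrite addrK.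
have C13 : C i1 i3 = t * C i1 i1.
  entry QC i1 i3; rewrite D11 g13 C33 C11 => H.
  by rewrite mulrBr -[C i1 i3](addrK (t * (t * C i3 i1))) H; ring.
(* Entry (1,2) gives [b3 = 0]; then [C i1 i3 = t * C i1 i1] gives [C i1 i1 = 0], hence [b1 = 0],
   against [C i0 i0 = 1]. *)
have [|b1 [b2 [b3 CE]]] := span C.
  by apply: TU => //; apply/fixes1P.
have b30 : b3 = 0.
  move/fixes2P: f21 => [f21 _]; move/fixes2P: f22 => [f22 _].
  by entry CE i1 i2; rewrite C12 f21 f22 B1r !mulr0 mulr1 !add0r.
have b10 : b1 = 0.
  move/fixes2P: f21 => [_ f21]; move/fixes2P: f22 => [_ f22].
  entry CE i1 i3; rewrite C13 f21 f22 B1r !mulr0 !addr0 => /eqP.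
  rewrite mulf_eq0 (negbTE t0) /= => /eqP C110.
  by entry CE i1 i1; rewrite C110 B1d1 B2d1 B1r !mulr0 mulr1 !addr0.
entry CE i0 i0; rewrite C00 b30 b10 B2d0 !mul0r mulr0 !addr0 => /eqP.
by rewrite oner_eq0.
Qed.
End Nonsurjective.

(** * Points of maximal rank *)

Section Rank3.
Variable F : fieldType.
Hypothesis char2 : 2%N \in [pchar F].
Hypothesis cardF : card_gt F 2.
Implicit Types (T U : {vspace 'M[F]_4}) (x y v w : 'rV[F]_4) (P B : 'M[F]_4).

Lemma basis_from x : x != 0 -> exists2 P, P \in unitmx & ev i0 *m P = x.
Proof.
move=> x0; have [|P uP HP] := @complete F [:: x]; first by rewrite seq1_free.
by exists P; rewrite // -rowE HP.
Qed.

Lemma dim_img_le3 T x : good T -> (\dim (img T x) <= 3)%N.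
Proof.
move=> gT; have d4 : (\dim (img T x) <= 4)%N.
  by apply: leq_trans (dimvS (subvf _)) _; rewrite dimvf /dim /=.
rewrite leq_eqVlt ltnS in d4; case/orP: d4 => // /eqP d4.
have x0 : x != 0.
  apply/eqP => x0; move: d4; rewrite x0 (_ : img T 0 = 0%VS) ?dimv0 //.
  by apply/eqP; rewrite -subv0; apply/subvP => w /imgP[B _ ->]; rewrite mul0mx mem0v.
have [P uP Px] := basis_from x0.
by have [] := img_ev0_proper char2 cardF (good_conj uP gT); rewrite dim_img_conj // Px.
Qed.

Lemma img0 T : img T 0 = 0%VS.
Proof.
by apply/eqP; rewrite -subv0; apply/subvP => w /imgP[B _ ->]; rewrite mul0mx mem0v.
Qed.

Lemma mem_img_self T x : good T -> \dim (img T x) = 3 -> x \in img T x.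
Proof.
move=> gT d3; have [->|x0] := eqVneq x 0; first exact: mem0v.
have [P uP Px] := basis_from x0.
rewrite -{1}Px -Px -img_conj //; apply: mem_img_ev0; first exact: good_conj.
by rewrite dim_img_conj // Px.
Qed.

(** If [d i0 = 0] then [B] kills [x]. By [first_order] it maps every vector into [x T], hence into
    the span of the first [k] vectors of the flag. *)
Lemma flag_ann T x P k B d :
  (\dim (img T x) <= 3)%N -> (forall y, (\dim (img T y) <= \dim (img T x))%N) ->
  P \in unitmx -> ev i0 *m P = x ->
  (forall u, u \in img T x -> exists2 c : 'rV_4, u = c *m P &
     forall j : 'I_4, (k <= j)%N -> c 0 j = 0) ->
  B \in T -> triang P B d -> d i0 = 0 -> forall j : 'I_4, (k <= j)%N -> d j = 0.
Proof.
move=> d3 dx uP Px HP BT [L [PB L0 Ld]] d0 j kj.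
have BA : B \in ann T x.
  apply/annP; split=> //; rewrite -Px -mulmxA PB mulmxA -rowE.
  rewrite (_ : row i0 L = 0) ?mul0mx //; apply/rowP; apply: ord4P;
  by rewrite !mxE ?Ld ?L0.
have /HP[c cP c0] : row j P *m B \in img T x by exact: first_order BA.
have : row j L = c.
  by apply: (can_inj (mulmxK uP)); rewrite -cP -!row_mul PB.
by move/rowP/(_ j); rewrite mxE Ld c0.
Qed.

Lemma bool3 (a b c : bool) : [\/ a = b, b = c | a = c].
Proof. by case: a; case: b; case: c; first [by constructor 1|by constructor 2|by constructor 3]. Qed.

Lemma adapted_basis (U : {vspace 'rV[F]_4}) x : x != 0 -> x \in U ->
  exists X P, [/\ P \in unitmx, ev i0 *m P = x, size X = \dim U, <<X>>%VS = U &
    forall i : 'I_4, (i < size X)%N -> row i P = X`_i].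
Proof.
move=> x0 xU; pose X := x :: vbasis (U :\: <[x]>)%VS.
have fX : free X.
  rewrite free_cons (span_basis (vbasisP _)) (basis_free (vbasisP _)) andbT.
  apply/negP => xD; case/negP: x0; rewrite -memv0 -(capv_diff U <[x]>%VS).
  by rewrite memv_cap xD memv_line.
have sX : <<X>>%VS = U.
  rewrite span_cons (span_basis (vbasisP _)) addvC.
  by rewrite -[RHS](addv_diff_cap _ <[x]>%VS) (capv_idPr _) // -memvE.
have [P uP HP] := complete fX.
by exists X, P; rewrite -rowE HP // -sX (eqP fX).
Qed.

(** If [x] is in [x T], two of the indices 1, 2, 3 are in one class; the matrix they give kills [x],
    and [flag_ann] forbids a nonzero diagonal entry at 2 or 3. If [x] is not in [x T], diagonals
    vanish at 0, hence also at 3, whereas two of the indices 0, 1, 3 are in one class. *)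
Lemma max_rank_gt2 T x : good T -> x != 0 -> (\dim (img T x) <= 2)%N ->
  (forall y, (\dim (img T y) <= \dim (img T x))%N) -> False.
Proof.
move=> [dT pT] x0 d2 dx; have d3 := leqW d2.
have [xU|xU] := boolP (x \in img T x).
  have [X [P [uP Px szX sX HP]]] := adapted_basis x0 xU.
  have HU u : u \in img T x -> exists2 c : 'rV_4, u = c *m P &
      forall j : 'I_4, (2 <= j)%N -> c 0 j = 0.
    rewrite -sX => /(complete_span HP)[|c -> c0]; first by rewrite szX (leq_trans d2).
    by exists c => // j j2; rewrite c0 // szX (leq_trans d2).
  have [c Hc] := pT P uP.
  have [i [j [k [ij cij ie _ /and3P[je _ _]]]]] := bool_pair3 c.
  have [B BT tB] := Hc i j ij cij.
  have key := flag_ann d3 dx uP Px HU BT tB.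
  have {}key : forall l : 'I_4, (2 <= l)%N -> ((l == i) || (l == j))%:R = 0 :> F.
    by apply: key; rewrite /= !(eq_sym i0) (negbTE ie) (negbTE je).
  have [i2|i2] := leqP 2 i.
    by move: (key i i2) => /eqP; rewrite eqxx oner_eq0.
  have [j2|j2] := leqP 2 j.
    by move: (key j j2) => /eqP; rewrite eqxx orbT oner_eq0.
  by move: i j ij ie je i2 j2 {cij tB key}; apply: ord4P; apply: ord4P.
pose X := x :: vbasis (img T x).
have fX : free X.
  by rewrite free_cons (span_basis (vbasisP _)) (basis_free (vbasisP _)) xU.
have szX : (size X <= 3)%N by rewrite /= size_tuple.
have [P uP HP] := complete fX.
have Px : ev i0 *m P = x by rewrite -rowE HP.
have HU u : u \in img T x -> exists2 c : 'rV_4, u = c *m P &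
    forall j : 'I_4, (3 <= j)%N -> c 0 j = 0.
  move=> uU; have /(complete_span HP)[|c -> c0] : u \in <<X>>%VS.
  - rewrite span_cons (span_basis (vbasisP _)).
    by apply: subvP uU; apply: addvSr.
  - exact: leqW.
  by exists c => // j j3; rewrite c0 // (leq_trans szX).
have [c Hc] := pT P uP.
have d0 i j B : B \in T -> triang P B (fun k => ((k == i) || (k == j))%:R) ->
    (i0 == i) || (i0 == j) = false /\ (i3 == i) || (i3 == j) = false.
  move=> BT tB.
  have [a [b [g [f [h [l Ht]]]]]] := triang4 tB.
  have xB : x *m B = ((i0 == i) || (i0 == j))%:R *: x.
    rewrite -Px -mulmxA -!rowE; apply/rowP => m; case: (Ht m) => + _ _ _.
    by rewrite !mxE.
  have d0 : (i0 == i) || (i0 == j) = false.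
    apply/negP => ij; case/negP: xU; have := mem_img x BT.
    by rewrite xB ij scale1r.
  split=> //; have := flag_ann d3 dx uP Px HU BT tB; rewrite d0.
  by move/(_ erefl i3 isT)/eqP; case: (_ || _); rewrite ?oner_eq0.
have no i j : i != j -> c i = c j -> (i0 == i) || (i0 == j) || (i3 == i) || (i3 == j) -> False.
  by move=> ij cij; have [B BT /(d0 _ _ _ BT)[-> /= ->]] := Hc i j ij cij.
by case: (bool3 (c i0) (c i1) (c i3)) => /no; apply.
Qed.

Lemma exists_rank3 T : good T -> exists x, \dim (img T x) = 3.
Proof.
move=> gT; apply: NNPP => H.
have {H}d2 x : (\dim (img T x) <= 2)%N.
  have := dim_img_le3 x gT; rewrite leq_eqVlt => /orP[/eqP d3|//].
  by case: H; exists x.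
(* Either the bound [m] is attained, at a point that is then of maximal rank, or it can be
   lowered. *)
have dS m : (m <= 2)%N -> ~ (forall x, (\dim (img T x) <= m)%N).
  elim: m => [|m IH] m2 dm.
    have := max_rank_gt2 gT (ev_neq0 F i0) (d2 _); apply=> y.
    exact: leq_trans (dm y) _.
  apply: (IH (ltnW m2)) => x; have := dm x; rewrite leq_eqVlt => /orP[/eqP dx|//].
  have x0 : x != 0 by apply/eqP => x0; move: dx; rewrite x0 img0 dimv0.
  by case: (max_rank_gt2 gT x0 (d2 _)) => y; rewrite dx.
exact: (dS 2 isT d2).
Qed.

(* The coordinates used near a vector [x] of maximal rank: [x] is the first
   basis vector and [x T] the hyperplane spanned by the first three. *)
Definition normal T : Prop :=
  [/\ good T, \dim (img T (ev i0)) = 3 &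
      forall w, (w \in img T (ev i0)) = (w 0 i3 == 0)].

Lemma normalize T x : good T -> \dim (img T x) = 3 ->
  exists P, [/\ P \in unitmx, ev i0 *m P = x & normal (conj P T)].
Proof.
move=> gT d3; have xU := mem_img_self gT d3.
have x0 : x != 0 by apply/eqP => x0; move: d3; rewrite x0 img0 dimv0.
have [X [P [uP Px szX sX HP]]] := adapted_basis x0 xU; rewrite d3 in szX.
exists P; split=> //; split=> [||w]; first exact: good_conj.
  by rewrite dim_img_conj // Px.
rewrite img_conj // Px -sX; apply/idP/eqP => [|w3].
  case/(complete_span HP) => [|c /(can_inj (mulmxK uP)) ->]; first by rewrite szX.
  by apply; rewrite szX.
rewrite mulmx_sum_row sum4 w3 scale0r addr0 !HP ?szX //.
by rewrite !rpredD ?rpredZ // memv_span ?mem_nth ?szX.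
Qed.
End Rank3.

(** * Normal coordinates at a point of maximal rank *)

Section Normal.
Variable F : fieldType.
Hypothesis char2 : 2%N \in [pchar F].
Hypothesis cardF : card_gt F 2.
Implicit Types (T U : {vspace 'M[F]_4}) (x y v w : 'rV[F]_4) (P B C : 'M[F]_4).

Variable T : {vspace 'M[F]_4}.
Hypothesis nT : normal T.

Let dx : \dim (img T (ev i0)) = 3. Proof. by case: nT. Qed.
Let d3 : (\dim (img T (ev i0)) <= 3)%N. Proof. by rewrite dx. Qed.
Let dmax y : (\dim (img T y) <= \dim (img T (ev i0)))%N.
Proof. by rewrite dx; apply: dim_img_le3; case: nT. Qed.

Definition row0_is B (a b c : F) := [/\ B i0 i0 = a, B i0 i1 = b & B i0 i2 = c].

Lemma normal03 B : B \in T -> B i0 i3 = 0.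
Proof.
move=> /(mem_img (ev i0)); case: nT => _ _ -> /eqP.
by rewrite -rowE mxE.
Qed.

Lemma normal_annP B : reflect (B \in T /\ row0_is B 0 0 0) (B \in ann T (ev i0)).
Proof.
apply: (iffP (annP _ _ _)); rewrite -rowE => -[BT].
  by move=> /rowP H; split=> //; split; [move: (H i0)|move: (H i1)|move: (H i2)]; rewrite !mxE.
move=> [B0 B1 B2]; split=> //; apply/rowP; apply: ord4P; rewrite !mxE //.
exact: normal03.
Qed.

Lemma normal_col3 B i : B \in ann T (ev i0) -> B i i3 = 0.
Proof.
move=> /(first_order char2 cardF (ev i) d3 dmax).
by case: nT => _ _ ->; rewrite -rowE mxE => /eqP.
Qed.

Lemma normal_row0 a b c : exists2 C, C \in T & row0_is C a b c.
Proof.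
have : rv4 [:: a; b; c] \in img T (ev i0) by case: nT => _ _ ->; rewrite mxE /=.
case/imgP => C CT; rewrite -rowE => /rowP H; exists C => //.
by split; [move: (H i0)|move: (H i1)|move: (H i2)]; rewrite !mxE /=.
Qed.

Lemma normal_dim_ann : \dim (ann T (ev i0)) = 3.
Proof. by apply: (@addIn 3); rewrite /= -{1}dx dim_ann; case: nT => -[]. Qed.

Section Alternating.
Variables C0 C1 C2 : 'M[F]_4.
Hypotheses (C0T : C0 \in T) (C1T : C1 \in T) (C2T : C2 \in T).
Hypotheses (row0 : row0_is C0 1 0 0) (row1 : row0_is C1 0 1 0) (row2 : row0_is C2 0 0 1).

Lemma normal_decomp B : B \in T -> exists2 E, E \in ann T (ev i0) &
  B = B i0 i0 *: C0 + B i0 i1 *: C1 + B i0 i2 *: C2 + E.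
Proof.
move=> BT; exists (B - (B i0 i0 *: C0 + B i0 i1 *: C1 + B i0 i2 *: C2)); last by rewrite addrC subrK.
apply/normal_annP; split; first by rewrite rpredB ?rpredD ?rpredZ.
case: row0 row1 row2 => [a0 a1 a2] [b0 b1 b2] [c0 c1 c2].
by split; rewrite !mxE ?(a0, a1, a2, b0, b1, b2, c0, c1, c2); ring.
Qed.

(** For [u] in the hyperplane [e0 T], let [C_u] be the combination of [C0], [C1], [C2] with first
    row [u]. The bilinear form of interest sends [(u, w)] to the last coordinate of [w C_u]; here
    [u = v B]. *)
Let form B v w := (v *m B) 0 i0 * (w *m C0) 0 i3 + (v *m B) 0 i1 * (w *m C1) 0 i3
  + (v *m B) 0 i2 * (w *m C2) 0 i3.

Let form0 B v : B \in ann T (ev i0) -> form B v v = 0.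
Proof.
move=> BA; pose u := v *m B.
(* This [C] satisfies [e0 C = v B], which is the hypothesis of [second_order]. *)
pose C := u 0 i0 *: C0 + u 0 i1 *: C1 + u 0 i2 *: C2.
have CT : C \in T by rewrite !rpredD ?rpredZ.
have xC : ev i0 *m C = u.
  case: row0 row1 row2 => [a0 a1 a2] [b0 b1 b2] [c0 c1 c2].
  rewrite -rowE; apply/rowP; apply: ord4P; rewrite ![row _ _ _ _]mxE.
  - by rewrite !mxE a0 b0 c0; ring.
  - by rewrite !mxE a1 b1 c1; ring.
  - by rewrite !mxE a2 b2 c2; ring.
  rewrite normal03 //; apply/esym/eqP.
  by case: nT => _ _ <-; apply: first_order BA.
have := second_order char2 cardF d3 dmax BA CT xC; case: nT => _ _ -> /eqP.
rewrite /C !mulmxDr -!scalemxAr /form -/u.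
by move: (v *m C0) (v *m C1) (v *m C2) u {xC CT C} => a b c u; rewrite !mxE.
Qed.

Lemma alternating B i : B \in ann T (ev i0) ->
  B i i0 * C0 i i3 + B i i1 * C1 i i3 + B i i2 * C2 i i3 = 0.
Proof. by move=> /(form0 (ev i)); rewrite /form -!rowE !mxE. Qed.

Lemma alternating_polar B i j : B \in ann T (ev i0) ->
  B i i0 * C0 j i3 + B i i1 * C1 j i3 + B i i2 * C2 j i3 +
  (B j i0 * C0 i i3 + B j i1 * C1 i i3 + B j i2 * C2 i i3) = 0.
Proof.
move=> BA; have := form0 (ev i + ev j) BA; rewrite /form !mulmxDl -!rowE !mxE => H.
rewrite -[RHS]H -[LHS]addr0 -[X in _ + X](alternating i BA) -[LHS]addr0.
by rewrite -[X in _ + X](alternating j BA); ring.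
Qed.
End Alternating.

Definition middle p q r s : 'M[F]_4 :=
  mx4 [:: [:: 1]; [:: 0; p; q]; [:: 0; r; s]; [:: 0; 0; 0; 1]].

(* For the flags [e0, y, H, e3] with [y] in [<e1, e2>], only [e1 + e2] and one of
   [e0 + e3] and [e0 + e1] can be the diagonals provided by [pattern]. *)
Lemma middle_flag p q r s : middle p q r s \in unitmx ->
  (exists2 B, B \in ann T (ev i0) & 
     triang (middle p q r s) B (fun k => ((k == i1) || (k == i2))%:R)) /\
  (exists2 B, B \in T &
     triang (middle p q r s) B (fun k => ((k == i0) || (k == i3))%:R) \/
     triang (middle p q r s) B (fun k => ((k == i0) || (k == i1))%:R)).
Proof.
set P := middle p q r s => uP; case: (nT) => -[_ pT] _ imgE.
have P0 : ev i0 *m P = ev i0.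
  by rewrite -rowE; apply/rowP; apply: ord4P; entries.
have HP u : u \in img T (ev i0) -> exists2 c : 'rV_4, u = c *m P &
    forall j : 'I_4, (3 <= j)%N -> c 0 j = 0.
  rewrite imgE => /eqP u3; exists (u *m invmx P); first by rewrite mulmxKV.
  apply: ord4P => // _; rewrite -[RHS]u3 -[in RHS](mulmxKV uP u).
  by move: (u *m _) => c; entries.
have [c Hc] := pT P uP.
have d03 i j : i != j -> c i = c j -> (i0 == i) || (i0 == j) = false ->
    (i3 == i) || (i3 == j) = false.
  move=> ij cij d0; have [B BT tB] := Hc i j ij cij.
  have := flag_ann char2 cardF d3 dmax uP P0 HP BT tB; rewrite d0.
  by move/(_ erefl i3 isT)/eqP; case: (_ || _); rewrite ?oner_eq0.
have c13 : c i1 != c i3 by apply/eqP => H; have := d03 i1 i3 isT H erefl.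
have c23 : c i2 != c i3 by apply/eqP => H; have := d03 i2 i3 isT H erefl.
have cc (a b d : bool) : a != d -> b != d -> a = b by case: a; case: b; case: d.
split.
  have [B BT tB] := Hc i1 i2 isT (cc _ _ _ c13 c23); exists B => //.
  have [a [b [f [g [h [l Ht]]]]]] := triang4 tB.
  apply/annP; split=> //; rewrite -{1}P0 -mulmxA -rowE; apply/rowP => m.
  by case: (Ht m) => + _ _ _; rewrite mul0r !mxE.
have [c03|c03] := eqVneq (c i0) (c i3).
  by have [B BT tB] := Hc i0 i3 isT c03; exists B => //; left.
by have [B BT tB] := Hc i0 i1 isT (cc _ _ _ c03 c13); exists B => //; right.
Qed.

(** The flags with middle vectors [e1, e2] and [e2, e1] give a lower and an upper unitriangular
    middle block. *)
Lemma unit_blocks : exists B B',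
  [/\ B \in ann T (ev i0), B i1 i1 = 1, B i1 i2 = 0 & B i2 i2 = 1] /\
  [/\ B' \in ann T (ev i0), B' i1 i1 = 1, B' i2 i1 = 0 & B' i2 i2 = 1].
Proof.
have [|[B BA /triang4[a [b [c [f [g [h H]]]]]]] _] := @middle_flag 1 0 0 1.
  by mx4_unit [:: [:: 1]; [:: 0; 1; 0]; [:: 0; 0; 1]; [:: 0; 0; 0; 1 : F]].
have [|[B' BA' /triang4[a' [b' [c' [f' [g' [h' H']]]]]]] _] := @middle_flag 0 1 1 0.
  by mx4_unit [:: [:: 1]; [:: 0; 0; 1]; [:: 0; 1; 0]; [:: 0; 0; 0; 1 : F]].
exists B, B'; split; split=> //.
- by case: (H i1) => _ + _ _; entries.
- by case: (H i2) => _ + _ _; entries.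
- by case: (H i2) => _ _ + _; entries.
- by case: (H' i1) => _ _ + _; entries.
- by case: (H' i1) => _ + _ _; entries.
- by case: (H' i2) => _ + _ _; entries.
Qed.

(** The last disjunction separates the diagonals [e0 + e3] and [e0 + e1]. The scalar [c] appears
    because the diagonal is 0 at index 2 in both: the third flag vector is mapped to a multiple of
    the second, modulo [e0]. *)
Lemma fixed_flag_dichotomy p q r s : middle p q r s \in unitmx ->
  exists B, [/\ B \in T /\ row0_is B 1 0 0, p * B i1 i3 + q * B i2 i3 = 0,
    r * B i1 i3 + s * B i2 i3 = 0,
    exists c, r * B i1 i1 + s * B i2 i1 = c * p /\ r * B i1 i2 + s * B i2 i2 = c * q &
    [/\ B i3 i3 = 1, p * B i1 i1 + q * B i2 i1 = 0 & p * B i1 i2 + q * B i2 i2 = 0] \/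
    [/\ B i3 i3 = 0, p * B i1 i1 + q * B i2 i1 = p & p * B i1 i2 + q * B i2 i2 = q]].
Proof.
move=> /middle_flag[_ [B BT [] /triang4[a [b [c [f [g [h H]]]]]]]]; exists B.
  have [H01 H11 H21 _] := H i1; have [H02 H12 H22 _] := H i2.
  have [_ H13 H23 H33] := H i3; have [H00 _ _ _] := H i0.
  entries in H00; entries in H01; entries in H02; entries in H11; entries in H12.
  entries in H13; entries in H23; entries in H33; entries in H21; entries in H22.
  by split=> //; [exists c | left].
have [H01 H11 H21 _] := H i1; have [H02 H12 H22 _] := H i2.
have [_ H13 H23 H33] := H i3; have [H00 _ _ _] := H i0.
entries in H00; entries in H01; entries in H02; entries in H11; entries in H12.
entries in H13; entries in H23; entries in H33; entries in H21; entries in H22.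
by split=> //; [exists c | right].
Qed.
(** Take [v = e3 + t e0] and lifts [C h] of [e_h]. The vectors [v C_h] are independent as soon as
    [t] avoids the roots of a characteristic polynomial of degree 3. Then [v T] has dimension 3 and
    contains [v], although [v] lies outside the hyperplane that contains all images. *)
Lemma not_hyperplane : (forall B i, B \in T -> B i i3 = 0) -> False.
Proof.
move=> col3; pose w (h : 'I_3) : 'I_4 := inord h.
have wE h : w h = h :> nat by rewrite inordK // (leq_trans (ltn_ord h)).
have [h|C CT Ce] := @fin_all_exists2 _ _ _ (fun h B => ev (w h) = ev i0 *m B)
    (fun h : 'I_3 => _ : exists2 B, B \in T & ev (w h) = ev i0 *m B).
  apply/imgP; case: nT => _ _ ->; rewrite mxE /= (_ : i3 == _ = false) //.
  by apply/eqP => /(congr1 val) /=; rewrite wE => h3; move: (ltn_ord h); rewrite -h3.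
pose K : 'M[F]_3 := \matrix_(h, j) C h i3 (w j).
have [|t] := nonroot char2 cardF (monic_neq0 (char_poly_monic (- K))).
  by rewrite size_char_poly.
rewrite rootE /char_poly -horner_evalE -det_map_mx /= => Ht.
pose v := ev i3 + t *: ev i0.
have vC h : v *m C h = row i3 (C h) + t *: ev (w h).
  by rewrite mulmxDl -scalemxAl -Ce -rowE.
have fM : row_free (\matrix_h (row i3 (C h) + t *: ev (w h))).
  apply/row_freeP.
  pose J : 'M[F]_(4, 3) := \matrix_(i, j) (i == w j)%:R.
  have MJ : (\matrix_h (row i3 (C h) + t *: ev (w h))) *m J =
      map_mx (horner_eval t) (char_poly_mx (- K)).
    apply/matrixP => h j; rewrite !mxE (bigD1 (w j)) //= big1 => [|k kj].
      rewrite !mxE !eqxx mulr1 addr0 /horner_eval /=.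
      rewrite !hornerE /= opprK addrC; congr (_ + _).
      rewrite -(inj_eq val_inj) /= !wE eq_sym -(inj_eq val_inj) /=.
      by case: eqP => _; rewrite ?mulr1n ?mulr0n !hornerE ?mulr1 ?mulr0.
    by rewrite !mxE (negbTE kj) mulr0.
  exists (J *m invmx (map_mx (horner_eval t) (char_poly_mx (- K)))).
  by rewrite mulmxA MJ mulmxV // unitmxE unitfE.
have d3v : \dim (img T v) = 3.
  apply/eqP; rewrite eqn_leq; case: (nT) => gT _ _.
  rewrite dim_img_le3 //; apply: row_free_dim fM _ => h.
  by rewrite rowK -vC mem_img.
case: (nT) => gT _ _; case/imgP: (mem_img_self gT d3v) => B BT.
move=> /rowP/(_ i3)/eqP; rewrite [X in _ == X]mxE big1 => [|k _]; last by rewrite col3 ?mulr0.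
by rewrite !mxE /= mulr0 addr0 oner_eq0.
Qed.

Section Skew.
Variables C0 C1 C2 : 'M[F]_4.
Hypotheses (C0T : C0 \in T) (C1T : C1 \in T) (C2T : C2 \in T).
Hypotheses (row0 : row0_is C0 1 0 0) (row1 : row0_is C1 0 1 0) (row2 : row0_is C2 0 0 1).
Hypotheses (C013 : C0 i1 i3 = 0) (C023 : C0 i2 i3 = 0).

Let alt B i := @alternating C0 C1 C2 C0T C1T C2T row0 row1 row2 B i.
Let sym B i j := @alternating_polar C0 C1 C2 C0T C1T C2T row0 row1 row2 B i j.

(** For the unitriangular blocks, the relations of [alternating] reduce to single coefficients of
    the form on [<e1, e2>]. *)
Lemma skew : [/\ C1 i1 i3 = 0, C2 i2 i3 = 0 & C2 i1 i3 = C1 i2 i3].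
Proof.
have [B [B' [[BA B11 B12 B22] [BA' B11' B21' B22']]]] := unit_blocks.
have a11 : C1 i1 i3 = 0.
  by have := alt i1 BA; rewrite C013 B11 B12 mulr0 mul1r mul0r addr0 add0r.
have a22 : C2 i2 i3 = 0.
  by have := alt i2 BA'; rewrite C023 B21' B22' mulr0 mul1r mul0r !add0r.
split=> //; apply/eqP; rewrite -(addr_eq0_2 char2) addrC; apply/eqP.
have := sym i1 i2 BA.
by rewrite C013 C023 B11 B12 B22 a11 a22 !mulr0 !mul1r !addr0 !add0r.
Qed.

Lemma scalar_block B : C1 i2 i3 != 0 -> B \in ann T (ev i0) ->
  [/\ B i1 i2 = 0, B i2 i1 = 0 & B i1 i1 = B i2 i2].
Proof.
have [a11 a22 a12] := skew; move=> c0 BA; split; apply: (mulIf c0).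
- by have := alt i1 BA; rewrite C013 a11 a12 !mulr0 mul0r !add0r.
- by have := alt i2 BA; rewrite C023 a22 !mulr0 mul0r add0r addr0.
apply/eqP; rewrite -(addr_eq0_2 char2); apply/eqP.
have := sym i1 i2 BA.
by rewrite C013 C023 a11 a22 a12 !mulr0 !addr0 !add0r.
Qed.

(** Assume it is 0. If the form vanishes on [<e1, e2>], all of [T] maps into the hyperplane, against
    [not_hyperplane]. Otherwise the elements with first row [e0] have the same middle block up to
    scalars, and only the diagonal [e0 + e1] is possible for every flag. Then [e1], [e2] and
    [e1 + e2] are eigenvectors of that block, which is thus scalar, while its eigenvalues 1 and 0
    are distinct. *)
Lemma C33_neq0 : C0 i3 i3 <> 0.
Proof.
move=> C033; have [a11 a22 a12] := skew.
have [c0|c0] := eqVneq (C1 i2 i3) 0.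
  have [B [B' [[BA B11 B12 B22] _]]] := unit_blocks.
  have a13 : C1 i3 i3 = 0.
    have := sym i1 i3 BA.
    by rewrite C013 C033 a11 a12 c0 B11 B12 !mulr0 !mul1r !mul0r !addr0 !add0r.
  have a23 : C2 i3 i3 = 0.
    have := sym i2 i3 BA.
    by rewrite C023 C033 a13 a22 c0 B22 !mulr0 !mul1r !addr0 !add0r.
  apply: not_hyperplane => D i /(normal_decomp C0T C1T C2T row0 row1 row2)[E EA ->].
  have z : [/\ C0 i i3 = 0, C1 i i3 = 0 & C2 i i3 = 0].
    by move: i; apply: ord4P; split=> //; rewrite ?normal03 // a12.
  by case: z => z0 z1 z2; rewrite !mxE (normal_col3 _ EA) z0 z1 z2 !mulr0 !addr0.
have diff D : D \in T -> row0_is D 1 0 0 -> [/\ D i1 i2 = C0 i1 i2, D i2 i1 = C0 i2 i1,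
    D i1 i1 - C0 i1 i1 = D i2 i2 - C0 i2 i2 & D i3 i3 = 0].
  move=> DT [D0 D1 D2]; have DA : D - C0 \in ann T (ev i0).
    case: row0 => c00 c01 c02; apply/normal_annP; split; first by rewrite rpredB.
    by split; rewrite !mxE ?(D0, D1, D2, c00, c01, c02) subrr.
  have := normal_col3 i3 DA; have := scalar_block c0 DA.
  rewrite !mxE => -[/eqP b1 /eqP b2 b3] /eqP.
  by rewrite C033 subr0 => /eqP; split=> //; apply/eqP; rewrite -subr_eq0.
have [|B [[BT r0] _ _ [l [_ B22]] B']] := @fixed_flag_dichotomy 1 0 0 1.
  by mx4_unit [:: [:: 1]; [:: 0; 1; 0]; [:: 0; 0; 1]; [:: 0; 0; 0; 1 : F]].
have [|D [[DT s0] _ _ _ D']] := @fixed_flag_dichotomy 0 1 1 0.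
  by mx4_unit [:: [:: 1]; [:: 0; 0; 1]; [:: 0; 1; 0]; [:: 0; 0; 0; 1 : F]].
have [|E [[ET t0] _ _ _ E']] := @fixed_flag_dichotomy 1 1 0 1.
  by mx4_unit [:: [:: 1]; [:: 0; 1; -1]; [:: 0; 0; 1]; [:: 0; 0; 0; 1 : F]].
have [b1 b2 b3 b4] := diff _ BT r0; have [d1 d2 d3' d4] := diff _ DT s0.
have [e1 e2 e3 e4] := diff _ ET t0.
move: B' D' E'; rewrite b4 d4 e4.
have n10 : (0 : F) = 1 -> False by move/esym/eqP; rewrite oner_eq0.
case=> [[/n10//]|[_ B11 B12]] [[/n10//]|[_ D21 D22]] [[/n10//]|[_ E11 E12]].
rewrite !mul0r !mul1r !addr0 in B11 B12; rewrite !mul0r !mul1r !add0r in D21 D22.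
rewrite mulr0 mul0r add0r mul1r in B22; rewrite !mul1r in E11 E12.
rewrite -b1 B12 in d1 e1; rewrite -d2 D21 in e2.
rewrite e2 addr0 in E11; rewrite e1 add0r in E12.
apply: n10; rewrite -B11 -B22; move: e3 b3; rewrite E11 E12 B11 B22 => /addrI ->.
by move/addIr.
Qed.
End Skew.

(** Elements of [T] with the same first row have the same last column, by [normal_col3]. So the
    entry (3,3) is the same for all flags, and [C33_neq0] rules out the diagonal [e0 + e1]. *)
Lemma fixed_flag p q r s : middle p q r s \in unitmx ->
  exists B, [/\ B \in T, row0_is B 1 0 0, p * B i1 i3 + q * B i2 i3 = 0,
    r * B i1 i3 + s * B i2 i3 = 0 &
    [/\ B i3 i3 = 1, p * B i1 i1 + q * B i2 i1 = 0, p * B i1 i2 + q * B i2 i2 = 0 &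
      exists c, r * B i1 i1 + s * B i2 i1 = c * p /\ r * B i1 i2 + s * B i2 i2 = c * q]].
Proof.
have [|C [[CT C0] C13 C23 _ _]] := @fixed_flag_dichotomy 1 0 0 1.
  by mx4_unit [:: [:: 1]; [:: 0; 1; 0]; [:: 0; 0; 1]; [:: 0; 0; 0; 1 : F]].
rewrite !mul0r !mul1r ?add0r ?addr0 in C13 C23.
have [C1 C1T row1] := normal_row0 0 1 0; have [C2 C2T row2] := normal_row0 0 0 1.
have C330 : C i3 i3 <> 0 by exact: C33_neq0 CT C1T C2T C0 row1 row2 C13 C23.
move=> /fixed_flag_dichotomy[B [[BT B0] B13 B23 Bc [[B33 B1 B2]|[B33 _ _]]]].
  by exists B.
case: C330; have /(normal_col3 i3) : B - C \in ann T (ev i0).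
  case: B0 C0 => b0 b1 b2 [c0 c1 c2]; apply/normal_annP; split; first by rewrite rpredB.
  by split; rewrite !mxE ?(b0, b1, b2, c0, c1, c2) subrr.
by rewrite !mxE B33 sub0r => /eqP; rewrite oppr_eq0 => /eqP.
Qed.
End Normal.

(** * Coordinates that put the last columns in standard form *)

Section Shift.
Variable F : fieldType.
Hypothesis char2 : 2%N \in [pchar F].
Hypothesis cardF : card_gt F 2.
Implicit Types (T : {vspace 'M[F]_4}).

(** The scalar [c] is the value of the form at the pair [e1, e2]. *)
Definition skew_coords T c := normal T /\ exists C0 C1 C2 : 'M[F]_4,
  [/\ [/\ C0 \in T, C1 \in T & C2 \in T],
      [/\ row0_is C0 1 0 0, row0_is C1 0 1 0 & row0_is C2 0 0 1],
      [/\ C0 i1 i3 = 0, C0 i2 i3 = 0 & C0 i3 i3 = 1],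
      [/\ C1 i1 i3 = 0, C1 i2 i3 = c & C1 i3 i3 = 0] &
      [/\ C2 i1 i3 = c, C2 i2 i3 = 0 & C2 i3 i3 = 0]].

Lemma normal_skew_coords T : normal T ->
  exists Q c, [/\ Q \in unitmx, ev i0 *m Q = ev i0 & skew_coords (conj Q T) c].
Proof.
move=> nT.
have u1 : @middle F 1 0 0 1 \in unitmx.
  by mx4_unit [:: [:: 1]; [:: 0; 1; 0]; [:: 0; 0; 1]; [:: 0; 0; 0; 1 : F]].
have [C0 [C0T C0r _ _ [C033 _ _ _]]] := fixed_flag char2 cardF nT u1.
have [C1 C1T C1r] := normal_row0 nT 0 1 0; have [C2 C2T C2r] := normal_row0 nT 0 0 1.
(* Replacing [e1] by [e1 + s e0] replaces its lift [C1] by [C1 + s C0], and [C0 i3 i3 = 1]: this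
   choice clears the entry (3,3). The same goes for [t]. *)
pose s := - C1 i3 i3; pose t := - C2 i3 i3.
pose Q : 'M[F]_4 := mx4 [:: [:: 1]; [:: s; 1]; [:: t; 0; 1]; [:: 0; 0; 0; 1]].
have uQ : Q \in unitmx.
  by mx4_unit [:: [:: 1]; [:: -s; 1]; [:: -t; 0; 1]; [:: 0; 0; 0; 1]].
have Q0 : ev i0 *m Q = ev i0.
  by rewrite -rowE; apply/rowP; apply: ord4P; entries.
have nT' : normal (conj Q T).
  case: (nT) => gT dT imgE; split=> [||w]; first exact: good_conj.
    by rewrite dim_img_conj // Q0.
  by rewrite img_conj // Q0 imgE; entries.
have conjE X : X \in T -> exists2 D, D \in conj Q T & Q *m X = D *m Q.
  by move=> XT; exists (Q *m X *m invmx Q); rewrite ?mem_conj // mulmxKV.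
have [D1 D1T E1] : exists2 D, D \in conj Q T & Q *m (C1 + s *: C0) = D *m Q.
  by apply: conjE; rewrite rpredD ?rpredZ.
have [D2 D2T E2] : exists2 D, D \in conj Q T & Q *m (C2 + t *: C0) = D *m Q.
  by apply: conjE; rewrite rpredD ?rpredZ.
have [D0 [D0T D0r D013 D023 [D033 _ _ _]]] := fixed_flag char2 cardF nT' u1.
rewrite ?mul0r ?mul1r ?add0r ?addr0 in D013 D023.
case: (C0r) => c00 c01 c02; case: (C1r) => c10 c11 c12; case: (C2r) => c20 c21 c22.
have D133 : D1 i3 i3 = 0.
  by entry E1 i3 i3; rewrite C033 /s mulr1 subrr => <-.
have D233 : D2 i3 i3 = 0.
  by entry E2 i3 i3; rewrite C033 /t mulr1 subrr => <-.
have D1r : row0_is D1 0 1 0.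
  have D12 : D1 i0 i2 = 0 by entry E1 i0 i2; rewrite c02 c12 mulr0 addr0.
  have D11 : D1 i0 i1 = 1 by entry E1 i0 i1; rewrite c01 c11 mulr0 addr0.
  split=> //; entry E1 i0 i0; rewrite c00 c10 D12 D11 mulr1 mul1r mul0r add0r addr0.
  by rewrite -{1}[s]add0r => /addIr.
have D2r : row0_is D2 0 0 1.
  have D12 : D2 i0 i2 = 1 by entry E2 i0 i2; rewrite c02 c22 mulr0 addr0.
  have D11 : D2 i0 i1 = 0 by entry E2 i0 i1; rewrite c01 c21 mulr0 addr0.
  split=> //; entry E2 i0 i0; rewrite c00 c20 D12 D11 mulr1 mul1r mul0r add0r addr0.
  by rewrite -{1}[t]add0r => /addIr.
have [a11 a22 a12] := skew char2 cardF nT' D0T D1T D2T D0r D1r D2r D013 D023.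
exists Q, (D1 i2 i3); split=> //; split=> //.
by exists D0, D1, D2.
Qed.
End Shift.

(** * The symplectic case *)

Section Symplectic.
Variable F : fieldType.
Hypothesis char2 : 2%N \in [pchar F].
Hypothesis cardF : card_gt F 2.
Implicit Types (T : {vspace 'M[F]_4}) (x y v w : 'rV[F]_4) (P B C : 'M[F]_4).

(** Equivalently [B J] is alternating, where [J] is the antidiagonal matrix with entries
    [1, c, c, 1]. *)
Definition symplectic (c : F) B :=
  [/\ [/\ B i0 i3 = 0, B i1 i2 = 0, B i2 i1 = 0 & B i3 i0 = 0],
      B i0 i0 = B i3 i3 /\ B i1 i1 = B i2 i2,
      B i1 i0 = B i3 i2 * c /\ B i2 i0 = B i3 i1 * c &
      B i1 i3 = B i0 i2 * c /\ B i2 i3 = B i0 i1 * c].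

Section Relations.
Variables (T : {vspace 'M[F]_4}) (c : F).
Hypothesis cT : skew_coords T c.

Lemma ann_rel B : B \in ann T (ev i0) ->
  [/\ B i1 i0 = B i3 i2 * c, B i2 i0 = B i3 i1 * c & B i3 i0 = 0].
Proof.
case: cT => nT [C0 [C1 [C2 [[C0T C1T C2T] [r0 r1 r2] [a1 a2 a3] [b1 b2 b3] [d1 d2 d3]]]]].
move=> BA; have sym := alternating_polar char2 cardF nT C0T C1T C2T r0 r1 r2 _ _ BA.
have eq2 (a b : F) : a + b = 0 -> a = b.
  by move/eqP; rewrite (addr_eq0_2 char2) => /eqP.
split.
- have := sym i1 i3; rewrite a1 a3 b1 b3 d1 d3 !mulr0 !mulr1 !addr0 !add0r.
  exact: eq2.
- have := sym i2 i3; rewrite a2 a3 b2 b3 d2 d3 !mulr0 !mulr1 !addr0 !add0r.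
  exact: eq2.
- have := alternating char2 cardF nT C0T C1T C2T r0 r1 r2 i3 BA.
  by rewrite a3 b3 d3 !mulr0 !mulr1 !addr0.
Qed.
End Relations.

Lemma memv_coefs s (U : {vspace 'M[F]_4}) :
  (forall B, B \in U -> B \in vzero F s -> B = 0) -> (size s <= \dim U)%N ->
  forall w : 'rV_(size s), exists2 B, B \in U & coefs s B = w.
Proof.
move=> U0 dU w; have := dim_vzero s U.
rewrite (_ : (U :&: vzero F s)%VS = 0%VS) ?dimv0 ?add0n => [dI|]; last first.
  apply/eqP; rewrite -subv0; apply/subvP => B; rewrite memv_cap => /andP[BU BZ].
  by rewrite (U0 B) // mem0v.
have /eqP IE : (linfun (coefs (F:=F) s) @: U == fullv)%VS.
  by rewrite eqEdim subvf dI dimvf /dim /= mul1n.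
have : w \in (linfun (coefs (F:=F) s) @: U)%VS by rewrite IE memvf.
by case/memv_imgP => B BU ->; exists B; rewrite // lfunE.
Qed.

Lemma img_not_full T x : good T -> (forall i, ev i \in img T x) -> False.
Proof.
move=> gT H; have := dim_img_le3 char2 cardF x gT.
rewrite (_ : img T x = fullv) ?dimvf //.
apply/eqP; rewrite eqEsubv subvf /=; apply/subvP => w _.
by rewrite (row_sum_delta w) rpred_sum // => i _; rewrite rpredZ.
Qed.

(** Exchanging [e0] and [e3] makes the results about normal coordinates at [e0] available at
    [e3]. *)
Definition swap (i : 'I_4) := if i == i0 then i3 else if i == i3 then i0 else i.

Definition swap_mx : 'M[F]_4 := mx4 [:: [:: 0; 0; 0; 1]; [:: 0; 1]; [:: 0; 0; 1]; [:: 1]].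

Lemma unit_swap_mx : swap_mx \in unitmx.
Proof.
by mx4_unit [:: [:: 0; 0; 0; 1]; [:: 0; 1]; [:: 0; 0; 1]; [:: 1 : F]].
Qed.

Lemma mem_conj_swap T B : B \in T -> \matrix_(i, j) B (swap i) (swap j) \in conj swap_mx T.
Proof. by move=> BT; apply/conjP; [exact: unit_swap_mx|exists B => //]; mx4_eq. Qed.

Lemma conj_swapP T B : B \in conj swap_mx T ->
  exists2 C, C \in T & B = \matrix_(i, j) C (swap i) (swap j).
Proof.
case/(conjP _ _ unit_swap_mx) => C CT E; exists C => //.
apply: (can_inj (mulmxK unit_swap_mx)); rewrite -E; mx4_eq.
Qed.

Section Nonzero.
Variables (T : {vspace 'M[F]_4}) (c : F).
Hypothesis cT : skew_coords T c.
Hypothesis c0 : c != 0.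

Let nT : normal T. Proof. by case: cT. Qed.
Let gT : good T. Proof. by case: nT. Qed.

Lemma ann_scalar B : B \in ann T (ev i0) ->
  [/\ B i1 i2 = 0, B i2 i1 = 0 & B i1 i1 = B i2 i2].
Proof.
case: cT => _ [C0 [C1 [C2 [[C0T C1T C2T] [r0 r1 r2] [a1 a2 a3] [b1 b2 b3] [d1 d2 d3]]]]].
by apply: (scalar_block char2 cardF nT C0T C1T C2T r0 r1 r2) => //; rewrite b2.
Qed.

Lemma ann_symplectic B : B \in ann T (ev i0) -> symplectic c B.
Proof.
move=> BA; have [B12 B21 B11] := ann_scalar BA; have [B10 B20 B30] := ann_rel cT BA.
have [BT [B00 B01 B02]] := normal_annP nT _ BA.
have n3 := normal_col3 char2 cardF nT _ BA.
by split; rewrite ?B12 ?B21 ?B30 ?n3 ?B00 ?B01 ?B02 ?mul0r.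
Qed.

Lemma ann_param a p q : exists2 B, B \in ann T (ev i0) &
  [/\ B i1 i1 = a, B i3 i1 = p & B i3 i2 = q].
Proof.
pose s := [:: (i1, i1); (i3, i1); (i3, i2)].
have [||B BA /rowP E] := @memv_coefs s (ann T (ev i0)) _ _ (\row_k [:: a; p; q]`_k).
- move=> B BA; rewrite mem_vzero /= andbT => /and3P[/eqP B11 /eqP B31 /eqP B32].
  have [B12 B21 B22] := ann_scalar BA; have [B10 B20 B30] := ann_rel cT BA.
  have [BT [B00 B01 B02]] := normal_annP nT _ BA.
  apply/matrixP; apply: ord4P; apply: ord4P; rewrite mxE ?(normal_col3 char2 cardF nT _ BA) //.
  + by rewrite B10 B32 mul0r.
  + by rewrite B20 B31 mul0r.
  by rewrite -B22.
- by rewrite normal_dim_ann.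
exists B => //; split.
- by move: (E (@Ordinal 3 0 isT)); rewrite !mxE.
- by move: (E (@Ordinal 3 1 isT)); rewrite !mxE.
by move: (E (@Ordinal 3 2 isT)); rewrite !mxE.
Qed.

(** Subtracting an element that kills [e0] changes neither the first row nor the last column, and
    its three parameters clear the entries (1,1), (3,1) and (3,2). *)
Lemma reduced C : C \in T -> exists2 D, D \in T &
  [/\ forall j, D i0 j = C i0 j, forall i, D i i3 = C i i3,
      [/\ D i1 i2 = C i1 i2, D i2 i1 = C i2 i1 & D i2 i2 - D i1 i1 = C i2 i2 - C i1 i1],
      D i3 i1 = 0 /\ D i3 i2 = 0 & D i1 i1 = 0].
Proof.
move=> CT; have [B BA [B11 B31 B32]] := ann_param (C i1 i1) (C i3 i1) (C i3 i2).
have [BT [B00 B01 B02]] := normal_annP nT _ BA.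
have [B12 B21 B22] := ann_scalar BA; have n3 := normal_col3 char2 cardF nT _ BA.
exists (C - B); first by rewrite rpredB.
split.
- by apply: ord4P; rewrite !mxE ?B00 ?B01 ?B02 ?n3 subr0.
- by move=> i; rewrite !mxE n3 subr0.
- by rewrite !mxE B12 B21 !subr0 -B22; split=> //; ring.
- by rewrite !mxE B31 B32 !subrr.
by rewrite !mxE B11 subrr.
Qed.

Lemma reduced_basis : exists C0 C1 C2,
  [/\ [/\ C0 \in T, C1 \in T & C2 \in T],
      [/\ row0_is C0 1 0 0, row0_is C1 0 1 0 & row0_is C2 0 0 1],
      [/\ C0 i1 i3 = 0, C0 i2 i3 = 0, C0 i3 i3 = 1, C0 i3 i1 = 0 & C0 i3 i2 = 0] /\
      [/\ C0 i1 i1 = 0, C0 i1 i2 = 0, C0 i2 i1 = 0 & C0 i2 i2 = 0],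
      [/\ C1 i1 i3 = 0, C1 i2 i3 = c & C1 i3 i3 = 0] /\
      [/\ C1 i1 i1 = 0, C1 i3 i1 = 0 & C1 i3 i2 = 0] &
      [/\ C2 i1 i3 = c, C2 i2 i3 = 0 & C2 i3 i3 = 0] /\
      [/\ C2 i1 i1 = 0, C2 i3 i1 = 0 & C2 i3 i2 = 0]].
Proof.
case: cT => _ [_ [C1 [C2 [[_ C1T C2T] [_ r1 r2] _ [b1 b2 b3] [d1 d2 d3]]]]].
have [|C [CT r0 a1 a2 [a3 a11 a12 [l [_ a22]]]]] :=
  fixed_flag char2 cardF nT (p := 1) (q := 0) (r := 0) (s := 1).
  by mx4_unit [:: [:: 1]; [:: 0; 1]; [:: 0; 0; 1]; [:: 0; 0; 0; 1 : F]].
have [|D [DT s0 _ _ [_ D21 _ _]]] :=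
  fixed_flag char2 cardF nT (p := 0) (q := 1) (r := 1) (s := 0).
  by mx4_unit [:: [:: 1]; [:: 0; 0; 1]; [:: 0; 1]; [:: 0; 0; 0; 1 : F]].
(* The flag through [e1] leaves only this entry of the middle block open. The flag through [e2]
   settles it, because the two matrices differ by a scalar block. *)
have C21 : C i2 i1 = 0.
  have /ann_scalar[_ + _] : D - C \in ann T (ev i0).
    case: s0 r0 => [g0 g1 g2] [e0 e1 e2]; apply/(normal_annP nT); rewrite rpredB //.
    by split=> //; split; rewrite !mxE ?(g0, g1, g2) ?(e0, e1, e2) subrr.
  rewrite !mxE => /eqP; rewrite subr_eq0 => /eqP <-.
  by move: D21; rewrite mul0r mul1r add0r.
rewrite ?(mul0r, mul1r, mulr0, add0r, addr0) in a1 a2 a11 a12 a22.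
have [E0 E0T [E0r E03 [E012 E021 E022] [E031 E032] E011]] := reduced CT.
have [E1 E1T [E1r E13 _ [E131 E132] E111]] := reduced C1T.
have [E2 E2T [E2r E23 _ [E231 E232] E211]] := reduced C2T.
exists E0, E1, E2; split=> //.
- by split; rewrite /row0_is ?E0r ?E1r ?E2r.
- split; rewrite ?E03 ?E012 ?E021 ?E031 ?E032 //; split=> //.
  by move: E022; rewrite E011 a22 a11 !subr0.
- by rewrite !E13 b1 b2.
by rewrite !E23 d1 d2.
Qed.

Lemma symplecticD B C : symplectic c B -> symplectic c C -> symplectic c (B + C).
Proof.
move=> [[b1 b2 b3 b4] [b5 b6] [b7 b8] [b9 b10]] [[c1 c2 c3 c4] [c5 c6] [c7 c8] [c9 c10]].
split; first by split; rewrite !mxE ?(b1, b2, b3, b4) ?(c1, c2, c3, c4) addr0.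
- by rewrite !mxE b5 b6 c5 c6.
- by rewrite !mxE b7 b8 c7 c8 !mulrDl.
by rewrite !mxE b9 b10 c9 c10 !mulrDl.
Qed.

Lemma symplecticZ a B : symplectic c B -> symplectic c (a *: B).
Proof.
move=> [[b1 b2 b3 b4] [b5 b6] [b7 b8] [b9 b10]].
split; first by split; rewrite !mxE ?(b1, b2, b3, b4) mulr0.
- by rewrite !mxE b5 b6.
- by rewrite !mxE b7 b8 !mulrA.
by rewrite !mxE b9 b10 !mulrA.
Qed.

(** The elements killing [e0] satisfy only half of the relations nontrivially. The other half
    follows by symmetry, once [e3 T] is shown to be [<e1, e2, e3>], so that the coordinates are also
    normal at [e3]. *)
Lemma symplectic_coords B : B \in T -> symplectic c B.
Proof.
have [C0 [C1 [C2 [[C0T C1T C2T] [r0 r1 r2]]]]] := reduced_basis.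
case=> -[C013 C023 C033 C031 C032] [C011 C012 C021 C022].
case=> -[C113 C123 C133] [C111 C131 C132] [[C213 C223 C233] [C211 C231 C232]].
have [E1 E1A [e111 e131 e132]] := ann_param 0 1 0.
have [E2 E2A [e211 e231 e232]] := ann_param 0 0 1.
have [[E1T _] [E2T _]] := (normal_annP nT _ E1A, normal_annP nT _ E2A).
have [_ e120 e130] := ann_rel cT E1A; have [_ _ e230] := ann_rel cT E2A.
have img1 : ev i1 \in img T (ev i3).
  apply/imgP; exists E1 => //; rewrite -rowE; apply/rowP; apply: ord4P;
  by rewrite !mxE ?e130 ?e131 ?e132 ?(normal_col3 char2 cardF nT _ E1A).
have img2 : ev i2 \in img T (ev i3).
  apply/imgP; exists E2 => //; rewrite -rowE; apply/rowP; apply: ord4P;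
  by rewrite !mxE ?e230 ?e231 ?e232 ?(normal_col3 char2 cardF nT _ E2A).
have row3 C : C \in T -> C i3 i1 = 0 -> C i3 i2 = 0 ->
    C i3 i0 *: ev i0 + C i3 i3 *: ev i3 \in img T (ev i3).
  move=> CT C1' C2'; apply/imgP; exists C => //; rewrite -rowE; apply/rowP.
  by apply: ord4P; rewrite !mxE /= ?mulr0 ?mulr1 ?addr0 ?add0r.
have img3 := row3 _ C0T C031 C032; rewrite C033 scale1r in img3.
(* [e3 T] already contains [e1], [e2] and a vector of [e3 + <e0>]; with [e0] it would be the whole
   space. *)
have full : ev i0 \notin img T (ev i3).
  apply/negP => img0; apply: (@img_not_full T (ev i3) gT).
  by apply: ord4P => //; move: img3; rewrite rpredDl // rpredZ.
have zero a : a *: ev i0 \in img T (ev i3) -> a = 0.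
  move=> aI; apply/eqP; apply: contraR full => a0.
  by rewrite -[ev i0](scalerK a0) rpredZ.
have C130 : C1 i3 i0 = 0.
  by apply: zero; move: (row3 _ C1T C131 C132); rewrite C133 scale0r addr0.
have C230 : C2 i3 i0 = 0.
  by apply: zero; move: (row3 _ C2T C231 C232); rewrite C233 scale0r addr0.
have dim3 : \dim (img T (ev i3)) = 3.
  apply/eqP; rewrite eqn_leq dim_img_le3 //=.
  have fr : free [:: ev i1; ev i2; C0 i3 i0 *: ev i0 + ev i3].
    apply: free3 => [|a b /rowP/(_ i3)/eqP].
      apply: free2 (ev_neq0 F _) _ => a /rowP/(_ i2)/eqP.
      by rewrite !mxE /= mulr0 oner_eq0.
    by rewrite !mxE /= !mulr0 add0r addr0 oner_eq0.
  have d3 : \dim <<[:: ev i1; ev i2; C0 i3 i0 *: ev i0 + ev i3]>> = 3 by rewrite (eqP fr).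
  rewrite -[X in (X <= _)%N]d3; apply: dimvS; apply/span_subvP => w.
  by rewrite !inE => /or3P[] /eqP->.
have self := mem_img_self gT dim3.
have C030 : C0 i3 i0 = 0 by apply: zero; move: img3; rewrite rpredDr.
have T30 D : D \in T -> D i3 i0 = 0.
  move=> /(normal_decomp nT C0T C1T C2T r0 r1 r2)[E /(ann_rel cT)[_ _ E30] ->].
  by rewrite !mxE C030 C130 C230 E30 !mulr0 !addr0.
have sw0 : ev i0 *m swap_mx = ev i3.
  by rewrite -rowE; apply/rowP; apply: ord4P; entries.
have nT' : normal (conj swap_mx T).
  have us := unit_swap_mx; split=> [||w]; first exact: good_conj.
    by rewrite dim_img_conj // sw0.
  rewrite img_conj // sw0; apply/imgP/eqP => [[D DT]|w3].
    move=> /rowP/(_ i0); rewrite -rowE [RHS]mxE T30 // => <-; by entries.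
  apply/imgP; rewrite (row_sum_delta (w *m _)) sum4 !rpredD //; try exact: rpredZ.
  by rewrite (_ : (w *m _) 0 i0 = 0) ?scale0r ?mem0v // -w3; entries.
pose S (X : 'M[F]_4) := \matrix_(i, j) X (swap i) (swap j).
have annS X : X \in T -> X i3 i1 = 0 -> X i3 i2 = 0 -> X i3 i3 = 0 ->
    S X \in ann (conj swap_mx T) (ev i0).
  move=> XT X1 X2 X3; apply/(normal_annP nT'); split; first exact: mem_conj_swap.
  by split; rewrite mxE.
have row0S : row0_is (S C0) 1 0 0 by split; rewrite mxE.
have [|D [DT [D0 D1 D2] D13 D23 _]] :=
  fixed_flag char2 cardF nT' (p := 1) (q := 0) (r := 0) (s := 1).
  by mx4_unit [:: [:: 1]; [:: 0; 1]; [:: 0; 0; 1]; [:: 0; 0; 0; 1 : F]].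
have col3S i : D i i3 = S C0 i i3.
  have /(normal_col3 char2 cardF nT' i) : D - S C0 \in ann (conj swap_mx T) (ev i0).
    case: row0S => s0 s1 s2; apply/(normal_annP nT'); rewrite rpredB ?mem_conj_swap //.
    by split=> //; split; rewrite mxE [X in _ + X]mxE ?(D0, D1, D2) ?(s0, s1, s2) subrr.
  by rewrite mxE [X in _ + X]mxE => /eqP; rewrite subr_eq0 => /eqP.
have C010 : C0 i1 i0 = 0.
  by have := col3S i1; rewrite mxE => <-; rewrite mul0r mul1r addr0 in D13.
have C020 : C0 i2 i0 = 0.
  by have := col3S i2; rewrite mxE => <-; rewrite mul0r mul1r add0r in D23.
(* Such an [X] kills [e3]. At [e3] the lifts of [e1] and [e2] are [E1] and [E2], and the form takes
   the nonzero value [E1 i2 i0 = c], so [scalar_block] applies. *)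
have symp X : X \in T -> X i3 i1 = 0 -> X i3 i2 = 0 -> X i3 i3 = 0 -> X i1 i1 = 0 ->
    [/\ [/\ X i1 i2 = 0, X i2 i1 = 0 & X i2 i2 = 0], X i1 i0 = 0 & X i2 i0 = 0].
  move=> XT X31 X32 X33 X11; have XS := annS X XT X31 X32 X33.
  have sE1 : row0_is (S E1) 0 1 0.
    by split; rewrite mxE //= (normal_col3 char2 cardF nT _ E1A).
  have sE2 : row0_is (S E2) 0 0 1.
    by split; rewrite mxE //= (normal_col3 char2 cardF nT _ E2A).
  have [||||||x12 x21 x11] := scalar_block char2 cardF nT' (C0 := S C0) (C1 := S E1) (C2 := S E2)
    _ _ _ row0S sE1 sE2 _ _ _ XS; rewrite ?mem_conj_swap //.
  - by rewrite mxE.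
  - by rewrite mxE.
  - by rewrite mxE /= e120 e131 mul1r.
  have n3 i := normal_col3 char2 cardF nT' i XS.
  rewrite !mxE /= in x12 x21 x11; split; first by rewrite -x11.
    by have := n3 i1; rewrite mxE.
  by have := n3 i2; rewrite mxE.
move=> /(normal_decomp nT C0T C1T C2T r0 r1 r2)[E /ann_symplectic sE ->].
apply: symplecticD sE; apply: symplecticD; last first.
  have [[x12 x21 x22] x10 x20] := symp C2 C2T C231 C232 C233 C211.
  case: r2 => c0' c1' c2'; apply: symplecticZ; split.
  - by split; rewrite ?(normal03 nT C2T).
  - by rewrite c0' C211 C233 x22.
  - by rewrite x10 x20 C231 C232 !mul0r.
  by rewrite C213 C223 c1' c2' mul1r mul0r.
apply: symplecticD.
  case: r0 => c0' c1' c2'; apply: symplecticZ; split.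
  - by split; rewrite ?(normal03 nT C0T).
  - by rewrite c0' C033 C011 C022.
  - by rewrite C010 C020 C031 C032 !mul0r.
  by rewrite C013 C023 c1' c2' !mul0r.
have [[x12 x21 x22] x10 x20] := symp C1 C1T C131 C132 C133 C111.
case: r1 => c0' c1' c2'; apply: symplecticZ; split.
- by split; rewrite ?(normal03 nT C1T).
- by rewrite c0' C111 C133 x22.
- by rewrite x10 x20 C131 C132 !mul0r.
by rewrite C113 C123 c1' c2' mul1r mul0r.
Qed.
End Nonzero.
End Symplectic.

(** * The degenerate case *)

Section Hyperplane.
Variable F : fieldType.
Hypothesis char2 : 2%N \in [pchar F].
Hypothesis cardF : card_gt F 2.
Implicit Types (T : {vspace 'M[F]_4}) (x y v w : 'rV[F]_4) (P B C D : 'M[F]_4).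

Lemma free_middle v w : v 0 i1 * w 0 i2 - v 0 i2 * w 0 i1 != 0 -> free [:: v; w].
Proof.
move=> d0; apply: free2 => [|a wE].
  by apply: contra d0 => /eqP->; rewrite !mxE !mul0r subrr.
by move: d0; rewrite wE !mxE mulrCA [v 0 i2 * _]mulrCA [v 0 i2 * _]mulrC subrr eqxx.
Qed.

Section Degenerate.
Variable T : {vspace 'M[F]_4}.
Hypothesis cT : skew_coords T 0.

Let nT : normal T. Proof. by case: cT. Qed.

Lemma degenerate_col3 B : B \in T -> [/\ B i0 i3 = 0, B i1 i3 = 0 & B i2 i3 = 0].
Proof.
case: cT => _ [C0 [C1 [C2 [[C0T C1T C2T] [r0 r1 r2] [a1 a2 a3] [b1 b2 b3] [d1 d2 d3]]]]].
move=> /[dup] /(normal03 nT) B03 /(normal_decomp nT C0T C1T C2T r0 r1 r2)[E EA ->].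
have n3 := normal_col3 char2 cardF nT _ EA.
split; rewrite !mxE n3 ?(a1, a2, b1, b2, d1, d2) ?mulr0 ?addr0 //.
by rewrite !(normal03 nT) // !mulr0 !addr0.
Qed.

Lemma degenerate_ann B : B \in ann T (ev i0) ->
  [/\ B i1 i0 = 0, B i2 i0 = 0 & B i3 i0 = 0].
Proof. by case/(ann_rel char2 cardF cT) => -> -> ->; rewrite !mulr0. Qed.

(** The annihilator of [e0] has dimension 3. If its elements with zero middle block have dimension
    at least 2, [v = e3] works. Otherwise two of its elements have independent middle blocks, and
    [v] is found on a line through [e3]. *)
Lemma degenerate_span : exists v B C, [/\ B \in ann T (ev i0), C \in ann T (ev i0),
  v 0 i3 = 1 & free [:: v *m B; v *m C]].
Proof.
pose s := [:: (i1, i1); (i1, i2); (i2, i1); (i2, i2)].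
pose W := (ann T (ev i0) :&: vzero F s)%VS.
have zero B : B \in ann T (ev i0) -> B \in vzero F (s ++ [:: (i3, i1); (i3, i2)]) -> B = 0.
  move=> BA; rewrite mem_vzero /= andbT.
  move=> /and5P[/eqP b11 /eqP b12 /eqP b21 /eqP b22 /andP[/eqP b31 /eqP b32]].
  have [B10 B20 B30] := degenerate_ann BA.
  have [BT [B00 B01 B02]] := normal_annP nT _ BA.
  apply/matrixP; apply: ord4P; apply: ord4P;
  by rewrite mxE ?(normal_col3 char2 cardF nT _ BA).
have [dW|dW] := leqP 2 (\dim W).
  pose t : seq ('I_4 * 'I_4) := [:: (i3, i1); (i3, i2)].
  have onto (w : 'rV[F]_(size t)) : exists2 B, B \in W & coefs t B = w.
    apply: memv_coefs => // B; rewrite memv_cap => /andP[BA Bs] Bt; apply: zero => //.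
    by move: Bs Bt; rewrite !mem_vzero all_cat => -> ->.
  have [B BW /rowP EB] := onto (\row_k (val k == 0)%:R).
  have [C CW /rowP EC] := onto (\row_k (val k == 1)%:R).
  have [BA CA] : B \in ann T (ev i0) /\ C \in ann T (ev i0).
    by move: BW CW; rewrite !memv_cap => /andP[-> _] /andP[-> _].
  exists (ev i3), B, C; split; rewrite ?mxE //; apply: free_middle.
  pose j0 := @Ordinal 2 0 isT; pose j1 := @Ordinal 2 1 isT.
  move: (EB j0) (EB j1) (EC j0) (EC j1); rewrite -!rowE !mxE /= => -> -> -> ->.
  by rewrite mulr1 mulr0 subr0 oner_eq0.
have [B [_ [[BA B11 B12 B22] _]]] := unit_blocks char2 cardF nT.
have /subvPn[C CA CW] : ~~ (ann T (ev i0) <= W + <[B]>)%VS.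
  apply/negP => /dimvS; rewrite normal_dim_ann // leqNgt.
  apply/negP/negPn; rewrite ltnS; apply: leq_trans (dimv_add_leqif _ _) _.
  by apply: leq_trans (leq_add (ltnSE dW) (_ : _ <= 1)%N) _; rewrite ?dim_vline ?leq_b1.
(* This is the determinant of [u B] and [u C] in the coordinates 1 and 2, for [u = a e1 + b e2]. A
   binary quadratic form that is zero at (1,0), (0,1) and (1,1) is zero, which would make the block
   of [C] a multiple of that of [B]. *)
pose c2 (a b : F) := (a + b * B i2 i1) * (a * C i1 i2 + b * C i2 i2) -
  b * (a * C i1 i1 + b * C i2 i1).
have [a [b ab]] : exists a b, c2 a b != 0.
  have [c10|] := eqVneq (c2 1 0) 0; last by exists 1, 0.
  have [c01|] := eqVneq (c2 0 1) 0; last by exists 0, 1.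
  have [c11|] := eqVneq (c2 1 1) 0; last by exists 1, 1.
  case/negP: CW; rewrite -[C](subrK (C i2 i2 *: B)) memv_add ?memvZ ?memv_line //.
  rewrite memv_cap rpredB ?rpredZ // mem_vzero /= andbT.
  rewrite /c2 !(mul0r, mul1r, addr0, subr0) in c10.
  rewrite /c2 c10 !(mul0r, mul1r, add0r) in c01 c11.
  have c21 : C i2 i1 = B i2 i1 * C i2 i2 by apply/eqP; rewrite eq_sym -subr_eq0 c01.
  have c11' : C i1 i1 = C i2 i2.
    apply/eqP; rewrite eq_sym -subr_eq0 -[X in _ == X]c11 c21; apply/eqP; ring.
  rewrite !mxE B11 B12 B22 c10 c21 c11' !mulr1 mulr0 !subrr (mulrC (C i2 i2)) subrr.
  by rewrite eqxx.
pose u := a *: ev i1 + b *: ev i2 : 'rV[F]_4.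
pose d v w := (v *m B) 0 i1 * (w *m C) 0 i2 - (v *m B) 0 i2 * (w *m C) 0 i1.
(* For [e3 + t u] the determinant is quadratic in [t], with leading coefficient [c2 a b]. *)
have [|t t0 dt] := quadratic_nonroot char2 cardF
  (c0 := d (ev i3) (ev i3)) (c1 := d (ev i3) u + d u (ev i3)) (c2 := d u u).
  have -> : d u u = c2 a b.
    rewrite /d /u /c2 !mulmxDl -!scalemxAl -!rowE !mxE B11 B12 B22; ring.
  by rewrite ab !orbT.
exists (ev i3 + t *: u), B, C; split=> //.
  by rewrite !mxE /= !(mulr0, addr0).
apply: free_middle; rewrite !mulmxDl -!scalemxAl; move: dt; rewrite /d.
move: (ev i3 *m B) (ev i3 *m C) (u *m B) (u *m C) => x1 x2 x3 x4.
by congr (_ != 0); rewrite !mxE; ring.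
Qed.
End Degenerate.
Lemma conj_comp T P Q : P \in unitmx -> Q \in unitmx ->
  conj Q (conj P T) = conj (Q *m P) T.
Proof.
move=> uP uQ; have uQP : Q *m P \in unitmx by rewrite unitmx_mul uQ.
apply/vspaceP => B; apply/(conjP _ _ uQ)/(conjP _ _ uQP) => [[C /(conjP _ _ uP)[D DT PD] QC]|[D DT QPD]].
  by exists D; rewrite // -mulmxA PD mulmxA QC mulmxA.
exists (P *m D *m invmx P); first by rewrite mem_conj.
by rewrite !mulmxA QPD mulmxA mulmxK.
Qed.

Lemma ann_conj T P x B : P \in unitmx ->
  (P *m B *m invmx P \in ann (conj P T) x) = (B \in ann T (x *m P)).
Proof.
move=> uP; apply/annP/annP; rewrite mem_conj // => -[BT xB]; split=> //.
  by apply: (can_inj (mulmxK (_ : invmx P \in unitmx)));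
     rewrite ?unitmx_inv // mul0mx -[RHS]xB !mulmxA.
by rewrite !mulmxA xB mul0mx.
Qed.

Lemma free_mul P v w : P \in unitmx -> free [:: v; w] -> free [:: v *m P; w *m P].
Proof.
move=> uP; rewrite !free_cons !span_seq1 span_nil !nil_free !memv0 !andbT => /andP[vw w0].
apply/andP; split.
  apply: contra vw => /vlineP[a aE]; apply/vlineP; exists a.
  by apply: (can_inj (mulmxK uP)); rewrite aE scalemxAl.
by apply: contra w0 => /eqP wP; rewrite -[w](mulmxK uP) wP mul0mx.
Qed.

(** For [phi] nonzero, its kernel on row vectors is a hyperplane invariant under [T]. *)
Definition eigencol T (phi : 'cV[F]_4) := forall B, B \in T -> exists b, B *m phi = b *: phi.

(** The vectors [v B], [v C] in the hyperplane and the matrix acting as 1 modulo it serve to show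
    that [v] is another point of rank 3. *)
Lemma symplectic_or_hyperplane T x : good T -> \dim (img T x) = 3 ->
  (exists P c, [/\ P \in unitmx, c != 0 & forall B, B \in conj P T -> symplectic c B]) \/
  exists phi, [/\ eigencol T phi, forall w, (w \in img T x) = (w *m phi == 0),
    exists2 B, B \in T & B *m phi = phi &
    exists v B C, [/\ B \in ann T x, C \in ann T x, v *m phi != 0 & free [:: v *m B; v *m C]]].
Proof.
move=> gT d3; have [P [uP P0 nT]] := normalize gT d3.
have [Q [c [uQ Q0]]] := normal_skew_coords char2 cardF nT.
rewrite conj_comp //; set R := Q *m P => cT.
have uR : R \in unitmx by rewrite unitmx_mul uQ.
have R0 : ev i0 *m R = x by rewrite mulmxA Q0.
clearbody R.
have [c0|c0] := eqVneq c 0; last first.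
  by left; exists R, c; split=> // B; apply: symplectic_coords.
right; rewrite c0 in cT; pose e3 : 'cV[F]_4 := delta_mx i3 0.
have we3 (w : 'rV[F]_4) : w *m e3 = (w 0 i3)%:M.
  by apply/matrixP => i j; rewrite !ord1 -colE !mxE eqxx mulr1n.
exists (invmx R *m e3); split.
- move=> B BT; exists ((R *m B *m invmx R) i3 i3).
  have : R *m B *m invmx R \in conj R T by rewrite mem_conj.
  have -> : B *m (invmx R *m e3) = invmx R *m (R *m B *m invmx R *m e3).
    by rewrite !mulmxA mulVmx // mul1mx.
  move: (R *m B *m invmx R) => D /(degenerate_col3 cT)[D0 D1 D2].
  rewrite scalemxAr; congr (_ *m _); rewrite -colE.
  by apply/colP; apply: ord4P; rewrite !mxE ?D0 ?D1 ?D2 ?mulr0 ?mulr1.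
- move=> w; rewrite -R0 -[w in LHS](mulmxKV uR) -img_conj // mulmxA we3.
  case: cT => -[_ _ ->] _; apply/eqP/eqP => [->|/matrixP/(_ 0 0)]; first exact: raddf0.
  by rewrite !mxE eqxx mulr1n.
- case: (cT) => _ [C0 [_ [_ [[C0T _ _] _ [a1 a2 a3] _ _]]]].
  have [B BT RB] := conjP _ _ uR C0T.
  exists B => //; apply: (can_inj (mulKmx uR)); rewrite !mulmxA RB mulmxK // mulmxV // mul1mx.
  rewrite -colE; apply/colP; apply: ord4P; rewrite !mxE //.
  by case: cT => nT' _; rewrite (normal03 nT').
have [v [B [C [BA CA v3 fr]]]] := degenerate_span cT.
exists (v *m R), (invmx R *m B *m R), (invmx R *m C *m R).
have back D : D \in ann (conj R T) (ev i0) -> invmx R *m D *m R \in ann T x.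
  move=> DA; rewrite -R0 -(ann_conj _ _ _ uR).
  have -> : R *m (invmx R *m D *m R) *m invmx R = D by rewrite -mulmxA mulmxK // mulKVmx.
  exact: DA.
split; [exact: back|exact: back|..].
  rewrite mulmxA mulmxK // we3 v3; apply/eqP => /matrixP/(_ 0 0)/eqP.
  by rewrite !mxE eqxx oner_eq0.
rewrite !mulmxA mulmxK //.
exact: free_mul.
Qed.
End Hyperplane.

(** * Spaces with two invariant hyperplanes *)

Section Classification.
Variable F : fieldType.
Hypothesis char2 : 2%N \in [pchar F].
Hypothesis cardF : card_gt F 2.
Implicit Types (T : {vspace 'M[F]_4}) (x y v w : 'rV[F]_4) (P B C D : 'M[F]_4).

(** The hyperplanes [<e0, e1, e2>] and [<e1, e2, e3>] are invariant, hence so is the plane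
    [<e1, e2>]. The last two conditions say that [e0] and [e3] can be sent anywhere in this
    plane. *)
Definition bidegenerate T :=
  [/\ good T,
    forall D, D \in T -> [/\ D i0 i3 = 0, D i1 i3 = 0 & D i2 i3 = 0] /\
      [/\ D i1 i0 = 0, D i2 i0 = 0 & D i3 i0 = 0],
    forall p q, exists2 D, D \in T & D i0 i1 = p /\ D i0 i2 = q &
    forall p q, exists2 D, D \in T &
      [/\ D i0 i0 = 0, D i0 i1 = 0, D i0 i2 = 0 & D i3 i3 = 0] /\
      (D i3 i1 = p /\ D i3 i2 = q)].

Definition dir_mx (a b h1 h2 : F) : 'M[F]_4 :=
  mx4 [:: [:: a]; [:: 0; b]; [:: 0; 0; b]; [:: 0; h1; h2; a]].

(** With [f = e3 + h1 e1 + h2 e2], the two matrices are the projections attached to the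
    decomposition into [<e0, f>] and [<e1, e2>]. Preserving [<e0, f>] imposes four independent
    conditions on [T], which leaves dimension 2, so that [plane_scalar] applies to the flag
    [e0, f, e1, e2]. *)
Lemma bidegenerate_dir T h1 h2 : bidegenerate T ->
  (forall p q, exists2 D, D \in T &
    [/\ D i0 i0 = 0, D i0 i1 = 0, D i0 i2 = 0 & D i3 i3 = 0] /\
    (h1 * D i1 i1 + h2 * D i2 i1 + D i3 i1 = p /\
     h1 * D i1 i2 + h2 * D i2 i2 + D i3 i2 = q)) ->
  dir_mx 1 0 h1 h2 \in T /\ dir_mx 0 1 (- h1) (- h2) \in T.
Proof.
move=> [gT zT onto1 _] onto2.
pose P : 'M[F]_4 := mx4 [:: [:: 1]; [:: 0; h1; h2; 1]; [:: 0; 1]; [:: 0; 0; 1]].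
have uP : P \in unitmx.
  by mx4_unit [:: [:: 1]; [:: 0; 0; 1]; [:: 0; 0; 0; 1]; [:: 0; 1; - h1; - h2]].
have [dT' pT'] := good_conj uP gT.
pose s := [:: (i0, i2); (i0, i3); (i1, i2); (i1, i3)].
pose U := (conj P T :&: vzero F s)%VS.
have dU : (\dim U <= 2)%N.
  have := dim_vzero s (conj P T); rewrite dT'.
  suff -> : (linfun (coefs (F:=F) s) @: conj P T)%VS = fullv.
    by rewrite dimvf => /(@addIn 4 _ 2) ->.
  apply/eqP; rewrite eqEsubv subvf; apply/subvP => w _.
  pose k0 := @Ordinal 4 0 isT; pose k1 := @Ordinal 4 1 isT.
  pose k2 := @Ordinal 4 2 isT; pose k3 := @Ordinal 4 3 isT.
  have [X XT [X1 X2]] := onto1 (w 0 k0) (w 0 k1).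
  have [Y YT [[Y0 Y1 Y2 Y3] [Y31 Y32]]] := onto2
    (w 0 k2 - (h1 * X i1 i1 + h2 * X i2 i1 + X i3 i1 - X i3 i3 * h1))
    (w 0 k3 - (h1 * X i1 i2 + h2 * X i2 i2 + X i3 i2 - X i3 i3 * h2)).
  have [D [DT PD]] : exists D, D \in conj P T /\ P *m (X + Y) = D *m P.
    by exists (P *m (X + Y) *m invmx P); rewrite mem_conj // mulmxKV // rpredD.
  have [[X03 X13 X23] _] := zT X XT; have [[Y03 Y13 Y23] _] := zT Y YT.
  have D01 : D i0 i1 = 0 by entry PD i0 i3; rewrite X03 Y03 addr0.
  have D11 : D i1 i1 = X i3 i3.
    by entry PD i1 i3; rewrite X13 Y13 X23 Y23 Y3 !(addr0, mulr0) add0r.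
  apply/memv_imgP; exists D => //; rewrite lfunE /=; apply/rowP.
  have D02 : D i0 i2 = w 0 k0.
    by entry PD i0 i1; rewrite D01 X1 Y1 mul0r addr0 add0r.
  have D03 : D i0 i3 = w 0 k1.
    by entry PD i0 i2; rewrite D01 X2 Y2 mul0r addr0 add0r.
  have D12 : D i1 i2 = w 0 k2.
    entry PD i1 i1; rewrite D11 => H.
    have -> : w 0 k2 = h1 * Y i1 i1 + h2 * Y i2 i1 + Y i3 i1 +
      (h1 * X i1 i1 + h2 * X i2 i1 + X i3 i1 - X i3 i3 * h1) by rewrite Y31 subrK.
    by apply: (addrI (X i3 i3 * h1)); rewrite -H; ring.
  have D13 : D i1 i3 = w 0 k3.
    entry PD i1 i2; rewrite D11 => H.
    have -> : w 0 k3 = h1 * Y i1 i2 + h2 * Y i2 i2 + Y i3 i2 +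
      (h1 * X i1 i2 + h2 * X i2 i2 + X i3 i2 - X i3 i3 * h2) by rewrite Y32 subrK.
    by apply: (addrI (X i3 i3 * h2)); rewrite -H; ring.
  by case=> -[|[|[|[|k]]]] Hk //; rewrite mxE /= ?D02 ?D03 ?D12 ?D13; congr (w 0 _); apply: val_inj.
have mU B : B \in conj P T -> fixes1 B -> fixes2 B -> B \in U.
  move=> BT /fixes1P[_ B02 B03] /fixes2P[B12 B13].
  by rewrite memv_cap BT mem_vzero /= B02 B03 B12 B13 eqxx.
have [scal [B1 [B2 [[B1T B2T] [B1U B2U] t1 t2]]]] := plane_scalar pT' mU dU.
have back B a b : B \in conj P T -> triang 1%:M B (fun k => if (k < 2)%N then a else b) ->
    B i3 i2 = 0 -> dir_mx a b ((a - b) * h1) ((a - b) * h2) \in T.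
  move=> BT /triang1[L Dg] B32; have [D DT PD] := conjP _ _ uP BT.
  have [[D03 D13 D23] [D10 D20 D30]] := zT D DT.
  suff <- : D = dir_mx a b ((a - b) * h1) ((a - b) * h2) by [].
  apply: (can_inj (mulKmx uP)); rewrite PD.
  have B10 : B i1 i0 = 0.
    by entry PD i1 i0; rewrite D10 D20 D30 !mulr0 !addr0.
  have B20 : B i2 i0 = 0 by entry PD i2 i0; rewrite D10.
  have B30 : B i3 i0 = 0 by entry PD i3 i0; rewrite D20.
  have B21 : B i2 i1 = 0 by entry PD i2 i3; rewrite D13.
  have B31 : B i3 i1 = 0 by entry PD i3 i3; rewrite D23.
  have -> : B = mx4 [:: [:: a]; [:: 0; a]; [:: 0; 0; b]; [:: 0; 0; 0; b]].
    apply/matrixP; apply: ord4P; apply: ord4P;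
    by rewrite [RHS]mxE ?Dg ?(B10, B20, B30, B21, B31, B32) ?L.
  mx4_eq.
have [_ B132 _] := scal _ B1U; have [_ B232 _] := scal _ B2U.
have ext (B : 'M[F]_4) d d' : (forall k, d k = d' k) -> triang 1%:M B d -> triang 1%:M B d'.
  by move=> dd [L [E L0 Ld]]; exists L; split=> // k; rewrite Ld.
split.
  have := back B1 1 0 B1T _ B132; rewrite subr0 !mul1r; apply.
  by apply: ext t1; apply: ord4P.
have := back B2 0 1 B2T _ B232; rewrite sub0r !mulN1r; apply.
by apply: ext t2; apply: ord4P.
Qed.
Lemma dir_mxE a b h1 h2 i j : dir_mx a b h1 h2 i j =
  nth 0 (nth [::] [:: [:: a]; [:: 0; b]; [:: 0; 0; b]; [:: 0; h1; h2; a]] i) j.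
Proof. by rewrite mxE. Qed.

(** For [h = t (a, b)], the surjectivity asked by [bidegenerate_dir] is the invertibility of a
    matrix of size 2 equal to 1 at [t = 0]; its determinant is quadratic in [t], hence nonzero for
    some [t != 0]. The projections for 0 and for [h] then differ by a multiple of
    [dir_mx 0 0 a b]. *)
Lemma bidegenerate_last_row T : bidegenerate T ->
  [/\ dir_mx 1 0 0 0 \in T, dir_mx 0 1 0 0 \in T,
      dir_mx 0 0 1 0 \in T & dir_mx 0 0 0 1 \in T].
Proof.
move=> bT; have [gT zT _ onto] := bT.
have [|N0 M0] := @bidegenerate_dir T 0 0 bT.
  move=> p q; have [D DT [D0 [D1 D2]]] := onto p q; exists D => //; split=> //.
  by rewrite !mul0r !add0r.
rewrite oppr0 in M0.
have [X XT [[X00 X01 X02 X33] [X31 X32]]] := onto 1 0.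
have [Y YT [[Y00 Y01 Y02 Y33] [Y31 Y32]]] := onto 0 1.
have dir a b : dir_mx 0 0 a b \in T.
  pose x1 := a * X i1 i1 + b * X i2 i1; pose x2 := a * X i1 i2 + b * X i2 i2.
  pose y1 := a * Y i1 i1 + b * Y i2 i1; pose y2 := a * Y i1 i2 + b * Y i2 i2.
  have [|t t0 dt] := quadratic_nonroot char2 cardF
    (c0 := 1) (c1 := x1 + y2) (c2 := x1 * y2 - x2 * y1); first by rewrite oner_eq0.
  set d := (X in X != 0) in dt.
  have dE : d = (1 + t * x1) * (1 + t * y2) - (t * x2) * (t * y1) by rewrite /d; ring.
  have [|_] := @bidegenerate_dir T (t * a) (t * b) bT.
    (* Cramer's rule for that system of size 2. *)
    move=> p q; pose al := (p * (1 + t * y2) - q * (t * y1)) / d.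
    pose be := (q * (1 + t * x1) - p * (t * x2)) / d.
    exists (al *: X + be *: Y); first by rewrite rpredD ?rpredZ.
    rewrite !mxE X00 X01 X02 X33 Y00 Y01 Y02 Y33 X31 X32 Y31 Y32 !mulr0 addr0; split=> //.
    split; apply: (mulfI dt); rewrite /al /be.
      transitivity ((p * (1 + t * y2) - q * (t * y1)) * (d / d) * (1 + t * x1) +
        (q * (1 + t * x1) - p * (t * x2)) * (d / d) * (t * y1)); last first.
        by rewrite divff // dE; ring.
      by rewrite /x1 /y1; ring.
    transitivity ((p * (1 + t * y2) - q * (t * y1)) * (d / d) * (t * x2) +
      (q * (1 + t * x1) - p * (t * x2)) * (d / d) * (1 + t * y2)); last first.
      by rewrite divff // dE; ring.
    by rewrite /x2 /y2; ring.
  move=> Mt; have -> : dir_mx 0 0 a b =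
      t^-1 *: (dir_mx 0 1 0 0 - dir_mx 0 1 (- (t * a)) (- (t * b))).
    apply/matrixP; apply: ord4P; apply: ord4P;
    by rewrite dir_mxE [RHS]mxE [X in _ * X]mxE [X in _ * (_ + X)]mxE !dir_mxE /=
      ?subrr ?mulr0 // sub0r opprK mulKf.
  by rewrite rpredZ // rpredB.
by split.
Qed.

Definition upper_mx (h1 h2 : F) : 'M[F]_4 := mx4 [:: [:: 0; h1; h2]].

(** The hypotheses are symmetric in [e0] and [e3]: as [e3 T] is [<e1, e2, e3>], of maximal rank, a
    matrix killing [e3] sends [e0] into it by [first_order], hence has entry 0 at (0,0). *)
Lemma bidegenerate_rows T : bidegenerate T ->
  [/\ dir_mx 1 0 0 0 \in T /\ dir_mx 0 1 0 0 \in T,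
      dir_mx 0 0 1 0 \in T /\ dir_mx 0 0 0 1 \in T,
      upper_mx 1 0 \in T & upper_mx 0 1 \in T].
Proof.
move=> bT; have [N0 M0 d31 d32] := bidegenerate_last_row bT.
have [gT zT onto1 onto2] := bT.
have dim3 : \dim (img T (ev i3)) = 3.
  apply/eqP; rewrite eqn_leq dim_img_le3 //=.
  pose w (k : 'I_3) : 'I_4 := lift i0 k.
  have : row_free (\matrix_k (ev (w k) : 'rV[F]_4)).
    apply/row_freeP; exists (\matrix_(i, j) (i == w j)%:R).
    apply/matrixP => i j; rewrite !mxE (bigD1 (w i)) //= big1 => [|k kw].
      by rewrite !mxE !eqxx mul1r addr0 (inj_eq lift_inj).
    by rewrite !mxE (negbTE kw) mul0r.
  move=> /row_free_dim; apply=> k; rewrite rowK; apply/imgP.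
  move: k => [[|[|[|k]]] Hk] //; [exists (dir_mx 0 0 1 0)|exists (dir_mx 0 0 0 1)|
    exists (dir_mx 1 0 0 0)] => //; rewrite -rowE; apply/rowP; apply: ord4P;
    by rewrite [RHS]mxE dir_mxE mxE.
have row3 w : w \in img T (ev i3) -> w 0 i0 = 0.
  case/imgP => D DT ->; rewrite -rowE mxE.
  by have [_ []] := zT D DT.
have onto2' p q : exists2 D, D \in T &
    [/\ D i3 i3 = 0, D i3 i1 = 0, D i3 i2 = 0 & D i0 i0 = 0] /\ (D i0 i1 = p /\ D i0 i2 = q).
  have [D DT [D1 D2]] := onto1 p q.
  pose E := D - (D i3 i3 *: dir_mx 1 0 0 0 + D i3 i1 *: dir_mx 0 0 1 0 + D i3 i2 *: dir_mx 0 0 0 1).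
  have ET : E \in T by rewrite rpredB // !rpredD ?rpredZ.
  have E33 : E i3 i3 = 0 by rewrite !mxE /= mulr1 !mulr0 !addr0 subrr.
  have E31 : E i3 i1 = 0 by rewrite !mxE /= mulr1 !mulr0 addr0 add0r subrr.
  have E32 : E i3 i2 = 0 by rewrite !mxE /= mulr1 !mulr0 !add0r subrr.
  have E01 : E i0 i1 = p by rewrite !mxE /= !mulr0 !addr0 subr0.
  have E02 : E i0 i2 = q by rewrite !mxE /= !mulr0 !addr0 subr0.
  clearbody E; exists E => //; split=> //; split=> //.
  have EA : E \in ann T (ev i3).
    apply/annP; split=> //; rewrite -rowE; apply/rowP; apply: ord4P; rewrite !mxE //.
    by have [_ []] := zT E ET.
  have := first_order char2 cardF (ev i0) _ _ EA; rewrite dim3 => /(_ isT).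
  move=> H; have /row3 : ev i0 *m E \in img T (ev i3) by apply: H => y; apply: dim_img_le3.
  by rewrite -rowE mxE.
have bT' : bidegenerate (conj (swap_mx F) T).
  split.
  - exact: good_conj (unit_swap_mx F) gT.
  - move=> D /conj_swapP[C /zT[[c1 c2 c3] [c4 c5 c6]] ->].
    by split; split; rewrite mxE.
  - move=> p q; have [D DT [_ [D1 D2]]] := onto2 p q.
    by exists (\matrix_(i, j) D (swap i) (swap j)); rewrite ?mem_conj_swap ?mxE.
  move=> p q; have [D DT [[D1 D2 D3 D4] [D5 D6]]] := onto2' p q.
  exists (\matrix_(i, j) D (swap i) (swap j)); rewrite ?mem_conj_swap //.
  by split; [split|]; rewrite !mxE.
have [_ _ /conj_swapP[C CT C1] /conj_swapP[D DT D1]] := bidegenerate_last_row bT'.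
have unswap (X Y : 'M[F]_4) i j : X = \matrix_(i, j) Y (swap i) (swap j) ->
    Y i j = X (swap i) (swap j).
  by move=> ->; rewrite mxE; congr (Y _ _); [move: i|move: j]; apply: ord4P.
split=> //.
  suff -> : upper_mx 1 0 = C by [].
  by apply/matrixP; apply: ord4P; apply: ord4P; rewrite (unswap _ _ _ _ C1) !mxE.
suff -> : upper_mx 0 1 = D by [].
by apply/matrixP; apply: ord4P; apply: ord4P; rewrite (unswap _ _ _ _ D1) !mxE.
Qed.

(** In the degenerate case at [x], the point [v] also has rank 3 and gives a second invariant
    hyperplane. The basis is [x, v B, v C, v], whose middle vectors lie in both hyperplanes. *)
Lemma classification T : good T ->
  (exists P c, [/\ P \in unitmx, c != 0 & forall B, B \in conj P T -> symplectic c B]) \/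
  (exists2 P, P \in unitmx & bidegenerate (conj P T)).
Proof.
move=> gT; have [x d3] := exists_rank3 char2 cardF gT.
have [|[phi [ephi imgx [B1 B1T B1phi] [v [B [C [BA CA vphi fr]]]]]]] :=
  symplectic_or_hyperplane char2 cardF gT d3; first by left.
have le3 y : (\dim (img T y) <= 3)%N by apply: dim_img_le3.
have annphi D : D \in ann T x -> D *m phi = 0.
  move=> DA; apply/row_matrixP => i; rewrite row0 rowE.
  apply/eqP; rewrite mulmxA -imgx; apply: first_order DA => // y; rewrite d3; exact: le3.
have xphi : x *m phi = 0.
  by apply/eqP; rewrite -imgx mem_img_self.
have d3v : \dim (img T v) = 3.
  apply/eqP; rewrite eqn_leq le3 /=.
  have f3 : free [:: v *m B; v *m C; v *m B1].
    apply: free3 => // a b /(congr1 (mulmx^~ phi)).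
    rewrite -mulmxA B1phi mulmxDl -!scalemxAl -!mulmxA !annphi // !mulmx0 !scaler0 addr0.
    by move/eqP; rewrite (negbTE vphi).
  have df : \dim <<[:: v *m B; v *m C; v *m B1]>> = 3 by rewrite (eqP f3).
  rewrite -[X in (X <= _)%N]df; apply: dimvS; apply/span_subvP => w.
  have [[BT _] [CT _]] := (annP _ _ _ BA, annP _ _ _ CA).
  by rewrite !inE => /or3P[] /eqP->; apply: mem_img.
have [|[psi [epsi imgv [B2 B2T B2psi] [u [_ [_ [_ _ upsi _]]]]]]] :=
  symplectic_or_hyperplane char2 cardF gT d3v; first by left.
right.
have vpsi : v *m psi = 0 by apply/eqP; rewrite -imgv mem_img_self.
(* Otherwise [x T], the kernel of [phi], would lie in that of [psi]; as [v] is in the latter but not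
   in the former, [psi] would be 0. *)
have xpsi : x *m psi != 0.
  apply: contra upsi => /eqP xpsi; rewrite [u *m psi]mx11_scalar.
  have kpsi w : w *m phi = 0 -> w *m psi = 0.
    move=> /eqP; rewrite -imgx => /imgP[D /epsi[b Db] ->].
    by rewrite -mulmxA Db -scalemxAr xpsi scaler0.
  pose w := u - ((u *m phi) 0 0 / (v *m phi) 0 0) *: v.
  have v0 : (v *m phi) 0 0 != 0.
    by apply: contra vphi => /eqP v0; rewrite [_ *m _]mx11_scalar v0 raddf0.
  have /kpsi : w *m phi = 0.
    rewrite mulmxBl -scalemxAl; move: (u *m phi) (v *m phi) v0 => U V V0.
    by apply/matrixP => i j; rewrite !ord1 !mxE divfK ?subrr.
  by rewrite mulmxBl -scalemxAl vpsi scaler0 subr0 => ->; rewrite mxE raddf0.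
pose y1 := v *m B; pose y2 := v *m C.
have ann_psi D : D \in ann T x -> v *m D *m psi = 0.
  move=> /annP[DT xD]; have [b Db] := epsi D DT.
  have b0 : b = 0.
    apply/eqP; apply: contraR xpsi => b0.
    rewrite -[x *m psi](scalerK b0) scalemxAr -Db mulmxA xD mul0mx scaler0.
    by rewrite eqxx.
  by rewrite -mulmxA Db b0 scale0r mulmx0.
have y1phi : y1 *m phi = 0 by rewrite -mulmxA annphi // mulmx0.
have y2phi : y2 *m phi = 0 by rewrite -mulmxA annphi // mulmx0.
have y1psi : y1 *m psi = 0 by apply: ann_psi.
have y2psi : y2 *m psi = 0 by apply: ann_psi.
have f4 : free [:: x; y1; y2; v].
  rewrite free_cons; apply/andP; split; last first.
    apply: free3 => // a b /(congr1 (mulmx^~ phi)).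
    rewrite mulmxDl -!scalemxAl y1phi y2phi !scaler0 addr0.
    by move/eqP; rewrite (negbTE vphi).
  rewrite 2!span_cons span_seq1; apply/negP.
  move=> /memv_addP[_ /vlineP[a ->] [_ /memv_addP[_ /vlineP[b ->] [_ /vlineP[d ->] ->]]]].
  move=> /(congr1 (mulmx^~ psi)); rewrite !mulmxDl -!scalemxAl y1psi y2psi vpsi.
  by rewrite !scaler0 !addr0 => /eqP; rewrite (negbTE xpsi).
have [P uP HP] := complete f4; exists P => //.
have P0 : ev i0 *m P = x by rewrite -rowE HP.
have P1 : ev i1 *m P = y1 by rewrite -rowE HP.
have P2 : ev i2 *m P = y2 by rewrite -rowE HP.
have P3 : ev i3 *m P = v by rewrite -rowE HP.
have Pcol (chi : 'cV[F]_4) i : (P *m chi) i 0 = (ev i *m P *m chi) 0 0.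
  by rewrite -mulmxA -rowE [RHS]mxE.
have nz (w : 'rV[F]_4) (chi : 'cV[F]_4) : w *m chi != 0 -> (w *m chi) 0 0 != 0.
  by apply: contra => /eqP H; rewrite [_ *m _]mx11_scalar H raddf0.
have zero D : D \in conj P T -> [/\ D i0 i3 = 0, D i1 i3 = 0 & D i2 i3 = 0] /\
      [/\ D i1 i0 = 0, D i2 i0 = 0 & D i3 i0 = 0].
  case/(conjP _ _ uP) => G GT PG.
  have col (chi : 'cV[F]_4) i : eigencol T chi -> (P *m chi) i 0 = 0 ->
      (D *m (P *m chi)) i 0 = 0.
    move=> /(_ G GT)[b Gb] Pi.
    by rewrite mulmxA -PG -mulmxA Gb -scalemxAr mxE Pi mulr0.
  have phi3 : (P *m phi) i3 0 != 0 by rewrite Pcol P3 nz.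
  have psi0 : (P *m psi) i0 0 != 0 by rewrite Pcol P0 nz.
  have phi_0 : (P *m phi) i0 0 = 0 by rewrite Pcol P0 xphi mxE.
  have phi_1 : (P *m phi) i1 0 = 0 by rewrite Pcol P1 y1phi mxE.
  have phi_2 : (P *m phi) i2 0 = 0 by rewrite Pcol P2 y2phi mxE.
  have psi_1 : (P *m psi) i1 0 = 0 by rewrite Pcol P1 y1psi mxE.
  have psi_2 : (P *m psi) i2 0 = 0 by rewrite Pcol P2 y2psi mxE.
  have psi_3 : (P *m psi) i3 0 = 0 by rewrite Pcol P3 vpsi mxE.
  move: (col phi ^~ ephi) (col psi ^~ epsi) => cphi cpsi {col}.
  move: (P *m phi) (P *m psi) phi3 psi0 phi_0 phi_1 phi_2 psi_1 psi_2 psi_3 cphi cpsi.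
  move=> f g f3 g0 f0 f1 f2 g1 g2 g3 cf cg.
  have zf i : f i 0 = 0 -> D i i3 = 0.
    move=> /cf; rewrite mxE sum4 f0 f1 f2 !mulr0 !add0r => /eqP.
    by rewrite mulf_eq0 (negbTE f3) orbF => /eqP.
  have zg i : g i 0 = 0 -> D i i0 = 0.
    move=> /cg; rewrite mxE sum4 g1 g2 g3 !mulr0 !addr0 => /eqP.
    by rewrite mulf_eq0 (negbTE g0) orbF => /eqP.
  by split; split; [apply: zf|apply: zf|apply: zf|apply: zg|apply: zg|apply: zg].
have [BT CT] : B \in T /\ C \in T by case/annP: BA; case/annP: CA.
split=> //; first exact: good_conj.
- move=> p q.
  have : p *: y1 + q *: y2 \in img T x.
    by rewrite imgx mulmxDl -!scalemxAl y1phi y2phi !scaler0 addr0.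
  rewrite -P0 -P1 -P2 !scalemxAl -mulmxDl -img_conj // => /imgP[D DT E].
  exists D => //; move/rowP: E => E; move: (E i1) (E i2); rewrite -rowE !mxE /=.
  by rewrite !(mulr0, mulr1, addr0, add0r) => -> ->.
have conj_ann D : D \in ann T x -> let E := P *m D *m invmx P in
    [/\ E \in conj P T, ev i0 *m E = 0, E i3 i3 = 0 & ev i3 *m E = v *m D *m invmx P].
  move=> DA E; have [DT xD] := annP _ _ _ DA.
  have E3 : ev i3 *m E = v *m D *m invmx P by rewrite !mulmxA P3.
  have E0 : ev i0 *m E = 0 by rewrite !mulmxA P0 xD mul0mx.
  have ET : E \in conj P T by rewrite mem_conj.
  split=> //; have : E *m (P *m phi) = 0.
    by rewrite !mulmxA mulmxKV // -mulmxA annphi // mulmx0.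
  move: (zero E ET) => [[z1 z2 z3] [z4 z5 z6]].
  move=> /matrixP/(_ i3 0); rewrite mxE sum4 !Pcol P0 P1 P2 P3 xphi y1phi y2phi.
  rewrite z6 !mxE !mulr0 !add0r => /eqP; rewrite mulf_eq0 => /orP[/eqP//|].
  by move/negP: (nz _ _ vphi); rewrite mxE.
move=> p q.
have [E1T E10 E133 E13] := conj_ann B BA; have [E2T E20 E233 E23] := conj_ann C CA.
move: (P *m B *m invmx P) (P *m C *m invmx P) E1T E10 E133 E13 E2T E20 E233 E23.
rewrite -/y1 -/y2 -P1 -P2 !mulmxK // => D E DT D0 D33 D3 ET E0 E33 E3.
exists (p *: D + q *: E); first by rewrite rpredD ?rpredZ.
rewrite -!rowE in D0 D3 E0 E3.
have D0' j : D i0 j = 0 by move/rowP/(_ j): D0; rewrite !mxE.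
have E0' j : E i0 j = 0 by move/rowP/(_ j): E0; rewrite !mxE.
have D3' j : D i3 j = (j == i1)%:R by move/rowP/(_ j): D3; rewrite !mxE eqxx.
have E3' j : E i3 j = (j == i2)%:R by move/rowP/(_ j): E3; rewrite !mxE eqxx.
split; first by split; rewrite !mxE ?D0' ?E0' ?D33 ?E33 !mulr0 addr0.
by rewrite !mxE !D3' !E3' /= !(mulr0, mulr1, addr0, add0r).
Qed.
End Classification.

(** * The orthogonal of a 2-spec space *)

Section Orthogonal.
Variable F : fieldType.
Implicit Types (S T U V : {vspace 'M[F]_4}) (P B M L : 'M[F]_4).

Definition pairing (X : seq 'M[F]_4) B : 'rV[F]_(size X) := \row_k \tr (B *m X`_k).

Fact pairing_is_linear X : linear (pairing X).
Proof.
move=> a B C; apply/rowP => k.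
by rewrite !mxE mulmxDl -scalemxAl mxtraceD mxtraceZ.
Qed.

HB.instance Definition _ X :=
  GRing.isLinear.Build F 'M[F]_4 'rV[F]_(size X) *:%R (pairing X) (pairing_is_linear X).

(** The trace form is nondegenerate: a linear functional [f] is represented by the matrix with
    entries [f (delta_mx j i)]. *)
Lemma pairing_onto (X : seq 'M[F]_4) (w : 'rV_(size X)) : free X ->
  exists B, pairing X B = w.
Proof.
move=> fX; pose f M := \sum_k w 0 k * coord (in_tuple X) k M.
exists (\matrix_(i, j) f (delta_mx j i)); apply/rowP => k; rewrite mxE.
transitivity (f X`_k); last first.
  rewrite /f (bigD1 k) //= big1 => [|l lk].
    by rewrite (coord_free (X := in_tuple X) _ _ fX) eqxx mulr1 addr0.
  by rewrite (coord_free (X := in_tuple X) _ _ fX) eq_sym (negbTE lk) mulr0.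
move: X`_k => M.
have fE (I : finType) (G : I -> 'M[F]_4) : f (\sum_i G i) = \sum_i f (G i).
  rewrite /f [RHS]exchange_big /=; apply: eq_bigr => l _.
  by rewrite linear_sum mulr_sumr.
rewrite [in RHS](matrix_sum_delta M) fE.
rewrite [RHS](eq_bigr (fun i => \sum_j f (M i j *: delta_mx i j))) => [|i _]; last exact: fE.
rewrite [RHS]exchange_big /=; apply: eq_bigr => i _; rewrite mxE; apply: eq_bigr => j _.
rewrite mxE /f mulr_suml; apply: eq_bigr => l _.
by rewrite linearZ /= mulrCA mulrC mulrA.
Qed.

Lemma trace_separation V E : E \notin V ->
  exists2 M, \tr (M *m E) = 1 & forall B, B \in V -> \tr (M *m B) = 0.
Proof.
move=> EV; have fE : free (E :: vbasis V).
  by rewrite free_cons (basis_free (vbasisP V)) (span_basis (vbasisP V)) EV.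
have [M /rowP EM] := pairing_onto (X := E :: vbasis V) (\row_k (val k == 0)%:R) fE.
exists M => [|B BV]; first by have := EM ord0; rewrite !mxE.
rewrite (coord_vbasis BV) mulmx_sumr raddf_sum big1 // => k _ /=.
have := EM (lift ord0 (cast_ord (esym (size_tuple _)) k)); rewrite !mxE /= => Bk.
by rewrite -scalemxAr mxtraceZ Bk mulr0.
Qed.

Definition orthogonal_to S T := forall M, M \in S <-> (forall B, B \in T -> \tr (B *m M) = 0).

Lemma orthogonal_exists S : exists2 T, (\dim S + \dim T = 16)%N & orthogonal_to S T.
Proof.
pose X : seq 'M[F]_4 := vbasis S; have fX : free X := basis_free (vbasisP S).
exists (lker (linfun (pairing X))) => [|M].
  have := limg_ker_dim (linfun (pairing X)) fullv.
  rewrite capfv dimvf addnC (_ : (_ @: fullv)%VS = fullv) ?dimvf.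
    have sX : size X = \dim S by rewrite size_tuple.
    by rewrite /dim /= mul1n -[X in _ -> (X + _)%N = _]sX.
  apply/eqP; rewrite eqEsubv subvf; apply/subvP => w _.
  have [B Bw] := pairing_onto w fX.
  by apply/memv_imgP; exists B; rewrite ?memvf // lfunE.
split=> [MS B|H].
  rewrite memv_ker lfunE /= => /eqP/rowP B0.
  rewrite (coord_vbasis MS) mulmx_sumr raddf_sum big1 // => k _ /=.
  have := B0 (cast_ord (esym (size_tuple _)) k); rewrite !mxE /= => Bk.
  by rewrite -scalemxAr mxtraceZ Bk mulr0.
apply/negPn/negP => /trace_separation[B BM BS].
have BT : B \in lker (linfun (pairing X)).
  rewrite memv_ker lfunE /=; apply/eqP/rowP => k; rewrite !mxE BS //.
  by rewrite vbasis_mem // mem_nth.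
by move/eqP: (H B BT); rewrite BM oner_eq0.
Qed.

Lemma orthogonal_conj P S T : P \in unitmx -> orthogonal_to S T ->
  orthogonal_to (conj P S) (conj P T).
Proof.
move=> uP ST M; split=> [/(conjP _ _ uP)[N /ST NS PN] B /(conjP _ _ uP)[C CT PC]|H].
  have -> : B *m M = P *m (C *m N) *m invmx P.
    by rewrite mulmxA PC -[B *m P *m N]mulmxA PN mulmxA mulmxK.
  by rewrite mxtrace_mulC mulmxA mulVmx // mul1mx NS.
rewrite -[M](mulmxK uP) -[M *m P](mulKVmx uP) mem_conj //; apply/ST => C CT.
have := H (P *m C *m invmx P); rewrite mem_conj // => /(_ CT) <-.
transitivity (\tr ((C *m invmx P *m M) *m P)); first by rewrite !mulmxA.
by rewrite mxtrace_mulC !mulmxA.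
Qed.

Hypothesis char2 : 2%N \in [pchar F].
Hypothesis cardF : card_gt F 2.

Lemma nonroot_linear3 (s : seq (F * F)) : (size s <= 3)%N ->
  all (fun p => p != 0) s -> exists t, all (fun p => p.1 + t * p.2 != 0) s.
Proof.
move=> s3 s0; pose q (p : F * F) := Poly [:: p.1; p.2].
have q0 p : p != 0 -> q p != 0.
  move=> p0; apply: contra p0 => /eqP/polyP H.
  have E i : [:: p.1; p.2]`_i = 0 by rewrite -coef_Poly H coef0.
  by rewrite [p]surjective_pairing (E 0 : p.1 = 0) (E 1 : p.2 = 0).
have sq p : (size (q p) <= 2)%N by apply: size_Poly.
have [||t Ht] := @nonroot F char2 cardF (\prod_(p <- s) q p).
- by rewrite prodf_seq_neq0; apply: sub_all s0 => p /q0.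
- apply: (@leq_trans (size s).+1) => //; elim: s {s0 s3} => [|p s IH].
    by rewrite big_nil size_poly1.
  rewrite big_cons; apply: leq_trans (size_polyMleq _ _) _.
  by rewrite -subn1 leq_subLR (leq_trans (leq_add (sq p) IH)).
exists t; apply/allP => p ps; move: Ht; rewrite rootE horner_prod prodf_seq_neq0.
move=> /allP/(_ p ps) /=; rewrite horner_Poly /= mul0r add0r.
by rewrite addrC mulrC.
Qed.

Definition lower : {vspace 'M[F]_4} := vzero F
  [:: (i0, i1); (i0, i2); (i0, i3); (i1, i2); (i1, i3); (i2, i3)].

Lemma lowerP L : reflect (forall i j : 'I_4, (i < j)%N -> L i j = 0) (L \in lower).
Proof.
rewrite mem_vzero /= andbT; apply: (iffP idP) => [|H]; last by rewrite !H ?eqxx.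
move=> /and5P[/eqP H1 /eqP H2 /eqP H3 /eqP H4 /andP[/eqP H5 /eqP H6]].
by apply: ord4P; apply: ord4P.
Qed.

Lemma trace_delta B i j : \tr (B *m delta_mx i j) = B j i.
Proof.
rewrite /mxtrace (bigD1 j) //= big1 => [|k kj]; rewrite mxE.
  rewrite (bigD1 i) //= big1 => [|l li]; first by rewrite mxE !eqxx mulr1 !addr0.
  by rewrite mxE (negbTE li) mulr0.
by rewrite big1 // => l _; rewrite mxE (negbTE kj) andbF mulr0.
Qed.

Definition diag_eq i j : {vspace 'M[F]_4} :=
  lker (linfun (pairing [:: delta_mx i i - delta_mx j j])).

Lemma diag_eqP i j L : reflect (L i i = L j j) (L \in diag_eq i j).
Proof.
rewrite memv_ker lfunE /=.
have E k : pairing [:: delta_mx i i - delta_mx j j] L 0 k = L i i - L j j.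
  by rewrite mxE [k]ord1 /= mulmxBr raddfB /= !trace_delta.
apply: (iffP eqP) => [/rowP/(_ ord0)|H].
  by rewrite E mxE => /eqP; rewrite subr_eq0 => /eqP.
by apply/rowP => k; rewrite E mxE H subrr.
Qed.

Lemma conj_eigenvalue P M L (a : F) : P \in unitmx -> P *m M = L *m P ->
  eigenvalue L a -> eigenvalue M a.
Proof.
move=> uP PM /eigenvalueP[v vL v0]; apply/eigenvalueP; exists (v *m P).
  by rewrite -mulmxA PM mulmxA vL scalemxAl.
by apply: contra v0 => /eqP vP; rewrite -[v](mulmxK uP) vP mul0mx.
Qed.

Lemma eigenvalue_lower L i : L \in lower -> eigenvalue L (L i i).
Proof.
move=> /lowerP H; rewrite eigenvalue_root_char char_poly_trig; last exact/is_trig_mxP.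
by rewrite rootE horner_prod (bigD1 i) //= !hornerE subrr mul0r.
Qed.

(** Otherwise each pair of indices is separated by some triangular matrix, and a combination of the
    three separates all pairs: it has three eigenvalues. The combination is built one matrix at a
    time, so that the parameter avoids at most three values. *)
Lemma two_spec_diag S P i j k : two_spec S -> P \in unitmx -> uniq [:: i; j; k] ->
  [|| (conj P S :&: lower <= diag_eq i j)%VS, (conj P S :&: lower <= diag_eq j k)%VS
    | (conj P S :&: lower <= diag_eq i k)%VS].
Proof.
move=> S2 uP ijk; set U := (_ :&: _)%VS; apply: contraT; rewrite !negb_or.
move=> /and3P[/subvPn[A AU /diag_eqP Aij] /subvPn[B BU /diag_eqP Bjk]
  /subvPn[C CU /diag_eqP Cik]].
have d0 (M N : 'M[F]_4) l m : (M l l != M m m) || (N l l != N m m) ->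
    (M l l - M m m, N l l - N m m) != 0 :> F * F.
  by rewrite -pair_eqE /pair_eq /= negb_and !subr_eq0.
have [||t] := @nonroot_linear3 [:: (A i i - A j j, B i i - B j j);
    (A j j - A k k, B j j - B k k)] => //.
  rewrite /= !d0 //; [by apply/orP; right; apply/eqP | by apply/orP; left; apply/eqP].
move=> /and3P[/= t1 t2 _].
pose D := A + t *: B; have DU : D \in U by rewrite rpredD ?rpredZ.
have Dij : D i i != D j j.
  by rewrite -subr_eq0; apply: contra t1 => /eqP H; apply/eqP; rewrite -[RHS]H !mxE; ring.
have Djk : D j j != D k k.
  by rewrite -subr_eq0; apply: contra t2 => /eqP H; apply/eqP; rewrite -[RHS]H !mxE; ring.
have [||s] := @nonroot_linear3 [:: (D i i - D j j, C i i - C j j);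
    (D j j - D k k, C j j - C k k); (D i i - D k k, C i i - C k k)] => //.
  rewrite /= !d0 //; [by apply/orP; right; apply/eqP | by rewrite Djk | by rewrite Dij].
move=> /and4P[/= s1 s2 s3 _].
pose L := D + s *: C; have LU : L \in U by rewrite rpredD ?rpredZ.
have Lij : L i i != L j j.
  by rewrite -subr_eq0; apply: contra s1 => /eqP H; apply/eqP; rewrite -[RHS]H !mxE; ring.
have Ljk : L j j != L k k.
  by rewrite -subr_eq0; apply: contra s2 => /eqP H; apply/eqP; rewrite -[RHS]H !mxE; ring.
have Lik : L i i != L k k.
  by rewrite -subr_eq0; apply: contra s3 => /eqP H; apply/eqP; rewrite -[RHS]H !mxE; ring.
move: LU; rewrite memv_cap => /andP[/(conjP _ _ uP)[M MS PM] Lw].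
have := S2 M MS [:: L i i; L j j; L k k]; rewrite /= !inE !negb_or Lij Lik Ljk /=.
by rewrite !(conj_eigenvalue uP PM) ?eigenvalue_lower // => /(_ isT isT).
Qed.

(** One class consists of the indices whose diagonal form agrees with that of 0; by [two_spec_diag]
    the others agree with each other. If [e_i + e_j] were not in [T] plus the strictly lower
    matrices, some [M] orthogonal to both would pair to 1 with it. But [M] is then in [S] and lower
    triangular, so [M i i = M j j] and the pairing is 0. *)
Lemma two_spec_pattern S T : two_spec S -> orthogonal_to S T -> pattern T.
Proof.
move=> S2 ST P uP; pose U := (conj P S :&: lower)%VS.
pose c i := (U <= diag_eq i i0)%VS; exists c => i j ij cij.
have triple k l m : uniq [:: k; l; m] -> _ := fun u => two_spec_diag S2 uP u.
have Uij : (U <= diag_eq i j)%VS.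
  have refl k : c k = false -> k != i0.
    by apply: contraFN => /eqP->; apply/subvP => L _; apply/diag_eqP.
  case ci : (c i) cij => /esym cj.
    apply/subvP => L LU; apply/diag_eqP; transitivity (L i0 i0).
      by apply/diag_eqP; apply: (subvP ci).
    by apply/esym/diag_eqP; apply: (subvP cj).
  have := triple i j i0; rewrite /= !inE negb_or ij !refl // => /(_ isT).
  by rewrite -/U -[X in [|| _, X | _]]/(c j) -[X in [|| _, _ | X]]/(c i) ci cj !orbF.
have ST' := orthogonal_conj uP ST.
pose NL := vzero F [:: (i0, i0); (i0, i1); (i0, i2); (i0, i3); (i1, i1); (i1, i2);
  (i1, i3); (i2, i2); (i2, i3); (i3, i3)].
have NLP (N : 'M[F]_4) : reflect (forall k l : 'I_4, (k <= l)%N -> N k l = 0) (N \in NL).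
  rewrite mem_vzero /= andbT; apply: (iffP idP) => [|H]; last by rewrite !H ?eqxx.
  move=> /and5P[/eqP H1 /eqP H2 /eqP H3 /eqP H4 /and5P[/eqP H5 /eqP H6 /eqP H7 /eqP H8]].
  by move=> /andP[/eqP H9 /eqP H10]; apply: ord4P; apply: ord4P.
pose E : 'M[F]_4 := delta_mx i i + delta_mx j j.
have : E \in (conj P T + NL)%VS.
  apply/negPn/negP => /trace_separation[M ME MV].
  have MS : M \in conj P S.
    apply/ST' => B BT; rewrite mxtrace_mulC MV // -[B]addr0 memv_add ?mem0v //.
  have Ml : M \in lower.
    apply/lowerP => k l kl; rewrite -trace_delta MV // -[delta_mx _ _]add0r memv_add ?mem0v //.
    apply/NLP => m n mn; rewrite mxE; case: eqP => //= ml; case: eqP => //= nk.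
    by move: mn; rewrite ml nk leqNgt kl.
  have /diag_eqP Mij : M \in diag_eq i j by apply: (subvP Uij); rewrite memv_cap MS.
  move: ME; rewrite mulmxDr raddfD /= !trace_delta Mij (addrr_pchar2 char2).
  by move/esym/eqP; rewrite oner_eq0.
case/memv_addP => D /(conjP _ _ uP)[B BT PB] [N /NLP HN EN].
have DE : D = E - N by rewrite EN addrK.
have off k l m : (k < l)%N -> (k == m) && (l == m) = false.
  by move=> kl; apply/negP => /andP[/eqP km /eqP lm]; move: kl; rewrite km lm ltnn.
exists B => //; exists D; split=> // [k l kl|k];
  rewrite DE mxE [X in _ + X]mxE HN ?(ltnW kl) // subr0 !mxE.
  by rewrite !off // addr0.
rewrite !andbb; case: (eqVneq k i) => [->|_]; first by rewrite (negbTE ij) addr0.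
by rewrite add0r.
Qed.

End Orthogonal.

(** * The two models *)

Section Models.
Variable F : fieldType.
Hypothesis char2 : 2%N \in [pchar F].
Hypothesis cardF : card_gt F 2.
Implicit Types (S T U V : {vspace 'M[F]_4}) (P B M N : 'M[F]_4).

Lemma trace4 B M : \tr (B *m M) =
  B i0 i0 * M i0 i0 + B i0 i1 * M i1 i0 + B i0 i2 * M i2 i0 + B i0 i3 * M i3 i0 +
  (B i1 i0 * M i0 i1 + B i1 i1 * M i1 i1 + B i1 i2 * M i2 i1 + B i1 i3 * M i3 i1) +
  (B i2 i0 * M i0 i2 + B i2 i1 * M i1 i2 + B i2 i2 * M i2 i2 + B i2 i3 * M i3 i2) +
  (B i3 i0 * M i0 i3 + B i3 i1 * M i1 i3 + B i3 i2 * M i2 i3 + B i3 i3 * M i3 i3).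
Proof. by rewrite /mxtrace sum4 !mxE !sum4. Qed.

Lemma ord2P (Q : 'I_2 -> Prop) : Q ord0 -> Q (lift ord0 ord0) -> forall i, Q i.
Proof. by move=> Q0 Q1 [[|[|i]] Hi] //; [move: Q0|move: Q1]; congr Q; apply: val_inj. Qed.

Lemma blocks : ((@lshift 2 2 ord0 = i0) * (@lshift 2 2 (lift ord0 ord0) = i1)) *
  ((@rshift 2 2 ord0 = i2) * (@rshift 2 2 (lift ord0 ord0) = i3)).
Proof. by split; split; apply: val_inj. Qed.

Lemma mem_jointE N : reflect
  [/\ N i0 i0 = N i1 i1, N i2 i2 = N i3 i3, N i2 i0 = 0 /\ N i2 i1 = 0 &
      N i3 i0 = 0 /\ N i3 i1 = 0] (N \in joint (sl F 2) (sl F 2)).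
Proof.
have tr2 (X : 'M[F]_2) : (X \in sl F 2) = (X ord0 ord0 == X (lift ord0 ord0) (lift ord0 ord0)).
  by rewrite inE /mxtrace !big_ord_recl big_ord0 addr0 (addr_eq0_2 char2).
apply: (iffP and3P); rewrite !tr2.
  move=> [/eqP H1 /eqP H2 /eqP/matrixP H3].
  rewrite !mxE !blocks in H1 H2.
  have := (H3 ord0 ord0, H3 ord0 (lift ord0 ord0), H3 (lift ord0 ord0) ord0,
    H3 (lift ord0 ord0) (lift ord0 ord0)).
  by rewrite !mxE !blocks => -[[[]]].
move=> [H1 H2 [H3 H4] [H5 H6]]; split.
- by rewrite !mxE !blocks H1.
- by rewrite !mxE !blocks H2.
by apply/eqP/matrixP; apply: ord2P; apply: ord2P; rewrite !mxE !blocks.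
Qed.

Lemma mem_B4E N : reflect
  [/\ N i2 i2 = N i0 i0 /\ N i3 i3 = N i1 i1, N i2 i3 = N i1 i0 /\ N i3 i2 = N i0 i1,
      N i0 i3 = N i1 i2 & N i2 i1 = N i3 i0] (N \in B4 F).
Proof.
apply: (iffP and3P).
  move=> [/eqP/matrixP H1 /eqP/matrixP H2 /eqP/matrixP H3].
  have := (H1 ord0 ord0, H1 ord0 (lift ord0 ord0), H1 (lift ord0 ord0) ord0,
    H1 (lift ord0 ord0) (lift ord0 ord0), H2 ord0 (lift ord0 ord0), H3 (lift ord0 ord0) ord0).
  by rewrite !mxE !blocks !(oppr_pchar2 char2) => -[[[[[]]]]].
move=> [[H1 H2] [H3 H4] H5 H6]; split; apply/eqP/matrixP; apply: ord2P; apply: ord2P;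
by rewrite !mxE !blocks ?(oppr_pchar2 char2).
Qed.

Lemma similar_conj P S (W : {pred 'M[F]_4}) : P \in unitmx ->
  (forall N, (N \in W) <-> (N \in conj P S)) -> similar_sets S W.
Proof.
move=> uP H; exists P => // N; rewrite H; split=> [/(conjP _ _ uP)[M MS PM]|[M MS ->]].
  by exists M; rewrite // PM mulmxK.
by rewrite mem_conj.
Qed.

Lemma joint_conj S T : \dim S = 10 -> orthogonal_to S T -> bidegenerate T ->
  exists2 R, R \in unitmx & forall N, (N \in joint (sl F 2) (sl F 2)) <-> (N \in conj R S).
Proof.
move=> dS ST /(bidegenerate_rows char2 cardF)[[N0 M0] [d31 d32] d01 d02].
pose W M := [/\ M i3 i3 = M i0 i0, M i2 i2 = M i1 i1, M i1 i0 = 0 /\ M i2 i0 = 0 &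
    M i1 i3 = 0 /\ M i2 i3 = 0].
have WS M : M \in S -> W M.
  move=> /ST H; move: (H _ N0) (H _ M0) (H _ d31) (H _ d32) (H _ d01) (H _ d02).
  rewrite !trace4 !mxE /= !(mul0r, mul1r, addr0, add0r) => /eqP; rewrite (addr_eq0_2 char2).
  move=> /eqP h0 /eqP; rewrite (addr_eq0_2 char2) => /eqP h1 *; by split.
pose s := [:: (i0, i0); (i0, i1); (i0, i2); (i0, i3); (i1, i1); (i1, i2); (i2, i1);
  (i3, i0); (i3, i1); (i3, i2)].
have W0 M : W M -> M \in vzero F s -> M = 0.
  move=> [w1 w2 [w3 w4] [w5 w6]]; rewrite mem_vzero /= andbT.
  move=> /and5P[/eqP h1 /eqP h2 /eqP h3 /eqP h4 /and5P[/eqP h5 /eqP h6 /eqP h7 /eqP h8]].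
  move=> /andP[/eqP h9 /eqP h10].
  by apply/matrixP; apply: ord4P; apply: ord4P; rewrite [RHS]mxE // ?w1 ?w2.
have SW M : W M -> M \in S.
  have onto (w : 'rV[F]_(size s)) : exists2 N, N \in S & coefs s N = w.
    by apply: memv_coefs; [move=> N /WS; apply: W0 | rewrite dS].
  move=> wM; have [N NS NM] := onto (coefs s M).
  suff /eqP -> : M == N by [].
  rewrite -subr_eq0; apply/eqP; apply: W0.
    case: wM (WS N NS) => [w1 w2 [w3 w4] [w5 w6]] [v1 v2 [v3 v4] [v5 v6]].
    by split; [| |split|split]; rewrite !mxE ?(w1, w2, w3, w4, w5, w6)
      ?(v1, v2, v3, v4, v5, v6) ?subrr.
  by rewrite memv_ker lfunE raddfB /= NM subrr.
(* The basis is reordered as [e0, e3, e1, e2], the invariant plane coming last. *)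
pose R : 'M[F]_4 := mx4 [:: [:: 1]; [:: 0; 0; 0; 1]; [:: 0; 1]; [:: 0; 0; 1]].
have uR : R \in unitmx.
  by mx4_unit [:: [:: 1]; [:: 0; 0; 1]; [:: 0; 0; 0; 1]; [:: 0; 1 : F]].
exists R => // N; split=> [/mem_jointE[h1 h2 [h3 h4] [h5 h6]]|].
  apply/conjP => //; exists (mx4 [:: [:: N i0 i0; N i0 i2; N i0 i3; N i0 i1];
    [:: 0; N i2 i2; N i2 i3; 0]; [:: 0; N i3 i2; N i3 i3; 0];
    [:: N i1 i0; N i1 i2; N i1 i3; N i1 i1]]).
    by apply: SW; split; [| |split|split]; rewrite !mxE.
  apply/matrixP; apply: ord4P; apply: ord4P; entries; by [].
move=> /(conjP _ _ uR)[M /WS[w1 w2 [w3 w4] [w5 w6]] E]; apply/mem_jointE; split.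
- by entry E i0 i0; entry E i1 i3; rewrite w1 => -> ->.
- by entry E i2 i1; entry E i3 i2; rewrite w2 => -> ->.
- by split; [entry E i2 i0; rewrite w3|entry E i2 i3; rewrite w5].
by split; [entry E i3 i0; rewrite w4|entry E i3 i3; rewrite w6].
Qed.

(** By dimension, [T] consists of all [A J^-1] with [A] alternating, [J] being the antidiagonal
    matrix of [symplectic]; its orthogonal consists of the [M] with [J^-1 M] symmetric, which is
    what [W] spells out. *)
Lemma B4_conj S T c : c != 0 -> \dim T = 6 -> orthogonal_to S T ->
  (forall B, B \in T -> symplectic c B) ->
  exists2 R, R \in unitmx & forall N, (N \in B4 F) <-> (N \in conj R S).
Proof.
move=> c0 dT ST sT.
pose W M := [/\ M i3 i3 = M i0 i0, M i2 i2 = M i1 i1,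
  M i1 i0 = c * M i3 i2 /\ M i2 i0 = c * M i3 i1 & M i1 i3 = c * M i0 i2 /\ M i2 i3 = c * M i0 i1].
pose s := [:: (i0, i0); (i0, i1); (i0, i2); (i1, i1); (i3, i1); (i3, i2)].
have onto (w : 'rV[F]_(size s)) : exists2 B, B \in T & coefs s B = w.
  apply: memv_coefs; last by rewrite dT.
  move=> B /sT[[b1 b2 b3 b4] [b5 b6] [b7 b8] [b9 b10]]; rewrite mem_vzero /= andbT.
  move=> /and5P[/eqP h1 /eqP h2 /eqP h3 /eqP h4 /andP[/eqP h5 /eqP h6]].
  apply/matrixP; apply: ord4P; apply: ord4P; rewrite [RHS]mxE //.
  - by rewrite b7 h6 mul0r.
  - by rewrite b9 h3 mul0r.
  - by rewrite b8 h5 mul0r.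
  - by rewrite -b6.
  - by rewrite b10 h2 mul0r.
  by rewrite -b5.
have WS M : M \in S -> W M.
  move=> /ST H.
  have key (l : seq F) : l`_0 * (M i0 i0 + M i3 i3) + l`_1 * (M i1 i0 + c * M i3 i2) +
      l`_2 * (M i2 i0 + c * M i3 i1) + l`_3 * (M i1 i1 + M i2 i2) +
      l`_4 * (M i1 i3 + c * M i0 i2) + l`_5 * (M i2 i3 + c * M i0 i1) = 0.
    have [B BT /rowP EB] := onto (\row_k l`_k).
    have := H B BT; rewrite trace4.
    have [[b1 b2 b3 b4] [b5 b6] [b7 b8] [b9 b10]] := sT B BT.
    rewrite b1 b2 b3 b4 -b5 -b6 b7 b8 b9 b10.
    have B00 : B i0 i0 = l`_0 by move: (EB (@Ordinal 6 0 isT)); rewrite !mxE.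
    have B01 : B i0 i1 = l`_1 by move: (EB (@Ordinal 6 1 isT)); rewrite !mxE.
    have B02 : B i0 i2 = l`_2 by move: (EB (@Ordinal 6 2 isT)); rewrite !mxE.
    have B11 : B i1 i1 = l`_3 by move: (EB (@Ordinal 6 3 isT)); rewrite !mxE.
    have B31 : B i3 i1 = l`_4 by move: (EB (@Ordinal 6 4 isT)); rewrite !mxE.
    have B32 : B i3 i2 = l`_5 by move: (EB (@Ordinal 6 5 isT)); rewrite !mxE.
    by rewrite B00 B01 B02 B11 B31 B32 => E; rewrite -[RHS]E; ring.
  have eq2 (a b : F) : a + b = 0 -> b = a.
    by move/eqP; rewrite addrC (addr_eq0_2 char2) => /eqP.
  move: (key [:: 1]) (key [:: 0; 1]) (key [:: 0; 0; 1]) (key [:: 0; 0; 0; 1])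
    (key [:: 0; 0; 0; 0; 1]) (key [:: 0; 0; 0; 0; 0; 1]) => /=.
  rewrite !(mul0r, mul1r, addr0, add0r).
  by move=> /eq2 h1 /eq2 h2 /eq2 h3 /eq2 h4 /eq2 h5 /eq2 h6; split.
have SW M : W M -> M \in S.
  move=> [w1 w2 [w3 w4] [w5 w6]]; apply/ST => B /sT[[b1 b2 b3 b4] [b5 b6] [b7 b8] [b9 b10]].
  rewrite trace4 w1 w2 w3 w4 w5 w6 b1 b2 b3 b4 -b5 -b6 b7 b8 b9 b10.
  set x := B i0 i0 * M i0 i0 + B i1 i1 * M i1 i1 + c * (B i0 i1 * M i3 i2 + B i0 i2 * M i3 i1 +
    B i3 i2 * M i0 i1 + B i3 i1 * M i0 i2).
  by transitivity (x + x); [rewrite /x; ring|rewrite (addrr_pchar2 char2)].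
(* The basis [e0, e1, e3, c^-1 e2] is symplectic for [J]: it pairs [e0] with [e3] and [e1] with
   [c^-1 e2], both to 1. *)
pose R : 'M[F]_4 := mx4 [:: [:: 1]; [:: 0; 1]; [:: 0; 0; 0; 1]; [:: 0; 0; c^-1]].
have uR : R \in unitmx.
  apply: (proj1 (@mulmx1_unit _ _ _ (mx4 [:: [:: 1]; [:: 0; 1]; [:: 0; 0; 0; c]; [:: 0; 0; 1]]) _)).
  by apply/matrixP; apply: ord4P; apply: ord4P; entries; rewrite ?mulVf.
exists R => // N; split=> [/mem_B4E[[h1 h2] [h3 h4] h5 h6]|].
  apply/conjP => //; exists (mx4 [:: [:: N i0 i0; N i0 i1; c^-1 * N i0 i3; N i0 i2];
    [:: N i1 i0; N i1 i1; c^-1 * N i1 i3; N i1 i2];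
    [:: c * N i3 i0; c * N i3 i1; N i3 i3; c * N i3 i2];
    [:: N i2 i0; N i2 i1; c^-1 * N i2 i3; N i2 i2]]).
    by apply: SW; split; [| |split|split]; rewrite !mxE /= ?mulVKf // ?(h1, h2, h3, h4, h5, h6).
  by apply/matrixP; apply: ord4P; apply: ord4P; entries; rewrite ?mulKf // mulrC.
move=> /(conjP _ _ uR)[M /WS[w1 w2 [w3 w4] [w5 w6]] E].
have N00 : N i0 i0 = M i0 i0 by entry E i0 i0.
have N01 : N i0 i1 = M i0 i1 by entry E i0 i1.
have cK (x y : F) : x = y / c -> y = c * x by move=> ->; rewrite mulrC divfK.
apply/mem_B4E; split; [split|split|..].
- by entry E i2 i3; rewrite N00 w1.
- have cV : c^-1 != 0 by rewrite invr_eq0.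
  by entry E i3 i2; rewrite w2 mulrC => /(mulIf cV) <-; entry E i1 i1.
- by entry E i2 i2 => /cK ->; entry E i1 i0; rewrite w3.
- by entry E i3 i3; rewrite w6 mulKf // => <-; rewrite N01.
- by entry E i0 i2 => /cK ->; entry E i1 i3; rewrite w5.
by entry E i2 i1 => <-; entry E i3 i0; rewrite w4 mulKf.
Qed.

(** In characteristic 2 the square of an eigenvalue of a trace-zero block of size 2 is determined by
    the block, and squaring is injective: each block contributes at most one eigenvalue. *)
Lemma joint_two_spec M : M \in joint (sl F 2) (sl F 2) -> at_most_eigenvalues 2 M.
Proof.
move=> /mem_jointE[h1 h2 [h3 h4] [h5 h6]].
have sq a : eigenvalue M a ->
    (a ^+ 2 == M i0 i0 ^+ 2 + M i0 i1 * M i1 i0) || (a ^+ 2 == M i2 i2 ^+ 2 + M i2 i3 * M i3 i2).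
  have det2 (x y p q r : F) : (x != 0) || (y != 0) -> x * p + y * r = a * x ->
      x * q + y * p = a * y -> a ^+ 2 = p ^+ 2 + q * r.
    move=> xy e1 e2.
    have k1 : x * (a ^+ 2 + (p ^+ 2 + q * r)) = 0.
      transitivity ((a + p) * (a * x - x * p) + x * (q * r) + (p ^+ 2 * x + p ^+ 2 * x)); first by ring.
      rewrite (addrr_pchar2 char2) addr0 -e1 (addrC _ (y * r)) addrK.
      transitivity (r * (a * y) + y * (r * p) + r * (x * q)); first by ring.
      rewrite -e2; transitivity ((r * x * q + r * y * p) + (r * x * q + r * y * p)); first by ring.
      by rewrite (addrr_pchar2 char2).
    have k2 : y * (a ^+ 2 + (p ^+ 2 + q * r)) = 0.
      transitivity ((a + p) * (a * y - y * p) + y * (q * r) + (p ^+ 2 * y + p ^+ 2 * y)); first by ring.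
      rewrite (addrr_pchar2 char2) addr0 -e2 addrK.
      transitivity (q * (a * x) + x * (q * p) + q * (y * r)); first by ring.
      rewrite -e1; transitivity ((q * x * p + q * y * r) + (q * x * p + q * y * r)); first by ring.
      by rewrite (addrr_pchar2 char2).
    apply/eqP; rewrite -(addr_eq0_2 char2); apply/eqP; case/orP: xy => /mulfI; apply.
      by rewrite k1 mulr0.
    by rewrite k2 mulr0.
  move=> /eigenvalueP[v /rowP vM v0].
  have V i := vM i; move: (V i0) (V i1) (V i2) (V i3); rewrite !mxE !sum4.
  rewrite h3 h4 h5 h6 !mulr0 !addr0 -h1 -h2 => V0 V1 V2 V3.
  have [v01|v01] := boolP ((v 0 i0 != 0) || (v 0 i1 != 0)).
    by rewrite (det2 _ _ _ _ _ v01 V0 V1) eqxx.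
  have [v23|v23] := boolP ((v 0 i2 != 0) || (v 0 i3 != 0)).
    move: v01; rewrite negb_or !negbK => /andP[/eqP v0' /eqP v1'].
    rewrite v0' v1' !mul0r !add0r in V2 V3.
    by rewrite (det2 _ _ _ _ _ v23 V2 V3) eqxx orbT.
  case/negP: v0; apply/eqP/rowP; move: v01 v23; rewrite !negb_or !negbK.
  by move=> /andP[/eqP ? /eqP ?] /andP[/eqP ? /eqP ?]; apply: ord4P; rewrite mxE.
have inj (a b d : F) : a ^+ 2 == d -> b ^+ 2 == d -> a = b.
  move=> /eqP <- /eqP/esym/eqP; rewrite -subr_eq0 subr_sqr mulf_eq0 subr_eq0.
  by rewrite (addr_eq0_2 char2) orbb => /eqP.
case=> [|a [|b [|c s]]] //=; rewrite !inE !negb_or => /andP[/and3P[ab ac _]].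
move=> /andP[/andP[bc _] _] /and4P[/sq/orP a' /sq/orP b' /sq/orP c' _].
case: a' => a'; case: b' => b'; case: c' => c';
first [ by rewrite (inj _ _ _ a' b') eqxx in ab
      | by rewrite (inj _ _ _ a' c') eqxx in ac
      | by rewrite (inj _ _ _ b' c') eqxx in bc ].
Qed.

(** The joint is cut out by four zero entries and two trace conditions: 16 - 4 - 1 - 1 = 10. *)
Lemma exists_two_spec : exists2 J : {vspace 'M[F]_4}, two_spec J & (10 <= \dim J)%N.
Proof.
pose s := [:: (i2, i0); (i2, i1); (i3, i0); (i3, i1)].
exists (vzero F s :&: diag_eq F i0 i1 :&: diag_eq F i2 i3)%VS.
  move=> M; rewrite !memv_cap => /andP[/andP[Ms /diag_eqP h1] /diag_eqP h2].
  move: Ms; rewrite mem_vzero /= andbT => /and4P[/eqP ? /eqP ? /eqP ? /eqP ?].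
  by apply: joint_two_spec; apply/mem_jointE.
have d1 : (12 <= \dim (vzero F s))%N.
  have := dim_vzero s (fullv : {vspace 'M[F]_4}); rewrite capfv dimvf.
  rewrite (_ : dim _ = 12 + 4)%N // => H; rewrite -(leq_add2r 4) -H leq_add2l.
  exact: dim_coefs.
have step (U : {vspace 'M[F]_4}) i j : (\dim U <= (\dim (U :&: diag_eq F i j)).+1)%N.
  have := limg_ker_dim (linfun (pairing [:: delta_mx i i - delta_mx j j])) U => <-.
  rewrite -[X in (_ <= X)%N]addn1 leq_add2l; apply: leq_trans (dimvS (subvf _)) _.
  by rewrite dimvf /dim /=.
rewrite -2!ltnS; apply: leq_trans d1 _; apply: leq_trans (step _ i0 i1) _.
by rewrite ltnS; apply: step.
Qed.

Lemma two_spec_dim10 S : two_spec S -> \dim S = 10 ->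
  similar_sets S (joint (sl F 2) (sl F 2)) \/ similar_sets S (B4 F).
Proof.
move=> S2 dS; have [T + ST] := orthogonal_exists S.
rewrite dS => /(@addnI 10 _ 6) dT.
have gT : good T by split=> //; apply: (two_spec_pattern char2 cardF S2 ST).
have step P (W : {pred 'M[F]_4}) : P \in unitmx ->
    (exists2 R, R \in unitmx & forall N, (N \in W) <-> (N \in conj R (conj P S))) ->
    similar_sets S W.
  move=> uP [R uR H]; apply: (@similar_conj (R *m P)); first by rewrite unitmx_mul uR.
  by move=> N; rewrite -conj_comp.
case: (classification char2 cardF gT) => [[P [c [uP c0 sT]]]|[P uP bT]].
  right; apply: (step P _ uP); apply: (B4_conj c0 _ (orthogonal_conj uP ST) sT).
  by rewrite dim_conj.
left; apply: (step P _ uP); apply: (joint_conj _ (orthogonal_conj uP ST) bT).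
by rewrite dim_conj.
Qed.

Lemma similar_mem1 S (W : {pred 'M[F]_4}) : similar_sets S W -> 1%:M \in W -> 1%:M \in S.
Proof.
move=> [P uP H] /H[A AS E]; suff -> : 1%:M = A by [].
by rewrite -[A](mulKmx uP) -[P *m A](mulmxKV uP) -E mul1mx mulVmx.
Qed.

End Models.

(** * Reduction of the optimal case to dimension 10 *)

Theorem theorem1p11 (F : fieldType) (charF : 2%N \in [pchar F]%R)
    (cardF : card_gt F 2) (S : {vspace 'M[F]_4}) (optS : optimal_two_spec S) :
  similar_sets S (joint (sl F 2) (sl F 2)) \/ similar_sets S (B4 F).
Proof.
have [S2 maxS] := optS.
have [J J2 dJ] := exists_two_spec charF.
have := leq_trans dJ (maxS J J2); rewrite leq_eqVlt => /orP[/eqP dS|dS].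
  exact: two_spec_dim10.
(* A larger [S] would contain a space of dimension 10 avoiding the identity,
   which both models contain. *)
pose X := (S :\: <[1%:M : 'M[F]_4]>)%VS.
have dX : (10 <= \dim X)%N.
  rewrite -ltnS; apply: leq_trans dS _; rewrite -(dimv_cap_compl S <[1%:M]>%VS) addnC.
  rewrite -[X in (_ <= X)%N]addn1 leq_add2l; apply: leq_trans (dimvS (capvSr _ _)) _.
  by rewrite dim_vline leq_b1.
pose Y := take 10 (vbasis X).
have fY : free Y.
  have := basis_free (vbasisP X); rewrite -[tval _](cat_take_drop 10).
  exact: catl_free.
have YX : (<<Y>> <= X)%VS.
  by apply/span_subvP => A /mem_take; apply: vbasis_mem.
have Y2 : two_spec <<Y>>.
  by move=> A AY; apply: S2; apply: subvP AY; apply: subv_trans YX (diffvSl _ _).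
have dY : \dim <<Y>> = 10.
  by rewrite (eqP fY) size_takel // size_tuple.
have one : (1%:M : 'M[F]_4) \in <<Y>>%VS.
  case: (two_spec_dim10 charF cardF Y2 dY) => /similar_mem1; apply.
    by apply/(mem_jointE charF); split; rewrite ?mxE.
  by apply/(mem_B4E charF); rewrite !mxE.
have : (1%:M : 'M[F]_4) \in (X :&: <[1%:M]>)%VS by rewrite memv_cap memv_line (subvP YX).
rewrite capv_diff memv0 => /eqP/matrixP/(_ i0 i0)/eqP.
by rewrite !mxE oner_eq0.
Qed.
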